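(* Let $d\ge1$ and let $B>0$ be a constant. There exists a sequence $\mathscr{E}$ of sieve maximum likelihood estimators such that, for every $\alpha\in(0,1)$, there are constants $C,k>0$ (depending only on $d$, $B$, $\alpha$) for which every $p\in\mathcal{D}_{\mathrm{Box},\mathrm{Lip},B}\setminus\mathcal{L}$ satisfies $$\mathbb{E}_{P^\infty}[\tau_\alpha]\le C\,d_H(p,\mathcal{L})^{-2(d+3)}\left(1+|\log d_H(p,\mathcal{L})|\right)^k,$$ i.e. $\mathbb{E}[\tau_\alpha]=\widetilde{O}\left(d_H(p,\mathcal{L})^{-2(d+3)}\right)$, where $\tau_\alpha$ is the rejection time of the universal likelihood ratio test using $\mathscr{E}$.
   Context: $X_1,X_2,\dots$ are $\mathbb{R}^d$-valued observations and $P^\infty$ is the law of an i.i.d. sequence from the law $P$ with density $p$. $\mathcal{D}$ is the set of probability laws on $\mathbb{R}^d$ with a Lebesgue density; laws are identified with their densities. $\mathcal{D}_{\mathrm{Box},\mathrm{Lip},B}$ is the set of probability densities supported on $[-1,1]^d$ that are $1$-Lipschitz on $[-1,1]^d$ and take values in $[1/B,B]$ there. $\mathcal{L}\subset\mathcal{D}$ is the set of laws with log-concave density ($e^g$ with $g$ concave, value $-\infty$ allowed). $d_H$ is the Hellinger distance, $d_H(p,q)=\|\sqrt p-\sqrt q\|_{L_2(\mathbb{R}^d)}$, and $d_H(p,\mathcal{L})=\inf_{q\in\mathcal{L}}d_H(p,q)$. A sequential estimator is a sequence $\mathscr{E}=\{\mathscr{E}_t\}_{t\ge0}$ of (measurable)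 maps $\mathscr{E}_t:(\mathbb{R}^d)^t\to\mathcal{D}$; write $\hat q_t=\mathscr{E}_t(X_1,\dots,X_t)$. It is a sequence of sieve maximum likelihood estimators if there are prescribed sets $\mathcal{S}_t\subset\mathcal{D}$ (not depending on the data or on the unknown $p$) such that $\hat q_t$ maximises $\sum_{s\le t}\log q(X_s)$ over $q\in\mathcal{S}_t$. For $t\ge d+1$, $\hat p_t$ is the log-concave maximum likelihood estimate from $X_1,\dots,X_t$, i.e. the maximiser of $\sum_{s\le t}\log f(X_s)$ over log-concave probability densities $f$ (it exists and is unique a.s. under $P^\infty$, $P\in\mathcal{D}$). The universal likelihood ratio (ULR) process is $R_t=1$ for $t\le d$ and $R_t=\prod_{d+1\le s\le t}\hat q_{s-1}(X_s)/\hat p_t(X_s)$ for $t>d$; its rejection time at level $\alpha$ is $\tau_\alpha=\inf\{t\ge1:R_t\ge1/\alpha\}$. *)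

(* Defs.v *)
From HB Require Import structures.
From mathcomp Require Import all_boot all_order all_algebra.
From mathcomp Require Import all_classical all_reals all_analysis.

Set Implicit Arguments.
Unset Strict Implicit.
Unset Printing Implicit Defensive.

Import Order.TTheory GRing.Theory Num.Theory.
Import numFieldNormedType.Exports.

Local Open Scope classical_set_scope.
Local Open Scope ring_scope.

(** R^d is [d.-tuple R], which carries the product Borel sigma-algebra; a sample
    of size [t] is a [t.-tuple (d.-tuple R)].  Laws in D are represented by their
    densities, i.e. by real-valued functions on R^d. *)

Section lebesgue_measure_on_Rd.
Context {R : realType}.

Definition cons_pair (n : nat) (z : measurableTypeR R * n.-tuple R) :
  n.+1.-tuple R := [tuple of (z.1 : R) :: z.2].

Lemma measurable_cons_pair (n : nat) : measurable_fun setT (@cons_pair n).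
Proof.
exact: (measurable_cons (f := fun z : measurableTypeR R * n.-tuple R => z.1 : R)
  measurable_fst measurable_snd).
Qed.

Lemma sigma_finite_cons_pair (n : nat)
    (m : {measure set (measurableTypeR R * n.-tuple R) -> \bar R}) :
  sigma_finite setT m -> sigma_finite setT (pushforward m (@cons_pair n)).
Proof.
move=> [F FT Ffin].
pose u (x : n.+1.-tuple R) : measurableTypeR R * n.-tuple R :=
  (thead x, [tuple of behead x]).
have mu_ : measurable_fun setT u.
  by apply: measurable_fun_pair; [exact: (measurable_tnth (T := R) ord0)|
    exact: (measurable_behead (T := R))].
have uK z : u (cons_pair z) = z.
  by case: z => a b; congr pair; apply/val_inj.
exists (fun i => u @^-1` F i).
  by rewrite -preimage_bigcup -FT preimage_setT.
move=> i; have [mF Foo] := Ffin i; split.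
  by rewrite -[X in measurable X]setTI; exact: mu_.
rewrite /pushforward -comp_preimage (_ : u \o _ = id) ?preimage_id//.
by apply/funext => z /=; rewrite uK.
Qed.

Section step.
Variables (n : nat) (m : {sigma_finite_measure set (n.-tuple R) -> \bar R}).

Definition lebesgue_step : set (n.+1.-tuple R) -> \bar R :=
  pushforward (lebesgue_measure \x m)%E (@cons_pair n).

HB.instance Definition _ := Measure.copy lebesgue_step
  (measure_function_pushforward__canonical__measure_function_Measure
    (lebesgue_measure \x m)%E (@measurable_cons_pair n)).

Let lebesgue_step_sigma_finite : sigma_finite setT lebesgue_step.
Proof.
apply: (sigma_finite_cons_pair (m := (lebesgue_measure \x m)%E)).
have /sigma_finiteP[F [TF ndF Foo]] := sigma_finiteT (@lebesgue_measure R).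
have /sigma_finiteP[G [TG ndG Goo]] := sigma_finiteT m.
exists (fun k => F k `*` G k).
  rewrite -setXTT TF TG predeqE => -[x y]; split.
    move=> [/= [k _ Fkx] [l _ Gly]]; exists (maxn k l) => //; split.
      by move: x Fkx; exact/subsetPset/ndF/leq_maxl.
    by move: y Gly; exact/subsetPset/ndG/leq_maxr.
  by move=> [k _ []/= ? ?]; split; exists k.
move=> k; have [mF Fk] := Foo k; have [mG Gk] := Goo k.
split; first exact: measurableX.
rewrite [X in (X < _)%E](product_measure1E lebesgue_measure m mF mG).
by rewrite lte_mul_pinfty// ge0_fin_numE.
Qed.

HB.instance Definition _ := Measure_isSigmaFinite.Build _ _ _ lebesgue_step
  lebesgue_step_sigma_finite.
End step.

(** Lebesgue measure on R^d, as the d-fold product of [lebesgue_measure]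
    (a point mass on the one-point space R^0). *)
Fixpoint lebesgue_Rd (d : nat) :
    {sigma_finite_measure set (d.-tuple R) -> \bar R} :=
  match d with
  | 0 => \d_([tuple] : 0.-tuple R)
  | n.+1 => lebesgue_step (lebesgue_Rd n)
  end.

End lebesgue_measure_on_Rd.

Section densities.
Context {R : realType} {d : nat}.
Implicit Types (p q f : d.-tuple R -> R) (x y : d.-tuple R).

Definition density p : Prop :=
  [/\ forall x, 0 <= p x, measurable_fun setT p &
      (\int[lebesgue_Rd d]_x (p x)%:E = 1)%E].

Definition euclidean_dist x y : R :=
  Num.sqrt (\sum_(i < d) (tnth x i - tnth y i) ^+ 2).

Definition box : set (d.-tuple R) := [set x | forall i, -1 <= tnth x i <= 1].

Definition box_lip_density (B : R) p : Prop :=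
  [/\ density p,
      forall x, ~ box x -> p x = 0,
      forall x y, box x -> box y -> `|p x - p y| <= euclidean_dist x y &
      forall x, box x -> B^-1 <= p x <= B].

Definition concave_fun (g : d.-tuple R -> \bar R) : Prop :=
  forall x y (s : R), 0 <= s <= 1 ->
    (s%:E * g x + (1 - s)%:E * g y <=
     g [tuple (s * tnth x i + (1 - s) * tnth y i)%R | i < d])%E.

(** As [p] is real-valued, the exponent [g] never takes the value [+oo]. *)
Definition logconcave_density p : Prop :=
  density p /\
  exists2 g : d.-tuple R -> \bar R,
    concave_fun g & forall x, (p x)%:E = expeR (g x).

(** Membership of the law with density [p] in the class of log-concave laws:
    densities of a law are only determined almost everywhere. *)
Definition logconcave_law p : Prop :=
  exists2 q, logconcave_density q & {ae lebesgue_Rd d, forall x, p x = q x}.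

Definition hellinger p q : \bar R :=
  ('N[lebesgue_Rd d]_2%:E[ (fun x => (Num.sqrt (p x) - Num.sqrt (q x))%R%:E) ])%E.

Definition hellinger_logconcave p : R :=
  fine (ereal_inf [set hellinger p q | q in logconcave_density]).

(** [lne 0 = -oo], so that the log-likelihood lives in [\bar R]. *)
Definition loglik (t : nat) (xs : t.-tuple (d.-tuple R)) q : \bar R :=
  (\sum_(s < t) lne (q (tnth xs s))%:E)%E.

Definition is_mle (F : set (d.-tuple R -> R)) (t : nat)
    (xs : t.-tuple (d.-tuple R)) q : Prop :=
  F q /\ forall f, F f -> (loglik xs f <= loglik xs q)%E.

End densities.

Definition estimator_seq (R : realType) (d : nat) : Type :=
  forall t : nat, t.-tuple (d.-tuple R) -> d.-tuple R -> R.

Section ulr.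
Context {R : realType} {d : nat}.
Implicit Types (E phat : estimator_seq R d).

(** Measurability of a density-valued map is joint measurability in the sample
    and in the point at which the estimated density is evaluated. *)
Definition sequential_estimator E : Prop :=
  forall t, (forall xs, density (E t xs)) /\
    measurable_fun setT
      (fun z : t.-tuple (d.-tuple R) * d.-tuple R => E t z.1 z.2).

Definition sieve_mle_seq E : Prop :=
  exists2 S : nat -> set (d.-tuple R -> R),
    forall t, S t `<=` density &
    forall t (xs : t.-tuple (d.-tuple R)), is_mle (S t) xs (E t xs).

(** [phat t xs] is a log-concave maximum likelihood estimate for every sample
    [xs] of size at least d+1 that admits one (almost every sample does, and the
    values of the estimate at the sample points are then unique); it is
    arbitrary on the other samples. *)
Definition logconcave_mle_seq phat : Prop :=
  forall t (xs : t.-tuple (d.-tuple R)), (d < t)%N ->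
    (exists f, is_mle logconcave_density xs f) ->
    is_mle logconcave_density xs (phat t xs).

(** Sequences of observations are indexed from 0: [x i] is the (i+1)-st
    observation. *)
Definition sample (x : nat -> d.-tuple R) (t : nat) : t.-tuple (d.-tuple R) :=
  [tuple x i | i < t].

Definition ulr E phat (x : nat -> d.-tuple R) (t : nat) : R :=
  if (t <= d)%N then 1 else
  \prod_(d <= i < t) (E i (sample x i) (x i) / phat t (sample x t) (x i)).

Definition rejection_time E phat (alpha : R) (x : nat -> d.-tuple R) : \bar R :=
  ereal_inf [set t%:R%:E | t in
    [set t : nat | (1 <= t)%N /\ alpha^-1 <= ulr E phat x t]].

End ulr.

Definition iid_with_density (R : realType) (d : nat) (dT : measure_display)
    (T : measurableType dT) (P : probability T R)
    (X : nat -> {RV P >-> d.-tuple R}) (p : d.-tuple R -> R) : Prop :=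
  (forall i (A : set (d.-tuple R)), measurable A ->
     distribution P (X i) A = (\int[lebesgue_Rd d]_(x in A) (p x)%:E)%E) /\
  (forall n (A : nat -> set (d.-tuple R)), (forall i, measurable (A i)) ->
     P (\bigcap_(i in `I_n) (X i @^-1` A i)) =
     (\prod_(i < n) P (X i @^-1` A i))%E).

(* Main.v *)
Require Import Defs.
From HB Require Import structures.
From mathcomp Require Import all_boot all_order all_algebra.
From mathcomp Require Import all_classical all_reals all_analysis.
From mathcomp Require Import measurable_realfun.
From mathcomp Require Import ring lra.
From mathcomp Require Import zify.

(** Let [delta] be the Hellinger distance of [p] to the log-concave class.  The
    test statistic is a quotient of two likelihoods, and both are compared with
    the likelihood of [p] itself.

    The denominator is the largest log-concave likelihood.  A single density [q]
    with affinity [\int sqrt (p q) <= 1 - delta^2 / 2] has, by Chernoff's bound,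
    a likelihood that is exponentially smaller than that of [p].  The bound is
    made uniform over the class by bracketing ([bracket_sum_le]): the level sets
    of a log-concave function are convex, and a convex set has a boundary that
    meets only O(N^(d-1)) of the N^d cells of a grid ([card_boundary_cells]), so
    that the square root of a truncated log-concave density is dominated by one
    of (A N + 1)^(N^d) step functions, which exceeds it by O(1/N) in the mean.
    Truncation costs nothing, since a log-concave density with a very high peak
    is concentrated near that peak and is tiny at most of the observations
    ([large_maximum_event]).  Together: [uniform_likelihood_bound].

    The numerator is the predictive likelihood of an estimator that may be
    chosen.  Time is cut into epochs, the j-th of which starts at
    16 * 2^(j(d+3)); during that epoch the estimator is the maximum likelihood
    step density on the grid with 2^j cells per axis, among the step densities
    whose cell weights stay above a small floor.  This estimator dominates, up
    to a factor 1 - O(2^-j) per observation, the Laplace rule of succession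
    ([floored_ge_laplace]), which loses only a polynomial factor against every
    law on the cells ([laplace_ge]); and a Lipschitz density is a step density
    up to relative error O(2^-j).  In all, the numerator is at least
    exp (- D 2^(m(d+2))) times the likelihood of [p] up to the end of the m-th
    epoch ([regret_bound]).

    With about 2^(m(d+3)) observations, the gain delta^2 2^(m(d+3)) in the
    denominator exceeds the regret and the logarithm of the number of brackets
    as soon as delta^2 >= C / 2^m.  From the first such epoch on, that is from a
    time of order delta^(-2(d+3)), each single time rejects except on an event
    of probability O(2^m exp (- 2^m)) ([rejection_after_epoch]), and these
    probabilities are summable ([integral_time_le]).

    Three facts complete the argument: [delta] is positive when [p] is not
    log-concave ([delta_gt0]); a log-concave maximum likelihood estimate exists
    as soon as the sample meets every corner of the box
    ([logconcave_mle_exists]); and the integral of a nonnegative function, being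
    a supremum over simple functions, is monotone even when the functions fail
    to be measurable, which matters because the estimates are only constrained
    by their maximality. *)

Import Order.TTheory GRing.Theory Num.Theory.
Import numFieldNormedType.Exports.

Set Implicit Arguments.
Unset Strict Implicit.
Unset Printing Implicit Defensive.

Local Open Scope classical_set_scope.
Local Open Scope ring_scope.

(** * Boxes in R^d *)

Section rect.
Context {R : realType}.

Definition rect (d : nat) (I : 'I_d -> set R) : set (d.-tuple R) :=
  [set x | forall i, I i (tnth x i)].

Lemma measurable_rect d (I : 'I_d -> set R) :
  (forall i, measurable (I i)) -> measurable (rect I).
Proof.
move=> mI; have -> : rect I = \bigcap_(i in [set: 'I_d]) ((@tnth d R)^~ i @^-1` I i).
  by apply/seteqP; split=> x /= H => [i _|i]; exact: H.
apply: fin_bigcap_measurable => [|i _]; first exact: finite_finset.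
rewrite -[X in measurable X]setTI.
exact: (measurable_tnth (T := R) i).
Qed.

Lemma lebesgue_rect d (I : 'I_d -> set R) :
  (forall i, measurable (I i)) ->
  lebesgue_Rd d (rect I) = (\prod_(i < d) lebesgue_measure (I i))%E.
Proof.
elim: d I => [|d IH] I mI.
  rewrite big_ord0 /= diracE mem_set//.
  by move=> [].
rewrite big_ord_recl -(IH (fun i => I (lift ord0 i))); last by move=> i; exact: mI.
rewrite /= /lebesgue_step /pushforward.
have -> : @cons_pair R d @^-1` rect I = I ord0 `*` rect (fun i => I (lift ord0 i)).
  apply/seteqP; split=> -[a x] /=.
    move=> H; split; first by have := H ord0; rewrite tnth0.
    by move=> i; have := H (lift ord0 i); rewrite tnthS.
  move=> [/= Ha Hx] i; case: (unliftP ord0 i) => [j|] ->; last by rewrite tnth0.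
  by rewrite tnthS; exact: Hx.
rewrite product_measure1E//; first exact: mI.
by apply: measurable_rect => i; exact: mI.
Qed.

End rect.

(** * Convex sets and grids of cubes *)

Section convex.
Context {R : realType}.

Definition comb (d : nat) (s : R) (x y : d.-tuple R) : d.-tuple R :=
  [tuple s * tnth x i + (1 - s) * tnth y i | i < d].

Lemma tnth_comb d s (x y : d.-tuple R) i :
  tnth (comb s x y) i = s * tnth x i + (1 - s) * tnth y i.
Proof. by rewrite tnth_mktuple. Qed.

Definition convex_Rd (d : nat) (K : set (d.-tuple R)) : Prop :=
  forall x y s, 0 <= s <= 1 -> K x -> K y -> K (comb s x y).

Lemma between_comb (a b c : R) : a <= c <= b ->
  exists2 s, 0 <= s <= 1 & s * b + (1 - s) * a = c.
Proof.
move=> /andP[ac cb]; have [ab|/eqP ab] := eqVneq a b.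
  by exists 0; [lra|rewrite -ab in cb; lra].
have ab' : 0 < b - a by lra.
exists ((c - a) / (b - a)).
  by apply/andP; split; [apply: divr_ge0; lra|rewrite ler_pdivrMr//; lra].
by field; rewrite gt_eqF.
Qed.

(** If a convex set meets each of the 2^d regions beyond the corners of a box,
    it contains the box: convex combinations of two of these points fix the
    coordinates of the target one after the other. *)
Lemma convex_contains_box d (K : set (d.-tuple R)) (lo hi : 'I_d -> R) :
  (forall i, lo i <= hi i) -> convex_Rd K ->
  (forall sg : {ffun 'I_d -> bool}, exists2 y, K y &
     forall i, if sg i then hi i <= tnth y i else tnth y i <= lo i) ->
  forall c, (forall i, lo i <= tnth c i <= hi i) -> K c.
Proof.
move=> lohi cK Ky c hc.
have step m : (m <= d)%N -> forall sg : {ffun 'I_d -> bool}, exists2 y, K y &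
    forall i : 'I_d, if (i < m)%N then tnth y i = tnth c i else
      if sg i then hi i <= tnth y i else tnth y i <= lo i.
  elim: m => [|m IH] md sg; first by have [y Hy1 Hy2] := Ky sg; exists y.
  pose om := Ordinal md.
  pose sgb b := [ffun i : 'I_d => if i == om then b else sg i].
  have [y1 Ky1 H1] := IH (ltnW md) (sgb true).
  have [y0 Ky0 H0] := IH (ltnW md) (sgb false).
  have := H1 om; have := H0 om; rewrite !ltnn !ffunE !eqxx /= => h0 h1.
  have /andP[c1 c2] := hc om.
  have [|s s01 sE] := @between_comb (tnth y0 om) (tnth y1 om) (tnth c om).
    by apply/andP; split; [exact: le_trans h0 _|exact: le_trans h1].
  exists (comb s y1 y0); first exact: cK.
  move=> i; rewrite tnth_comb ltnS leq_eqVlt.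
  have [->|iom] := eqVneq i om; first by rewrite eqxx /= sE.
  have -> : (i == m :> nat) = false.
    by apply/negbTE; apply: contra iom => /eqP im; apply/eqP/val_inj.
  move: (H1 i) (H0 i); rewrite !ffunE (negbTE iom) /=.
  case: (i < m)%N => [-> ->|]; first by ring.
  by case/andP: s01 => ? ?; case: (sg i) => ? ?; nra.
have [y Ky' yc] := step d (leqnn d) [ffun => true].
suff -> : c = y by [].
by apply: eq_from_tnth => i; have := yc i; rewrite ltn_ord.
Qed.

(** The closed cube of side [h] whose lower corner has grid coordinates [a]. *)
Definition ccell (d : nat) (h : R) (a : 'I_d -> R) : set (d.-tuple R) :=
  rect (fun i => `[-1 + h * a i, -1 + h * (a i + 1)]%classic).

Definition touches d (K : set (d.-tuple R)) h a : Prop :=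
  exists2 y, K y & ccell h a y.

Definition sgnb (b : bool) : R := if b then 1 else -1.

(** A cell whose 2^d diagonal neighbours are all touched lies between them. *)
Lemma touched_neighbours d (K : set (d.-tuple R)) h (a : 'I_d -> R) :
  0 < h -> convex_Rd K ->
  (forall sg : {ffun 'I_d -> bool}, touches K h (fun i => a i + sgnb (sg i))) ->
  ccell h a `<=` K.
Proof.
move=> h0 cK tK c hc.
apply: (@convex_contains_box _ _ (fun i => -1 + h * a i)
  (fun i => -1 + h * (a i + 1))) => // [i|sg].
- by nra.
- have [y Ky hy] := tK sg; exists y => // i.
  have := hy i; rewrite /= in_itv /= /sgnb => /andP[].
  by case: (sg i) => y1 y2; nra.
Qed.

(** The touched cells are contiguous along a line of cells, because an
    intermediate cell contains a convex combination of points of the end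
    cells. *)
Lemma touched_diagonal d (K : set (d.-tuple R)) h (a e : 'I_d -> R) (j : R) :
  0 < h -> convex_Rd K -> 1 <= j -> touches K h a ->
  touches K h (fun i => a i + j * e i) -> touches K h (fun i => a i + e i).
Proof.
move=> h0 cK j1 [y Ky hy] [z Kz hz]; have j0 : 0 < j by lra.
have s01 : 0 <= j^-1 <= 1 by rewrite invr_ge0 ltW//= invf_le1.
exists (comb j^-1 z y); first exact: cK.
move=> i; rewrite /= in_itv /= tnth_comb.
have /= := hy i; have /= := hz i; rewrite !in_itv /=.
set s := j^-1 in s01 *; have sj : s * j = 1 by rewrite mulVf// gt_eqF.
move=> /andP[z1 z2] /andP[y1 y2]; case/andP: s01 => s0 s1.
have sjE : s * (j * e i) = e i by rewrite mulrA sj mul1r.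
have -> : -1 + h * (a i + e i) =
  s * (-1 + h * (a i + j * e i)) + (1 - s) * (-1 + h * a i).
  by rewrite -[in LHS]sjE; ring.
have -> : -1 + h * (a i + e i + 1) =
  s * (-1 + h * (a i + j * e i + 1)) + (1 - s) * (-1 + h * (a i + 1)).
  by rewrite -[in LHS]sjE; ring.
by apply/andP; split; apply: lerD; apply: ler_wpM2l => //; lra.
Qed.

Definition gridc (d N : nat) (k : {ffun 'I_d -> 'I_N}) : 'I_d -> R :=
  fun i => (k i)%:R.

Definition boundary_cells (d N : nat) (h : R) (K : set (d.-tuple R)) :
  {set {ffun 'I_d -> 'I_N}} :=
  [set k | `[< touches K h (gridc k) >] && ~~ `[< ccell h (gridc k) `<=` K >]].

(** Every boundary cell has an untouched diagonal neighbour, in one of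
    [2 ^ d.+1] directions.  On a line of cells in that direction, the touched
    cells are contiguous, so at most one of them has an untouched successor; and
    the lines are parametrised by [d] coordinates with [2 * N.+1] values. *)
Lemma card_boundary_cells (d N : nat) (h : R) (K : set (d.+1.-tuple R)) :
  0 < h -> convex_Rd K ->
  (#|boundary_cells N.+1 h K| <= 2 ^ d.+1 * (2 * N.+1) ^ d)%N.
Proof.
move=> h0 cK.
pose untouched (k : {ffun 'I_d.+1 -> 'I_N.+1}) (sg : {ffun 'I_d.+1 -> bool}) :=
  ~~ `[< touches K h (fun i => gridc k i + sgnb (sg i)) >].
pose dir k : {ffun 'I_d.+1 -> bool} := odflt [ffun=> true] [pick sg | untouched k sg].
have dirP k : k \in boundary_cells N.+1 h K -> untouched k (dir k).
  rewrite inE => /andP[/asboolP tk /asboolP nk]; rewrite /dir; case: pickP => //= H.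
  case: nk; apply: touched_neighbours => // sg.
  by have /negbFE/asboolP := H sg.
(* The coordinates relative to the first one, which are constant along the
   diagonal of direction [sg]; [N.+1] is added to avoid truncated subtraction. *)
pose line (sg : {ffun 'I_d.+1 -> bool}) (k : {ffun 'I_d.+1 -> 'I_N.+1}) :=
  [ffun i : 'I_d => inord (if sg (lift ord0 i) == sg ord0
     then k (lift ord0 i) + N.+1 - k ord0 else k (lift ord0 i) + k ord0)%N
     : 'I_(N + N.+1).+1].
have lineE sg k k' : line sg k = line sg k' -> forall i,
    (k' i)%:R - (k i)%:R = ((k' ord0)%:R - (k ord0)%:R) * sgnb (sg ord0) * sgnb (sg i).
  move=> kk i; case: (unliftP ord0 i) => [j|] ->; last first.
    by rewrite -mulrA; case: (sg ord0); rewrite /sgnb; ring.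
  move/ffunP/(_ j)/(congr1 (@nat_of_ord _)): kk; rewrite !ffunE.
  have := ltn_ord (k ord0); have := ltn_ord (k' ord0).
  have := ltn_ord (k (lift ord0 j)); have := ltn_ord (k' (lift ord0 j)).
  move=> ? ? ? ?; case: eqP => [->|].
    rewrite !inordK; [|lia|lia] => e.
    have {}e : (k (lift ord0 j) + k' ord0 = k' (lift ord0 j) + k ord0)%N by lia.
    have := congr1 (fun n => n%:R : R) e; rewrite !natrD => {}e.
    have -> : forall u b, u * sgnb b * sgnb b = u by move=> u []; rewrite /sgnb; ring.
    by lra.
  rewrite !inordK; [|lia|lia] => sgE e.
  have := congr1 (fun n => n%:R : R) e; rewrite !natrD => {}e.
  have -> : sgnb (sg (lift ord0 j)) = - sgnb (sg ord0).
    by case: (sg ord0) (sg (lift ord0 j)) sgE => -[] //; rewrite /sgnb opprK.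
  have -> : forall u b, u * sgnb b * - sgnb b = - u by move=> u []; rewrite /sgnb; ring.
  by lra.
(* A step of length at least 1 along the diagonal from a touched cell whose next
   neighbour is untouched cannot end in a touched cell. *)
have nostep sg k k' : untouched k sg -> touches K h (gridc k) ->
    touches K h (gridc k') -> line sg k = line sg k' ->
    ~ 1 <= ((k' ord0)%:R - (k ord0)%:R) * sgnb (sg ord0).
  move=> /asboolPn uk tk tk' kk z1; apply: uk.
  apply: (touched_diagonal h0 cK z1 tk).
  suff -> : (fun i => gridc k i + ((k' ord0)%:R - (k ord0)%:R) * sgnb (sg ord0) *
    sgnb (sg i)) = gridc k' by [].
  by apply/funext => i; rewrite -(lineE _ _ _ kk) /gridc; ring.
have inj : {in boundary_cells N.+1 h K &, injective (fun k => (dir k, line (dir k) k))}.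
  move=> k k' kB k'B [dE lE]; rewrite -dE in lE.
  have uk := dirP _ kB; have uk' := dirP _ k'B; rewrite -dE in uk'.
  move: kB k'B; rewrite !inE => /andP[/asboolP tk _] /andP[/asboolP tk' _].
  have := nostep _ _ _ uk tk tk' lE; have := nostep _ _ _ uk' tk' tk (esym lE).
  move=> n1 n2; have e0 : k ord0 = k' ord0.
    apply/val_inj/eqP; rewrite eqn_leq; apply/andP; split; rewrite leqNgt; apply/negP => lt.
      have : (k' ord0).+1%:R <= (k ord0)%:R :> R by rewrite ler_nat.
      rewrite -natr1; case: (dir k ord0) n1 n2; rewrite /sgnb => n1 n2 ?.
        by apply: n1; lra.
      by apply: n2; lra.
    have : (k ord0).+1%:R <= (k' ord0)%:R :> R by rewrite ler_nat.
    rewrite -natr1; case: (dir k ord0) n1 n2; rewrite /sgnb => n1 n2 ?.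
      by apply: n2; lra.
    by apply: n1; lra.
  apply/ffunP => i; apply/val_inj/eqP; have := lineE _ _ _ lE i.
  by rewrite e0 subrr !mul0r => /eqP; rewrite subr_eq0 eqr_nat eq_sym.
rewrite -(card_in_imset inj).
apply: leq_trans (max_card _) _.
rewrite card_prod !card_ffun !card_ord card_bool.
by have -> : (2 * N.+1 = (N + N.+1).+1)%N by lia.
Qed.

End convex.

(** * The regular grid on the box *)

Section grid.
Context {R : realType}.

(** Grids have [N.+1] cells per axis, so that no grid is empty. *)
Definition wd (N : nat) : R := 2 / N.+1%:R.

Lemma wd_gt0 N : 0 < wd N.
Proof. by rewrite divr_gt0. Qed.

Lemma wdN N : wd N * N.+1%:R = 2.
Proof. by rewrite mulfVK// pnatr_eq0. Qed.

(** The minimum puts the end point 1 into the last cell. *)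
Definition axis_idx (N : nat) (r : R) : 'I_N.+1 :=
  inord (minn N (Num.truncn ((r + 1) / wd N))).

Definition axis_cell (N : nat) (j : 'I_N.+1) : set R :=
  [set r | -1 <= r <= 1 /\ axis_idx N r = j].

Definition cidx (d N : nat) (x : d.-tuple R) : {ffun 'I_d -> 'I_N.+1} :=
  [ffun i => axis_idx N (tnth x i)].

Definition gcell (d N : nat) (k : {ffun 'I_d -> 'I_N.+1}) : set (d.-tuple R) :=
  rect (fun i => axis_cell (k i)).

Lemma axis_cellE N (j : 'I_N.+1) : axis_cell j =
  if (j < N)%N then `[-1 + wd N * j%:R, -1 + wd N * (j%:R + 1)[%classic
  else `[-1 + wd N * j%:R, -1 + wd N * (j%:R + 1)]%classic.
Proof.
have w0 := wd_gt0 N; have wN := wdN N.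
have trunc_bounds r : -1 <= r <= 1 -> let t := Num.truncn ((r + 1) / wd N) in
    wd N * t%:R <= r + 1 < wd N * (t%:R + 1).
  move=> /andP[r1 r2] /=; set t := Num.truncn _.
  have /truncn_itv : 0 <= (r + 1) / wd N by rewrite divr_ge0//; [lra|exact: ltW].
  by rewrite -/t -natr1 ler_pdivlMr// ltr_pdivrMr// ![wd N * _]mulrC.
have idxE r : axis_idx N r = minn N (Num.truncn ((r + 1) / wd N)) :> nat.
  by rewrite inordK// ltnS geq_minl.
have jN : wd N * (j%:R + 1) <= 2.
  by rewrite -wN ler_pM2l// natr1 ler_nat.
have j0 : 0 <= wd N * j%:R by rewrite mulr_ge0// ltW.
apply/seteqP; split=> r.
  move=> [r11 /(congr1 (@nat_of_ord _))]; rewrite idxE => jE.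
  have /= := trunc_bounds r r11; set t := Num.truncn _ in jE *; move=> /andP[t1 t2].
  case: ifPn => jN'; rewrite /= in_itv /=; last first.
    have jE' : j = N :> nat by have := ltn_ord j; lia.
    rewrite jE' natr1 wN; apply/andP; split; last by lra.
    have : wd N * N%:R <= wd N * t%:R by rewrite ler_pM2l// ler_nat; lia.
    by lra.
  have -> : j = t :> nat by lia.
  by apply/andP; split; lra.
have jN'' : (N <= j)%N -> j = N :> nat by have := ltn_ord j; lia.
case: ifPn => jN'; rewrite /= in_itv /= => /andP[r1 r2].
  have r11 : -1 <= r <= 1 by apply/andP; split; lra.
  split; first exact: r11.
  apply: ord_inj; rewrite idxE.
  suff -> : Num.truncn ((r + 1) / wd N) = j by lia.
  apply: truncn_def; rewrite -natr1 ler_pdivlMr// ltr_pdivrMr//.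
  by apply/andP; split; lra.
have r11 : -1 <= r <= 1 by apply/andP; split; lra.
have {}jN' : j = N :> nat by apply: jN''; rewrite leqNgt.
split; first exact: r11.
apply: ord_inj; rewrite idxE jN'.
apply/minn_idPl; rewrite -ltnS -(ltr_nat R).
have /= := trunc_bounds r r11; set t := Num.truncn _; rewrite natr1 => /andP[_ t2].
rewrite -(ltr_pM2l w0); apply: le_lt_trans t2.
by move: r1; rewrite jN'; lra.
Qed.

Lemma measurable_axis_cell N (j : 'I_N.+1) : measurable (axis_cell j).
Proof. by rewrite axis_cellE; case: ifP. Qed.

Lemma lebesgue_axis_cell N (j : 'I_N.+1) :
  lebesgue_measure (axis_cell j) = (wd N)%:E.
Proof.
have w0 := wd_gt0 N.
by rewrite axis_cellE; case: ifP => _; rewrite lebesgue_measure_itv /= lte_fin;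
  (case: ifPn => [_|]; [rewrite -EFinB; congr EFin; ring|by move=> /negP[]; nra]).
Qed.

Lemma measurable_gcell d N (k : {ffun 'I_d -> 'I_N.+1}) : measurable (gcell k).
Proof. by apply: measurable_rect => i; exact: measurable_axis_cell. Qed.

Lemma lebesgue_gcell d N (k : {ffun 'I_d -> 'I_N.+1}) :
  lebesgue_Rd d (gcell k) = (wd N ^+ d)%:E.
Proof.
rewrite lebesgue_rect => [|i]; last exact: measurable_axis_cell.
under eq_bigr do rewrite lebesgue_axis_cell.
by rewrite prodEFin prodr_const card_ord.
Qed.

Lemma lebesgue_cube d (l : 'I_d -> R) (h : R) : 0 <= h ->
  lebesgue_Rd d (rect (fun i => `[l i, l i + h]%classic)) = (h ^+ d)%:E.
Proof.
move=> h0; rewrite lebesgue_rect//.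
transitivity (\prod_(i < d) h%:E)%E; last by rewrite prodEFin prodr_const card_ord.
apply: eq_bigr => i _; rewrite lebesgue_measure_itv /= lte_fin.
case: ifPn => [_|]; first by rewrite -EFinB; congr EFin; ring.
by rewrite -leNgt => h1; congr EFin; lra.
Qed.

Lemma gcell_sub_ccell d N (k : {ffun 'I_d -> 'I_N.+1}) :
  gcell k `<=` ccell (wd N) (gridc k).
Proof.
move=> x kx i; have := kx i; rewrite axis_cellE /gridc /= !in_itv /=.
by case: ifP => _ /=; rewrite in_itv//= => /andP[-> /ltW].
Qed.

Lemma boxE d : @box R d = rect (fun=> `[-1, 1]%classic).
Proof. by apply/seteqP; split=> x H i; have := H i; rewrite /= in_itv. Qed.

Lemma measurable_box d : measurable (@box R d).
Proof. by rewrite boxE; apply: measurable_rect. Qed.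

Lemma lebesgue_box d : lebesgue_Rd d (@box R d) = (2 ^+ d)%:E.
Proof.
rewrite -(@lebesgue_cube d (fun=> -1) 2)// boxE.
by have -> : -1 + 2 = 1 :> R by ring.
Qed.

Lemma gcellP d N (k : {ffun 'I_d -> 'I_N.+1}) (x : d.-tuple R) :
  gcell k x <-> box x /\ cidx N x = k.
Proof.
split=> [kx|[bx <-] i]; last by split; [exact: bx|rewrite ffunE].
split=> [i|]; first by have [] := kx i.
by apply/ffunP => i; rewrite ffunE; have [] := kx i.
Qed.

Lemma box_gcell d N : @box R d = \big[setU/set0]_(k : {ffun 'I_d -> 'I_N.+1}) gcell k.
Proof.
apply/seteqP; split=> [x bx|x].
  by rewrite (bigD1 (cidx N x))//=; left; apply/gcellP.
by rewrite -bigcup_seq => -[k _ /gcellP[]].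
Qed.

Lemma trivIset_gcell d N (A : set {ffun 'I_d -> 'I_N.+1}) :
  trivIset A (@gcell d N).
Proof.
apply/trivIsetP => k l _ _ /eqP kl; apply/seteqP; split=> // x [] /gcellP[_ e1].
by move=> /gcellP[_ e2]; apply: kl; rewrite -e1.
Qed.

End grid.

(** * Bounds on integrals *)

Section integral_bounds.
Context {R : realType} {dT : measure_display} {T : measurableType dT}.
Variable mu : {measure set T -> \bar R}.

Lemma cst_le_integral (D A : set T) (f : T -> R) (c : R) :
  measurable D -> measurable A -> A `<=` D -> measurable_fun D f ->
  (forall x, D x -> 0 <= f x) -> (forall x, A x -> c <= f x) -> 0 <= c ->
  (c%:E * mu A <= \int[mu]_(x in D) (f x)%:E)%E.
Proof.
move=> mD mA AD mf f0 cf c0; rewrite -integral_cst//.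
apply: (@le_trans _ _ (\int[mu]_(x in A) (f x)%:E)%E).
  apply: ge0_le_integral => //=.
  - by apply/measurable_EFinP/(measurable_funS mD AD).
apply: ge0_subset_integral => //; first exact/measurable_EFinP.
Qed.

Lemma integral_le_cst (A : set T) (f : T -> R) (c : R) :
  measurable A -> measurable_fun A f ->
  (forall x, A x -> 0 <= f x <= c) -> 0 <= c ->
  (\int[mu]_(x in A) (f x)%:E <= c%:E * mu A)%E.
Proof.
move=> mA mf fc c0; rewrite -integral_cst//.
by apply: ge0_le_integral => //=; [move=> x /fc/andP[]|exact/measurable_EFinP|
  move=> x /fc/andP[]].
Qed.

End integral_bounds.

(** * Log-concave functions *)

Section log_concave.
Context {R : realType} {d : nat}.
Implicit Types (F p q : d.-tuple R -> R).

(** Log-concavity without values [-oo] of the exponent: the inequality is only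
    stated at pairs of points where [F] is positive. *)
Definition log_concave F : Prop := forall x y s, 0 <= s <= 1 ->
  0 < F x -> 0 < F y ->
  expR (s * ln (F x) + (1 - s) * ln (F y)) <= F (comb s x y).

Lemma logconcave_densityP p :
  logconcave_density p <-> density p /\ log_concave p.
Proof.
split=> [[dp [g cg pg]]|[dp lp]]; (split; first exact: dp).
  move=> x y s s01 px py.
  have gE z : 0 < p z -> g z = (ln (p z))%:E.
    move: (pg z); case: (g z) => [r|//|] /= [->]; last by rewrite ltxx.
    by rewrite expRK.
  have := cg x y s s01; rewrite gE// gE// -!EFinM -EFinD => H.
  rewrite -lee_fin pg -[X in (X <= _)%E]/(expeR (_%:E)).
  move: H; rewrite -/(comb s x y); case: (g (comb s x y)) => [r||] //=.
  - by rewrite !lee_fin ler_expR.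
  - by rewrite !leey.
exists (fun x => lne (p x)%:E) => [|x]; last first.
  by rewrite lneK// in_itv/= leey lee_fin; case: dp => ->.
have p0 x : 0 <= p x by case: dp => + _ _; exact.
move=> x y s s01; have [s0|s0] := eqVneq s 0.
  rewrite s0 mul0e add0e subr0 mul1e (_ : [tuple _ | i < d] = y)//.
  by apply: eq_from_tnth => i; rewrite tnth_mktuple; ring.
have [s1|s1] := eqVneq s 1.
  rewrite s1 mul1e subrr mul0e adde0 (_ : [tuple _ | i < d] = x)//.
  by apply: eq_from_tnth => i; rewrite tnth_mktuple; ring.
have s0' : 0 < s by rewrite lt0r s0; case/andP: s01.
have s1' : 0 < 1 - s by rewrite subr_gt0 lt_neqAle s1; case/andP: s01.
have [px|px] := leP (p x) 0.
  rewrite [lne (p x)%:E]le0_lneNy ?lee_fin// mulrNy gtr0_sg// mul1e.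
  by rewrite addNye leNye.
have [py|py] := leP (p y) 0.
  rewrite [lne (p y)%:E]le0_lneNy ?lee_fin// mulrNy gtr0_sg// mul1e.
  by rewrite addeNy leNye.
have := lp x y s s01 px py; rewrite -/(comb s x y) => H.
have pc : 0 < p (comb s x y) by apply: lt_le_trans H; exact: expR_gt0.
rewrite !lne_EFin// -!EFinM -EFinD lee_fin.
by rewrite -[leLHS]expRK ler_ln// posrE expR_gt0.
Qed.

Lemma log_concave_superlevel F (c : R) : 0 < c -> log_concave F ->
  convex_Rd [set x | c <= F x].
Proof.
move=> c0 lF x y s s01 /= cx cy.
have Fx := lt_le_trans c0 cx; have Fy := lt_le_trans c0 cy.
apply: le_trans (lF x y s s01 Fx Fy).
rewrite -[leLHS]lnK ?posrE// ler_expR.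
have : ln c <= ln (F x) by rewrite ler_ln ?posrE.
have : ln c <= ln (F y) by rewrite ler_ln ?posrE.
by case/andP: s01; nra.
Qed.

(** A log-concave function with a value at least [M] at [x0] and at least
    [M e^-r] on a cube stays above [M e^-1] on the cube shrunk by the factor
    [1 / r] towards [x0]. *)
Lemma integral_ge_peak F (x0 : d.-tuple R) (M r h : R) (a : 'I_d -> R) :
  (forall x, 0 <= F x) -> measurable_fun setT F -> log_concave F ->
  0 < M -> M <= F x0 -> 1 <= r -> 0 < h ->
  (forall x, ccell h a x -> M * expR (- r) <= F x) ->
  ((M * expR (-1) * (h / r) ^+ d)%:E <= \int[lebesgue_Rd d]_x (F x)%:E)%E.
Proof.
move=> F0 mF lF M0 Mx r1 h0 hF; have r0 : 0 < r by lra.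
pose l i := (1 - r^-1) * tnth x0 i + (-1 + h * a i) / r.
have hr : 0 <= h / r by rewrite divr_ge0// ltW.
rewrite EFinM -(lebesgue_cube l hr); apply: cst_le_integral => //.
- by apply: measurable_rect.
- move=> z hz; pose x := [tuple tnth x0 i + r * (tnth z i - tnth x0 i) | i < d].
  have zE : z = comb r^-1 x x0.
    apply: eq_from_tnth => i; rewrite tnth_comb tnth_mktuple; field.
    by rewrite gt_eqF.
  have Cx : ccell h a x.
    move=> i; have := hz i; rewrite /= !in_itv /= tnth_mktuple /l => /andP[z1 z2].
    have {}z1 := ler_wpM2l (ltW r0) z1; have {}z2 := ler_wpM2l (ltW r0) z2.
    have e1 : r * ((1 - r^-1) * tnth x0 i + (-1 + h * a i) / r) =
       r * tnth x0 i - tnth x0 i + (-1 + h * a i) by field; rewrite gt_eqF.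
    have e2 : r * ((1 - r^-1) * tnth x0 i + (-1 + h * a i) / r + h / r) =
       r * tnth x0 i - tnth x0 i + (-1 + h * a i) + h by field; rewrite gt_eqF.
    by rewrite e1 in z1; rewrite e2 in z2; apply/andP; split; nra.
  have Fx := hF _ Cx; have Fx0 := lt_le_trans M0 Mx.
  have Fx' : 0 < F x by apply: lt_le_trans Fx; rewrite mulr_gt0// expR_gt0.
  have s01 : 0 <= r^-1 <= 1 by rewrite invr_ge0 ltW//= invf_le1.
  rewrite zE; apply: le_trans (lF x x0 r^-1 s01 Fx' Fx0).
  rewrite -[X in X * _](lnK (x:=M)) ?posrE// -expRD ler_expR.
  have l0 : ln M <= ln (F x0) by rewrite ler_ln ?posrE.
  have l1 : ln M - r <= ln (F x).
    rewrite -[leLHS]expRK ler_ln ?posrE ?expR_gt0//.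
    by rewrite expRD lnK ?posrE.
  have e : ln M + -1 = r^-1 * (ln M - r) + (1 - r^-1) * ln M by field; rewrite gt_eqF.
  rewrite e; case/andP: s01 => ? ?.
  by apply: lerD; apply: ler_wpM2l => //; lra.
- by rewrite mulr_ge0 ?expR_ge0// ltW.
Qed.

End log_concave.

(** * Cell masses of a Lipschitz density *)

Section cell_masses.
Context {R : realType} {d : nat}.
Variables (B : R) (p : d.-tuple R -> R).
Hypotheses (B0 : 0 < B) (hp : box_lip_density B p).

Lemma box_lip_is_density : density p. Proof. by case: hp. Qed.
Lemma box_point : box [tuple (0 : R) | i < d].
Proof. by move=> i; rewrite tnth_mktuple; lra. Qed.

(** The values of [p] on the box lie in the interval from [1 / B] to [B], which
    is therefore nonempty. *)
Lemma B_ge1 : 1 <= B.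
Proof.
have [_ _ _ /(_ _ box_point)/andP[h1 h2]] := hp.
have h : B^-1 <= B := le_trans h1 h2.
rewrite leNgt; apply/negP => B1; have : 1 < B^-1 by rewrite invf_gt1.
by lra.
Qed.

Lemma p_ge0 x : 0 <= p x. Proof. by case: hp => -[+ _ _] _ _ _; exact. Qed.

Lemma p_meas (A : set (d.-tuple R)) : measurable_fun A p.
Proof. by case: hp => -[_ + _] _ _ _; exact: measurable_funTS. Qed.

Lemma p_le x : box x -> p x <= B.
Proof. by move=> bx; case: hp => _ _ _ /(_ _ bx)/andP[]. Qed.

Lemma p_ge x : box x -> B^-1 <= p x.
Proof. by move=> bx; case: hp => _ _ _ /(_ _ bx)/andP[]. Qed.

Lemma p_gt0 x : box x -> 0 < p x.
Proof. by move=> /p_ge; apply: lt_le_trans; rewrite invr_gt0. Qed.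

Lemma integral_p_setT : (\int[lebesgue_Rd d]_x (p x)%:E = 1)%E.
Proof. by case: hp => -[]. Qed.

Lemma integral_p_box : (\int[lebesgue_Rd d]_(x in @box R d) (p x)%:E = 1)%E.
Proof.
rewrite integral_mkcond -integral_p_setT; apply: eq_integral => x _.
rewrite /patch.
case: ifPn => // /negP nx; case: hp => _ -> //.
by move=> bx; apply: nx; rewrite inE.
Qed.

Lemma euclidean_dist_le (x y : d.-tuple R) (w : R) : 0 <= w ->
  (forall i, `|tnth x i - tnth y i| <= w) -> euclidean_dist x y <= d%:R * w.
Proof.
move=> w0 h; rewrite /euclidean_dist.
apply: (@le_trans _ _ (Num.sqrt ((d%:R * w) ^+ 2))); last first.
  by rewrite sqrtr_sqr ger0_norm// mulr_ge0.
rewrite ler_wsqrtr//; apply: (@le_trans _ _ (\sum_(i < d) w ^+ 2)).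
  apply: ler_sum => i _; rewrite -real_normK ?num_real//.
  by rewrite ler_pXn2r ?nnegrE.
rewrite sumr_const card_ord -[leLHS]mulr_natl exprMn ler_wpM2r ?sqr_ge0//.
by rewrite -natrX ler_nat; case: (d) => // n; rewrite expnS expn1 leq_pmulr.
Qed.

Variable N : nat.
Local Notation w := (@wd R N).
Local Notation cell := {ffun 'I_d -> 'I_N.+1}.

Definition cell_mass (k : cell) : R :=
  fine (\int[lebesgue_Rd d]_(x in gcell k) (p x)%:E).

Lemma gcell_box (k : cell) (x : d.-tuple R) : gcell k x -> box x.
Proof. by case/gcellP. Qed.

Lemma cell_mass_bounds (k : cell) (a b : R) :
  (forall x, gcell k x -> a <= p x <= b) -> 0 <= a -> 0 <= b ->
  a * w ^+ d <= cell_mass k <= b * w ^+ d.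
Proof.
move=> h a0 b0; have mk := @measurable_gcell R d N k.
have lo : (a%:E * (w ^+ d)%:E <= \int[lebesgue_Rd d]_(x in gcell k) (p x)%:E)%E.
  rewrite -(lebesgue_gcell k); apply: cst_le_integral => //; first exact: p_meas.
  - by move=> x _; exact: p_ge0.
  - by move=> x /h/andP[].
have hi : (\int[lebesgue_Rd d]_(x in gcell k) (p x)%:E <= b%:E * (w ^+ d)%:E)%E.
  rewrite -(lebesgue_gcell k); apply: integral_le_cst => //; first exact: p_meas.
  by move=> x /h/andP[_ ->]; rewrite p_ge0.
have fin : (\int[lebesgue_Rd d]_(x in gcell k) (p x)%:E)%E \is a fin_num.
  rewrite ge0_fin_numE; first by apply: (le_lt_trans hi); rewrite -EFinM ltry.
  by apply: integral_ge0 => x _; rewrite lee_fin p_ge0.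
by rewrite /cell_mass -!lee_fin fineK// !EFinM lo hi.
Qed.

Lemma integral_gcell (k : cell) :
  (\int[lebesgue_Rd d]_(x in gcell k) (p x)%:E = (cell_mass k)%:E)%E.
Proof.
rewrite /cell_mass fineK// ge0_fin_numE; last first.
  by apply: integral_ge0 => x _; rewrite lee_fin p_ge0.
apply: (@le_lt_trans _ _ (\int[lebesgue_Rd d]_(x in @box R d) (p x)%:E)%E); last first.
  by rewrite integral_p_box ltry.
apply: ge0_subset_integral.
- exact: measurable_gcell.
- exact: measurable_box.
- by apply/measurable_EFinP; exact: p_meas.
- by move=> x _; rewrite lee_fin p_ge0.
- by move=> x; exact: gcell_box.
Qed.

Lemma cell_mass_gt0 k : 0 < cell_mass k.
Proof.
have /andP[h _] : B^-1 * w ^+ d <= cell_mass k <= B * w ^+ d.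
  apply: cell_mass_bounds; rewrite ?invr_ge0 ?ltW// => x /gcell_box bx.
  by rewrite p_ge ?p_le.
by apply: lt_le_trans h; rewrite mulr_gt0 ?invr_gt0 ?exprn_gt0 ?wd_gt0.
Qed.

Lemma cell_mass_le k : cell_mass k <= B * w ^+ d.
Proof.
have /andP[_ h] : B^-1 * w ^+ d <= cell_mass k <= B * w ^+ d => //.
apply: cell_mass_bounds; rewrite ?invr_ge0 ?ltW// => x /gcell_box bx.
by rewrite p_ge ?p_le.
Qed.

Lemma cell_mass_ge k : B^-1 * w ^+ d <= cell_mass k.
Proof.
have /andP[h _] : B^-1 * w ^+ d <= cell_mass k <= B * w ^+ d => //.
apply: cell_mass_bounds; rewrite ?invr_ge0 ?ltW// => x /gcell_box bx.
by rewrite p_ge ?p_le.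
Qed.

Lemma sum_integral_gcell (f : d.-tuple R -> R) :
  (forall x, 0 <= f x) -> measurable_fun setT f ->
  (\int[lebesgue_Rd d]_(x in @box R d) (f x)%:E =
   \sum_(k : cell) \int[lebesgue_Rd d]_(x in gcell k) (f x)%:E)%E.
Proof.
move=> f0 mf; rewrite (@box_gcell R d N) ge0_integral_bigsetU//.
- by move=> k; exact: measurable_gcell.
- exact: index_enum_uniq.
- exact: trivIset_gcell.
- by apply/measurable_EFinP; exact: measurable_funTS.
- by move=> x _; rewrite lee_fin.
Qed.

Lemma sum_cell_mass : \sum_(k : cell) cell_mass k = 1.
Proof.
apply: EFin_inj; rewrite -sumEFin -integral_p_box sum_integral_gcell; last 2 first.
- exact: p_ge0.
- exact: p_meas.
by apply: eq_bigr => k _; rewrite integral_gcell.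
Qed.

(** On a cell the density varies by at most the factor [osc]. *)
Definition osc : R := 1 + B * d%:R * w.

Lemma osc_ge1 : 1 <= osc.
Proof. by rewrite lerDl; apply: mulr_ge0; [rewrite mulr_ge0//; exact: ltW|rewrite ltW// wd_gt0]. Qed.

Lemma p_osc (k : cell) x y : gcell k x -> gcell k y -> p x <= osc * p y.
Proof.
move=> kx ky; have bx := gcell_box kx; have by_ := gcell_box ky.
have [_ _ lip _] := hp.
have xy : euclidean_dist x y <= d%:R * w.
  apply: euclidean_dist_le; first by rewrite ltW// wd_gt0.
  move=> i; have := gcell_sub_ccell kx i; have := gcell_sub_ccell ky i.
  by rewrite /= !in_itv /= ler_norml; move=> /andP[? ?] /andP[? ?]; lra.
have h1 : p x - p y <= d%:R * w.
  by apply: le_trans xy; apply: le_trans (lip x y bx by_); exact: ler_norm.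
have h2 : 1 <= B * p y.
  by rewrite -(mulfV (lt0r_neq0 B0)) ler_pM2l// p_ge.
have h3 : 0 <= d%:R * w by rewrite mulr_ge0// ltW// wd_gt0.
have : d%:R * w * 1 <= d%:R * w * (B * p y) by rewrite ler_wpM2l.
by rewrite /osc; lra.
Qed.

(** The density and its cell average agree up to the factor [osc]: this is how
    the Lipschitz condition enters. *)
Lemma cell_mass_osc (k : cell) x : gcell k x ->
  w ^+ d * p x <= osc * cell_mass k /\ cell_mass k <= osc * (w ^+ d * p x).
Proof.
move=> kx; have o1 := osc_ge1; have px := p_ge0 x.
have o0 : 0 < osc by lra.
have /andP[h1 h2] : p x / osc * w ^+ d <= cell_mass k <= osc * p x * w ^+ d.
  apply: cell_mass_bounds => [y ky||]; last 2 first.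
  - by rewrite divr_ge0// ltW.
  - by rewrite mulr_ge0// ltW.
  by rewrite ler_pdivrMr// mulrC (p_osc kx ky) (p_osc ky kx).
split; last by move: h2; lra.
rewrite -(ler_pM2l o0) in h1; apply: le_trans h1.
by rewrite [p x / _]mulrC -!mulrA mulVKf ?gt_eqF// mulrC.
Qed.

End cell_masses.

(** * Hellinger distance to the log-concave class *)

Section hellinger.
Context {R : realType} {d : nat}.
Implicit Types (p q : d.-tuple R -> R).
Local Notation leb := (@lebesgue_Rd R d).

Lemma measurable_sqrt_comp p (A : set (d.-tuple R)) :
  measurable_fun A p -> measurable_fun A (fun x => Num.sqrt (p x)).
Proof.
move=> mp; have ms : measurable_fun setT (@Num.sqrt R).
  by apply: continuous_measurable_fun; exact: sqrt_continuous.
exact: (measurableT_comp ms mp).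
Qed.

Lemma hellinger_sqr p q : (hellinger p q `^ 2)%E =
  (\int[leb]_x ((Num.sqrt (p x) - Num.sqrt (q x)) ^+ 2)%:E)%E.
Proof.
rewrite /hellinger poweR_Lnorm//; apply: eq_integral => x _ /=.
by rewrite ?poweR_EFin powR_mulrn// real_normK// num_real.
Qed.

Lemma measurable_hellinger_integrand p q : density p -> density q ->
  measurable_fun setT (fun x => (Num.sqrt (p x) - Num.sqrt (q x)) ^+ 2).
Proof.
move=> [_ mp _] [_ mq _]; apply: measurable_funX.
by apply: measurable_funB; exact: measurable_sqrt_comp.
Qed.

(** Expanding the square. *)
Lemma hellinger_affinity p q : density p -> density q ->
  (\int[leb]_x ((Num.sqrt (p x) - Num.sqrt (q x)) ^+ 2)%:E +
   2%:E * \int[leb]_x (Num.sqrt (p x) * Num.sqrt (q x))%:E = 2%:E)%E.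
Proof.
move=> dp dq; have mh := measurable_hellinger_integrand dp dq.
have [p0 mp p1] := dp; have [q0 mq q1] := dq.
have ms : measurable_fun setT (fun x => Num.sqrt (p x) * Num.sqrt (q x)).
  by apply: measurable_funM; exact: measurable_sqrt_comp.
have s0 x : (0 <= (Num.sqrt (p x) * Num.sqrt (q x))%:E)%E.
  by rewrite lee_fin mulr_ge0// sqrtr_ge0.
rewrite -ge0_integralZl_EFin//; last exact/measurable_EFinP.
have h0 x : setT x -> (0 <= ((Num.sqrt (p x) - Num.sqrt (q x)) ^+ 2)%:E)%E.
  by rewrite lee_fin sqr_ge0.
have ss0 x : setT x -> (0 <= 2%:E * (Num.sqrt (p x) * Num.sqrt (q x))%:E)%E.
  by move=> _; rewrite mule_ge0.
have mss : measurable_fun setT (fun x => 2%:E * (Num.sqrt (p x) * Num.sqrt (q x))%:E)%E.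
  by apply: measurable_funeM; exact/measurable_EFinP.
have p0' x : setT x -> (0 <= (p x)%:E)%E by rewrite lee_fin.
have q0' x : setT x -> (0 <= (q x)%:E)%E by rewrite lee_fin.
rewrite -(ge0_integralD leb measurableT h0 _ ss0 mss); last exact/measurable_EFinP.
transitivity (\int[leb]_x (p x)%:E + \int[leb]_x (q x)%:E)%E; last first.
  by rewrite p1 q1 -EFinD.
move/measurable_EFinP : (mp) => mp'; move/measurable_EFinP : (mq) => mq'.
rewrite -(ge0_integralD leb measurableT p0' mp' q0' mq').
apply: eq_integral => x _ /=; rewrite -EFinM -!EFinD; congr EFin.
by rewrite -[p x in RHS]sqr_sqrtr// -[q x in RHS]sqr_sqrtr//; ring.
Qed.

(** A log-concave density, which bounds the distance to the class and is a
    competitor of every maximum likelihood estimate. *)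
Definition uniform_density (x : d.-tuple R) : R := (2 ^+ d)^-1 * \1_(@box R d) x.

Lemma convex_box : convex_Rd (@box R d).
Proof.
move=> x y s /andP[s0 s1] bx by_ i; rewrite tnth_comb.
by have /andP[? ?] := bx i; have /andP[? ?] := by_ i; apply/andP; split; nra.
Qed.

Lemma uniform_densityE x : box x -> uniform_density x = (2 ^+ d)^-1.
Proof. by move=> bx; rewrite /uniform_density indicE mem_set// mulr1. Qed.

Lemma uniform_logconcave : logconcave_density uniform_density.
Proof.
have c0 : 0 < (2 ^+ d)^-1 :> R by rewrite invr_gt0 exprn_gt0.
apply/logconcave_densityP; split; last first.
  have ub x : 0 < uniform_density x -> box x.
    rewrite /uniform_density indicE; case: (boolP (x \in box)); first by rewrite inE.
    by rewrite mulr0 ltxx.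
  move=> x y s s01 /ub bx /ub by_; rewrite !uniform_densityE//; last exact: convex_box.
  by rewrite -mulrDl addrC subrK mul1r lnK.
have mu : measurable_fun setT uniform_density.
  apply: measurable_funM => //; apply: measurable_indic; exact: measurable_box.
split=> //; first by move=> x; rewrite /uniform_density mulr_ge0// ltW.
transitivity (((2 ^+ d)^-1)%:E * \int[leb]_x (\1_(@box R d) x)%:E)%E.
  have mi : measurable_fun setT (fun x : d.-tuple R => (\1_(@box R d) x)%:E : \bar R).
    by apply/measurable_EFinP; apply: measurable_indic; exact: measurable_box.
  by rewrite -(ge0_integralZl_EFin leb measurableT _ mi (ltW c0)).
rewrite integral_indic//; last exact: measurable_box.
transitivity (((2 ^+ d)^-1)%:E * (2 ^+ d)%:E : \bar R)%E.
  by rewrite setIT; congr (_ * _)%E; exact: lebesgue_box.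
by rewrite -EFinM mulVf// gt_eqF// exprn_gt0.
Qed.

Lemma hellinger_sqr_le2 p q : density p -> density q -> (hellinger p q `^ 2 <= 2%:E)%E.
Proof.
move=> dp dq; rewrite hellinger_sqr -(hellinger_affinity dp dq) leeDl// mule_ge0//.
by apply: integral_ge0 => x _; rewrite lee_fin mulr_ge0// sqrtr_ge0.
Qed.

Lemma hellinger_fin p q : density p -> density q -> hellinger p q \is a fin_num.
Proof.
move=> dp dq; rewrite ge0_fin_numE; last exact: Lnorm_ge0.
apply: (@lty_poweRy _ _ 2); first by rewrite pnatr_eq0.
by apply: le_lt_trans (hellinger_sqr_le2 dp dq) _; rewrite ltry.
Qed.

Section distance.
Variable p : d.-tuple R -> R.
Hypothesis dp : density p.
Local Notation delta := (hellinger_logconcave p).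

Lemma ereal_inf_hellinger :
  ereal_inf [set hellinger p q | q in logconcave_density] = delta%:E.
Proof.
rewrite /hellinger_logconcave fineK// ge0_fin_numE.
  apply: (@le_lt_trans _ _ (hellinger p uniform_density)).
    by apply: ereal_inf_lbound; exists uniform_density => //; exact: uniform_logconcave.
  by rewrite -ge0_fin_numE ?Lnorm_ge0// hellinger_fin//; case: uniform_logconcave.
by apply: le_ereal_inf_tmp => _ [q _ <-]; exact: Lnorm_ge0.
Qed.

Lemma delta_ge0 : 0 <= delta.
Proof.
rewrite -lee_fin -ereal_inf_hellinger.
by apply: le_ereal_inf_tmp => _ [q _ <-]; exact: Lnorm_ge0.
Qed.

Lemma delta_sqr_le q : logconcave_density q ->
  ((delta ^+ 2)%:E <= \int[leb]_x ((Num.sqrt (p x) - Num.sqrt (q x)) ^+ 2)%:E)%E.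
Proof.
move=> lq; have dq : density q by case: lq.
have h : (delta%:E <= hellinger p q)%E.
  by rewrite -ereal_inf_hellinger; apply: ereal_inf_lbound; exists q.
rewrite -hellinger_sqr -(fineK (hellinger_fin dp dq)) poweR_EFin powR_mulrn ?fine_ge0 ?Lnorm_ge0//.
rewrite lee_fin ler_pXn2r ?nnegrE ?delta_ge0 ?fine_ge0 ?Lnorm_ge0//.
by rewrite -lee_fin (fineK (hellinger_fin dp dq)).
Qed.

Lemma affinity_le q : logconcave_density q ->
  (\int[leb]_x (Num.sqrt (p x) * Num.sqrt (q x))%:E <= (1 - delta ^+ 2 / 2)%:E)%E.
Proof.
move=> lq; have dq : density q by case: lq.
have := hellinger_affinity dp dq; have := delta_sqr_le lq.
have : (0 <= \int[leb]_x (Num.sqrt (p x) * Num.sqrt (q x))%:E)%E.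
  by apply: integral_ge0 => x _; rewrite lee_fin mulr_ge0// sqrtr_ge0.
move: (integral _ _ _) => H; move: (integral _ _ _) => I.
case: H => [a| |] //; case: I => [b| |] //=.
- by rewrite !lee_fin -EFinM -EFinD => _ h [] e; lra.
- by rewrite mulry gtr0_sg// mul1e.
- by rewrite mulry gtr0_sg// mul1e.
Qed.

Lemma delta_sqr_le2 : delta ^+ 2 <= 2.
Proof.
have := delta_sqr_le uniform_logconcave; rewrite -hellinger_sqr => h.
rewrite -lee_fin; apply: (le_trans h); apply: hellinger_sqr_le2 => //.
by case: uniform_logconcave.
Qed.

Lemma hellinger_approx (e : R) : 0 < e -> delta = 0 ->
  exists2 q, logconcave_density q &
    (\int[leb]_x ((Num.sqrt (p x) - Num.sqrt (q x)) ^+ 2)%:E < e%:E)%E.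
Proof.
move=> e0 delta0.
have fin : ereal_inf [set hellinger p q | q in logconcave_density] \is a fin_num.
  by rewrite ereal_inf_hellinger.
have se : 0 < Num.sqrt e by rewrite sqrtr_gt0.
have [_ [q lq <-]] := lb_ereal_inf_adherent se fin.
rewrite ereal_inf_hellinger delta0 add0e => h; exists q => //.
have dq : density q by case: lq.
move: h; rewrite -hellinger_sqr -(fineK (hellinger_fin dp dq)) poweR_EFin.
rewrite powR_mulrn ?fine_ge0 ?Lnorm_ge0// !lte_fin => h.
by rewrite -[ltRHS](sqr_sqrtr (ltW e0)) ltr_pXn2r// nnegrE ?fine_ge0 ?Lnorm_ge0// ltW.
Qed.

End distance.
End hellinger.

(** * A density at distance zero is log-concave *)

Section closed.
Context {R : realType} {d : nat}.
Variables (B : R) (p : d.-tuple R -> R).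
Hypotheses (B0 : 0 < B) (hp : box_lip_density B p).
Local Notation leb := (@lebesgue_Rd R d).

Lemma sqrt_ge_invB u : B^-1 <= u -> B^-1 <= Num.sqrt u.
Proof.
have B1 := B_ge1 B0 hp; have b0 : 0 <= B^-1 by rewrite invr_ge0 ltW.
have b1 : B^-1 <= 1 by rewrite invf_le1.
move=> h; rewrite -[leLHS]ger0_norm// -sqrtr_sqr ler_wsqrtr//.
by apply: le_trans h; rewrite expr2 -[leRHS]mulr1 ler_wpM2l.
Qed.

Lemma sqrt_lip u v e : 0 <= e -> B^-1 <= u -> B^-1 <= v -> u - v <= e ->
  Num.sqrt u <= Num.sqrt v + B * e.
Proof.
move=> e0 hu hv uv; have bu := sqrt_ge_invB hu; have bv := sqrt_ge_invB hv.
have b0 : 0 < B^-1 by rewrite invr_gt0.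
have u0 : 0 <= u by lra.
have v0 : 0 <= v by lra.
rewrite -lerBlDl; set a := Num.sqrt u in bu *; set b := Num.sqrt v in bv *.
have ab : (a - b) * (a + b) <= e.
  by rewrite -subr_sqr !sqr_sqrtr.
rewrite -(ler_pM2l b0) mulKf ?gt_eqF//.
have [ab0|ab0] := leP (a - b) 0; first by nra.
by apply: le_trans ab; rewrite mulrC ler_pM2l//; lra.
Qed.

(** Otherwise the integrand is at least [kap ^+ 2] on a whole cube of side
    [h]. *)
Lemma exists_close_point (q : d.-tuple R -> R) (kap h : R) :
  density q -> 0 <= h -> 0 <= kap ->
  (\int[leb]_x ((Num.sqrt (p x) - Num.sqrt (q x)) ^+ 2)%:E <
    (kap ^+ 2 * h ^+ d)%:E)%E ->
  forall l : 'I_d -> R, exists2 u : d.-tuple R,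
    (forall i, l i <= tnth u i <= l i + h) &
    `|Num.sqrt (p u) - Num.sqrt (q u)| <= kap.
Proof.
move=> dq h0 k0 small l; apply: contrapT => none.
move: small; rewrite ltNge => /negP; apply.
rewrite EFinM -(lebesgue_cube l h0); apply: cst_le_integral => //.
- exact: measurable_rect.
- exact: measurable_hellinger_integrand (box_lip_is_density hp) dq.
- by move=> x _; exact: sqr_ge0.
- move=> u hu; rewrite -[leRHS]real_normK ?num_real// ler_pXn2r ?nnegrE//.
  rewrite leNgt; apply/negP => lt; apply: none; exists u; last exact: ltW.
  by move=> i; have := hu i; rewrite /= in_itv.
- exact: sqr_ge0.
Qed.

Lemma near_box_p (x u : d.-tuple R) (r : R) : box x -> box u -> 0 <= r ->
  (forall i, `|tnth u i - tnth x i| <= 2 * r) ->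
  Num.sqrt (p x) <= Num.sqrt (p u) + 2 * d%:R * B * r /\
  Num.sqrt (p u) <= Num.sqrt (p x) + 2 * d%:R * B * r.
Proof.
move=> bx bu r0 xu; have px := p_ge hp bx; have pu := p_ge hp bu.
have [_ _ lip _] := hp.
have e0 : 0 <= d%:R * (2 * r) by rewrite !mulr_ge0.
have : `|p u - p x| <= d%:R * (2 * r).
  apply: le_trans (lip _ _ bu bx) _; apply: euclidean_dist_le => //.
  by rewrite mulr_ge0.
rewrite ler_norml => /andP[h1 h2].
have -> : 2 * d%:R * B * r = B * (d%:R * (2 * r)) by ring.
by split; apply: sqrt_lip => //; lra.
Qed.

Local Notation C := (2 * d%:R * B + 1).

(** Pointwise control of [q] from closeness in the mean: the cubes around [x]
    beyond the corners of a small central cube contain points where [q] is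
    nearly [p x], so the convex level sets of [q] contain the central cube.  The
    point [x] is first contracted towards the origin by the factor [1 - r], which
    keeps all these cubes inside the box. *)
Lemma central_cube_lower (q : d.-tuple R -> R) (x : d.-tuple R) (r : R) :
  logconcave_density q -> box x -> 0 < r <= 2^-1 ->
  (\int[leb]_x ((Num.sqrt (p x) - Num.sqrt (q x)) ^+ 2)%:E <
    (r ^+ 2 * (2 * r / 3) ^+ d)%:E)%E ->
  0 < Num.sqrt (p x) - C * r ->
  forall u : d.-tuple R, (forall i, `|tnth u i - (1 - r) * tnth x i| <= r / 3) ->
  (Num.sqrt (p x) - C * r) ^+ 2 <= q u.
Proof.
move=> lq bx /andP[r0 r12] small al0 u hu.
have /logconcave_densityP[dq cq] := lq.
have q0 z : 0 <= q z by case: dq => + _ _; exact.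
have r3 : 0 <= 2 * r / 3 by lra.
have cl := exists_close_point dq r3 (ltW r0) small.
apply: (@convex_contains_box _ _ [set z | (Num.sqrt (p x) - C * r) ^+ 2 <= q z]
  (fun i => (1 - r) * tnth x i - r / 3) (fun i => (1 - r) * tnth x i + r / 3)).
- by move=> i; lra.
- by apply: log_concave_superlevel => //; rewrite exprn_gt0.
- move=> sg; have [v hv close] := cl (fun i => (1 - r) * tnth x i +
    (if sg i then r / 3 else - r)).
  have xb i : -1 <= tnth x i <= 1 by exact: bx.
  have bv : box v.
    move=> i; have := hv i; have := xb i; case: (sg i) => /andP[? ?] /andP[? ?];
      apply/andP; split; nra.
  exists v => /=; last first.
    by move=> i; have := hv i; case: (sg i) => /andP[? ?]; lra.
  have vx i : `|tnth v i - tnth x i| <= 2 * r.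
    have := hv i; have := xb i; rewrite ler_norml.
    by case: (sg i) => /andP[? ?] /andP[? ?]; apply/andP; split; nra.
  have [h1 _] := near_box_p bx bv (ltW r0) vx.
  move: close; rewrite ler_norml => /andP[c1 c2].
  rewrite -(sqr_sqrtr (q0 v)) ler_pXn2r ?nnegrE ?sqrtr_ge0 ?(ltW al0)//.
  by lra.
- by move=> i; have := hu i; rewrite ler_norml => /andP[? ?]; lra.
Qed.

Lemma ln_sub_ge (a e : R) : B^-1 <= a -> 0 <= e -> e <= (2 * B)^-1 ->
  ln a - 2 * B * e <= ln (a - e).
Proof.
move=> ha e0 eB; have b0 : 0 < B^-1 by rewrite invr_gt0.
have a0 : 0 < a by lra.
have eB' : e <= B^-1 / 2 by rewrite invfM mulrC in eB.
have ae : 0 < a - e by lra.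
have h : ln (a / (a - e)) <= e / (a - e).
  rewrite (_ : a / (a - e) = 1 + e / (a - e)); last by field; rewrite gt_eqF.
  apply: le_ln1Dx; apply: (@lt_le_trans _ _ 0); first by lra.
  by rewrite divr_ge0// ltW.
rewrite ln_div ?posrE// in h.
have : e / (a - e) <= 2 * B * e.
  rewrite ler_pdivrMr//.
  have : 1 <= 2 * B * (a - e).
    have h2 : B^-1 / 2 <= a - e by lra.
    by have := ler_wpM2l (ltW B0) h2; rewrite mulrA mulfV ?gt_eqF//; lra.
  by nra.
by lra.
Qed.

Lemma ln_add_le (c e : R) : B^-1 <= c -> 0 <= e -> ln (c + e) <= ln c + B * e.
Proof.
move=> hc e0; have b0 : 0 < B^-1 by rewrite invr_gt0.
have c0 : 0 < c by lra.
have -> : c + e = c * (1 + e / c) by field; rewrite gt_eqF.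
have ec : 0 <= e / c by rewrite divr_ge0// ltW.
rewrite lnM ?posrE//; last by lra.
rewrite lerD2l; apply: (@le_trans _ _ (e / c)); first by apply: le_ln1Dx; lra.
rewrite mulrC ler_wpM2r//.
by rewrite -[leRHS]invrK lef_pV2 ?posrE ?invr_gt0.
Qed.

(** A log-concave density [q] close to [p] in the mean is nearly at least [p x]
    and [p y] on small cubes near [x] and [y] ([central_cube_lower]), and nearly
    at most [p (comb s x y)] at some point [u] of a small cube near
    [comb s x y].  As [u] is the convex combination of a point of each of the
    first two cubes, the inequality for [q] passes to the limit. *)
Lemma log_concave_of_approx :
  (forall e : R, 0 < e -> exists2 q, logconcave_density q &
    (\int[leb]_x ((Num.sqrt (p x) - Num.sqrt (q x)) ^+ 2)%:E < e%:E)%E) ->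
  log_concave p.
Proof.
move=> approx x y s s01 px py.
have inbox z : 0 < p z -> box z.
  by move=> pz; apply: contrapT => nz; case: hp => _ /(_ _ nz) e; rewrite e ltxx in pz.
have bx := inbox _ px; have by_ := inbox _ py.
set z := comb s x y; have bz : box z by exact: convex_box.
have pz := p_gt0 B0 hp bz.
have C0 : 0 < C by rewrite ltr_wpDl// !mulr_ge0// ltW.
set a := Num.sqrt (p x); set b := Num.sqrt (p y); set c := Num.sqrt (p z).
have aB : B^-1 <= a by exact: sqrt_ge_invB (p_ge hp bx).
have bB : B^-1 <= b by exact: sqrt_ge_invB (p_ge hp by_).
have cB : B^-1 <= c by exact: sqrt_ge_invB (p_ge hp bz).
have b0 : 0 < B^-1 by rewrite invr_gt0.
have eB : 2^-1 * B^-1 = (2 * B)^-1 by rewrite invfM.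
have key r : 0 < r -> r <= 2^-1 -> C * r <= (2 * B)^-1 ->
    s * ln (a - C * r) + (1 - s) * ln (b - C * r) <= ln (c + C * r).
  move=> r0 r12 Cr.
  have r3 : 0 <= 2 * r / 3 by lra.
  have e0 : 0 < r ^+ 2 * (2 * r / 3) ^+ d.
    by rewrite mulr_gt0// exprn_gt0//; lra.
  have [q lq small] := approx _ e0.
  have /logconcave_densityP[dq cq] := lq.
  have r012 : 0 < r <= 2^-1 by rewrite r0.
  have ax : 0 < a - C * r by lra.
  have bx' : 0 < b - C * r by lra.
  have lox := central_cube_lower lq bx r012 small ax.
  have loy := central_cube_lower lq by_ r012 small bx'.
  have [u hu close] := exists_close_point dq r3 (ltW r0) small
    (fun i => (1 - r) * tnth z i - r / 3).
  pose xu := [tuple (1 - r) * tnth x i + (tnth u i - (1 - r) * tnth z i) | i < d].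
  pose yu := [tuple (1 - r) * tnth y i + (tnth u i - (1 - r) * tnth z i) | i < d].
  have uE : u = comb s xu yu.
    by apply: eq_from_tnth => i; rewrite tnth_comb !tnth_mktuple; ring.
  have qx : (a - C * r) ^+ 2 <= q xu.
    apply: lox => i; rewrite tnth_mktuple addrC addKr ler_norml.
    by have /andP[? ?] := hu i; apply/andP; split; lra.
  have qy : (b - C * r) ^+ 2 <= q yu.
    apply: loy => i; rewrite tnth_mktuple addrC addKr ler_norml.
    by have /andP[? ?] := hu i; apply/andP; split; lra.
  have a2 : 0 < (a - C * r) ^+ 2 by rewrite exprn_gt0.
  have b2 : 0 < (b - C * r) ^+ 2 by rewrite exprn_gt0.
  have qx0 := lt_le_trans a2 qx; have qy0 := lt_le_trans b2 qy.
  have := cq xu yu s s01 qx0 qy0; rewrite -uE => qu.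
  have q0 : 0 <= q u by case: dq => + _ _; exact.
  have bu : box u.
    move=> i; have /andP[? ?] := hu i; have /andP[? ?] := bz i.
    by apply/andP; split; nra.
  have uz i : `|tnth u i - tnth z i| <= 2 * r.
    rewrite ler_norml; have /andP[? ?] := hu i; have /andP[? ?] := bz i.
    by apply/andP; split; nra.
  have [_ pu] := near_box_p bz bu (ltW r0) uz.
  have c0 : 0 < c + C * r by rewrite ltr_wpDr ?mulr_ge0 ?ltW//; lra.
  have quC : q u <= (c + C * r) ^+ 2.
    rewrite -(sqr_sqrtr q0) ler_pXn2r ?nnegrE ?sqrtr_ge0 ?(ltW c0)//.
    by move: close; rewrite ler_norml => /andP[? ?]; rewrite -/c in pu; lra.
  have {quC} := le_trans qu quC.
  rewrite -[leRHS]lnK ?posrE ?exprn_gt0// ler_expR lnXn// => h.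
  have l1 : ln (a - C * r) *+ 2 <= ln (q xu) by rewrite -lnXn// ler_ln ?posrE.
  have l2 : ln (b - C * r) *+ 2 <= ln (q yu) by rewrite -lnXn// ler_ln ?posrE.
  rewrite !mulr2n in h l1 l2; case/andP: s01 => s0 s1.
  have := ler_wpM2l s0 l1; have := ler_wpM2l (_ : 0 <= 1 - s) l2.
  by rewrite subr_ge0 => /(_ s1); lra.
rewrite -[leRHS]lnK ?posrE// ler_expR.
have lnsqrt (w : R) : 0 < w -> ln w = 2 * ln (Num.sqrt w).
  by move=> w0; rewrite -{1}(sqr_sqrtr (ltW w0)) lnXn ?sqrtr_gt0// mulr_natl.
rewrite (lnsqrt _ px) (lnsqrt _ py) (lnsqrt _ pz) -/a -/b -/c.
suff : s * ln a + (1 - s) * ln b <= ln c by lra.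
apply/ler_addgt0Pr => e e0.
pose D := 3 * B * C; have D0 : 0 < D by rewrite !mulr_gt0.
(* Small enough for [key], for the logarithm bounds, and for an error below
   [e]. *)
pose r := Num.min (Num.min 2^-1 ((2 * B)^-1 / C)) (e / D).
have r0 : 0 < r.
  have h1 : 0 < (2 * B)^-1 by rewrite invr_gt0 mulr_gt0.
  by rewrite !lt_min invr_gt0 ltr0n (divr_gt0 h1 C0) (divr_gt0 e0 D0).
have r1 : r <= 2^-1 by rewrite /r !ge_min lexx.
have r2 : C * r <= (2 * B)^-1.
  by rewrite mulrC -ler_pdivlMr// /r !ge_min lexx orbT.
have r3 : D * r <= e by rewrite mulrC -ler_pdivlMr// /r !ge_min lexx !orbT.
have Cr0 : 0 <= C * r by rewrite mulr_ge0// ltW.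
have := key r r0 r1 r2.
have := ln_sub_ge aB Cr0 r2; have := ln_sub_ge bB Cr0 r2; have := ln_add_le cB Cr0.
have DE : D * r = 3 * B * (C * r) by rewrite /D; ring.
rewrite DE in r3.
move: r3; set t := C * r; move=> r3 l1 l2 l3; case/andP: s01 => s0 s1.
have := ler_wpM2l s0 l3; have := ler_wpM2l (_ : 0 <= 1 - s) l2.
by rewrite subr_ge0 => /(_ s1); lra.
Qed.

Lemma delta_gt0 : ~ logconcave_law p -> 0 < hellinger_logconcave p.
Proof.
move=> nlc; rewrite lt0r (delta_ge0 (box_lip_is_density hp)) andbT; apply/eqP => delta0; apply: nlc.
exists p; last exact: aeW.
apply/logconcave_densityP; split; first exact: (box_lip_is_density hp).
by apply: log_concave_of_approx => e e0; apply: hellinger_approx => //; exact: (box_lip_is_density hp).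
Qed.

End closed.

(** * Step-function brackets of log-concave densities *)

Section bracket.
Context {R : realType} {d0 : nat}.
Local Notation d := d0.+1.
Variables (B : R) (p : d.-tuple R -> R).
Hypotheses (B0 : 0 < B) (hp : box_lip_density B p).
Local Notation leb := (@lebesgue_Rd R d).
Variable N : nat.
Local Notation w := (@wd R N).
Local Notation os := (@osc R d B N).
Local Notation cell := {ffun 'I_d -> 'I_N.+1}.

Variables (q : d.-tuple R -> R) (L : nat).
Hypothesis lq : logconcave_density q.

(** The levels of [sqrt q], at distance [1 / N.+1]: counting the levels that a
    cell touches, or that contain it, brackets [sqrt q] on that cell. *)
Definition level (l : 'I_L) : set (d.-tuple R) :=
  [set x | (l.+1%:R / N.+1%:R) ^+ 2 <= q x].

Definition ntouch (k : cell) : nat :=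
  #|[pred l : 'I_L | `[< touches (level l) w (gridc k) >]]|.

Definition ncontain (k : cell) : nat :=
  #|[pred l : 'I_L | `[< ccell w (gridc k) `<=` level l >]]|.

Let q0 x : 0 <= q x. Proof. by case: lq => -[+ _ _] _; exact. Qed.

Lemma level_convex (l : 'I_L) : convex_Rd (level l).
Proof.
apply: log_concave_superlevel; last by case/logconcave_densityP: lq.
by rewrite exprn_gt0// divr_gt0.
Qed.

Lemma levelP (l : 'I_L) x :
  level l x <-> (l < Num.truncn (Num.sqrt (q x) * N.+1%:R))%N.
Proof.
have s0 : 0 <= Num.sqrt (q x) * N.+1%:R by rewrite mulr_ge0 ?sqrtr_ge0.
rewrite /level /= -[X in _ <= X](sqr_sqrtr (q0 x)) ler_pXn2r ?nnegrE ?sqrtr_ge0 ?divr_ge0//.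
rewrite ler_pdivrMr//; have /andP[t1 t2] := truncn_itv s0.
split=> h; last by apply: le_trans t1; rewrite ler_nat.
by rewrite -ltnS -(ltr_nat R); apply: le_lt_trans t2.
Qed.

(** Every level below [sqrt (q x)] is touched by the cell of [x]. *)
Lemma q_le_bracket (k : cell) x : ccell w (gridc k) x ->
  Num.min (q x) ((L%:R / N.+1%:R) ^+ 2) <= ((ntouch k).+1%:R / N.+1%:R) ^+ 2.
Proof.
move=> kx; set t := Num.truncn (Num.sqrt (q x) * N.+1%:R).
have tk : (minn t L <= ntouch k)%N.
  rewrite /ntouch; pose f (i : 'I_(minn t L)) : 'I_L := widen_ord (geq_minr t L) i.
  have fi : injective f by move=> i j /(congr1 val) /= ij; exact: val_inj.
  rewrite -[X in (X <= _)%N]card_ord -(card_imset _ fi); apply/subset_leq_card/fintype.subsetP.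
  move=> l /imsetP[i _ ->]; rewrite inE; apply/asboolP/asboolP; exists x => //.
  by apply/levelP => /=; have := ltn_ord i; rewrite leq_min => /andP[].
have [tL|Lt] := leqP t L.
  rewrite ge_min; apply/orP; left.
  rewrite -[leLHS](sqr_sqrtr (q0 x)) ler_pXn2r ?nnegrE ?sqrtr_ge0 ?divr_ge0//.
  rewrite ler_pdivlMr//; have s0 : 0 <= Num.sqrt (q x) * N.+1%:R.
    by rewrite mulr_ge0 ?sqrtr_ge0.
  have /andP[_ t2] := truncn_itv s0; apply: (le_trans (ltW t2)).
  by rewrite ler_nat ltnS; move: tk; rewrite (minn_idPl tL).
rewrite ge_min; apply/orP; right.
rewrite ler_pXn2r ?nnegrE ?divr_ge0// ler_pM2r ?invr_gt0// ler_nat.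
by move: tk; rewrite (minn_idPr (ltnW Lt)) => /leqW.
Qed.

Lemma bracket_low (k : cell) x : ccell w (gridc k) x ->
  (ncontain k)%:R / N.+1%:R <= Num.sqrt (q x).
Proof.
move=> kx; set t := Num.truncn (Num.sqrt (q x) * N.+1%:R).
rewrite ler_pdivrMr//; have s0 : 0 <= Num.sqrt (q x) * N.+1%:R.
  by rewrite mulr_ge0 ?sqrtr_ge0.
have /andP[t1 _] := truncn_itv s0; apply: le_trans t1; rewrite ler_nat -/t.
rewrite /ncontain; set S := [pred l | _].
have St (l : 'I_L) : l \in S -> (l < t)%N.
  move=> h; have /asboolW sub : `[< ccell w (gridc k) `<=` level l >] := h.
  exact/levelP/sub.
rewrite cardE -(size_map val); apply: (@leq_trans (size (iota 0 t))); last by rewrite size_iota.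
apply: uniq_leq_size; first by rewrite map_inj_uniq ?enum_uniq//; exact: val_inj.
by move=> _ /mapP[l + ->]; rewrite mem_enum mem_iota add0n => /St.
Qed.

(** A level that touches a cell without containing it counts that cell as a
    boundary cell. *)
Lemma sum_touch_contain : (\sum_(k : cell) ntouch k <=
  \sum_(k : cell) ncontain k + L * (2 ^ d * (2 * N.+1) ^ d0))%N.
Proof.
have h (k : cell) : (ntouch k <= ncontain k +
    \sum_(l < L) (k \in boundary_cells N.+1 w (level l)))%N.
  rewrite /ntouch /ncontain -!sum1_card big_mkcond [X in (_ <= X + _)%N]big_mkcond /=.
  rewrite -big_split /=.
  apply: leq_sum => l _; rewrite !inE.
  by case: (asbool _); case: (asbool _).
apply: (@leq_trans (\sum_(k : cell) (ncontain k +
    \sum_(l < L) (k \in boundary_cells N.+1 w (level l))))%N).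
  by apply: leq_sum => k _; exact: h.
rewrite big_split /= leq_add2l.
rewrite exchange_big /= -[L in leqRHS]card_ord -sum_nat_const; apply: leq_sum => l _.
rewrite -big_mkcond sum1_card; apply: card_boundary_cells; first exact: wd_gt0.
exact: level_convex.
Qed.

(** The lower step function lies below [sqrt q], and [sqrt p] is nearly constant
    on cells. *)
Lemma affinity_lower :
  ((\sum_(k : cell) (ncontain k)%:R / N.+1%:R * Num.sqrt (w ^+ d * cell_mass p k))%:E <=
   os%:E *
   \int[leb]_x (Num.sqrt (p x) * Num.sqrt (q x))%:E)%E.
Proof.
have w0 : 0 < w ^+ d by rewrite exprn_gt0// wd_gt0.
have o1 := @osc_ge1 R d B B0 N; have o0 : 0 < os by lra.
have [[_ mq _] _] := lq.
have ms : measurable_fun setT (fun x => Num.sqrt (p x) * Num.sqrt (q x)).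
  by apply: measurable_funM; apply: measurable_sqrt_comp => //; exact: p_meas hp _.
have s0 x : 0 <= Num.sqrt (p x) * Num.sqrt (q x) by rewrite mulr_ge0 ?sqrtr_ge0.
have cellwise (k : cell) : (((ncontain k)%:R / N.+1%:R *
    Num.sqrt (w ^+ d * cell_mass p k))%:E <= os%:E *
    \int[leb]_(x in gcell k) (Num.sqrt (p x) * Num.sqrt (q x))%:E)%E.
  set n := _ / _; set m := cell_mass p k.
  have n0 : 0 <= n by rewrite divr_ge0.
  have -> : n * Num.sqrt (w ^+ d * m) =
      os * (n * (Num.sqrt (w ^+ d * m) / (os * w ^+ d)) * w ^+ d).
    by field; rewrite !gt_eqF// wd_gt0.
  rewrite EFinM lee_pmul2l ?lte_fin// EFinM -(lebesgue_gcell k).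
  apply: cst_le_integral => //; try exact: measurable_gcell.
  - exact: measurable_funTS.
  - move=> x kx; rewrite mulrC; apply: ler_pM => //.
    + by rewrite divr_ge0 ?sqrtr_ge0// mulr_ge0// ltW.
    + rewrite ler_pdivrMr ?mulr_gt0//.
      have [_ hm] := cell_mass_osc B0 hp kx.
      have px := p_ge0 hp x.
      have e : Num.sqrt ((os * w ^+ d) ^+ 2) = os * w ^+ d.
        by rewrite sqrtr_sqr ger0_norm// mulr_ge0// ltW.
      rewrite -e -sqrtrM//.
      rewrite ler_wsqrtr//; apply: (@le_trans _ _ (w ^+ d * (os * (w ^+ d * p x)))).
        by rewrite ler_wpM2l// ltW.
      rewrite [leLHS](_ : _ = os * (p x * (w ^+ d) ^+ 2)); last by ring.
      rewrite [leRHS](_ : _ = os ^+ 2 * (p x * (w ^+ d) ^+ 2)); last by ring.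
      apply: ler_wpM2r; first by rewrite mulr_ge0// sqr_ge0.
      by rewrite expr2 ler_peMl// ltW.
    + exact: bracket_low (gcell_sub_ccell kx).
  - rewrite mulr_ge0// divr_ge0 ?sqrtr_ge0// mulr_ge0// ltW//.
rewrite -sumEFin; apply: (@le_trans _ _ (os%:E *
    \int[leb]_(x in @box R d) (Num.sqrt (p x) * Num.sqrt (q x))%:E)%E); last first.
  rewrite lee_pmul2l ?lte_fin//; apply: ge0_subset_integral => //.
  - exact: measurable_box.
  - exact/measurable_EFinP.
rewrite (sum_integral_gcell N s0 ms) ge0_sume_distrr; last first.
  by move=> k _; apply: integral_ge0 => x _; rewrite lee_fin.
by apply: lee_sum => k _; exact: cellwise.
Qed.

Lemma ncontain_le_ntouch (k : cell) : (ncontain k <= ntouch k)%N.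
Proof.
apply/subset_leq_card/fintype.subsetP => l h.
have /asboolW sub : `[< ccell w (gridc k) `<=` level l >] := h.
suff : `[< touches (level l) w (gridc k) >] by [].
apply: asboolT; pose y := [tuple -1 + w * gridc k i | i < d].
have ky : ccell w (gridc k) y.
  move=> i; rewrite /= in_itv /= tnth_mktuple lexx /= lerD2l ler_pM2l ?wd_gt0//.
  by rewrite lerDl.
by exists y => //; exact: sub.
Qed.

Lemma sqrt_cell_mass_le (k : cell) : Num.sqrt (w ^+ d * cell_mass p k) <= B * w ^+ d.
Proof.
have w0 : 0 < w ^+ d by rewrite exprn_gt0// wd_gt0.
have B1 := B_ge1 B0 hp.
have e : Num.sqrt ((B * w ^+ d) ^+ 2) = B * w ^+ d.
  by rewrite sqrtr_sqr ger0_norm// mulr_ge0// ltW.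
rewrite -e ler_wsqrtr//.
apply: (@le_trans _ _ (w ^+ d * (B * w ^+ d))).
  by rewrite ler_wpM2l ?(ltW w0)//; exact: (cell_mass_le B0 hp).
rewrite [leLHS](_ : _ = B * (w ^+ d) ^+ 2); last by ring.
rewrite [leRHS]exprMn; apply: ler_wpM2r; first by rewrite sqr_ge0.
by rewrite expr2 ler_peMl// ltW.
Qed.

(** The upper step function has almost the affinity of [q] with [p]: it exceeds
    the lower one by the boundary cells of the levels, and each cell has mass of
    order [N.+1 ^- d]. *)
Lemma bracket_sum_le (A : nat) (D : R) : L = (A * N.+1)%N -> 0 <= D ->
  (\int[leb]_x (Num.sqrt (p x) * Num.sqrt (q x))%:E <= (1 - D / 2)%:E)%E ->
  \sum_(k : cell) (ntouch k).+1%:R / N.+1%:R * Num.sqrt (w ^+ d * cell_mass p k) <=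
  1 - D / 2 + B * (2 * d%:R + 2 ^+ d + A%:R * 8 ^+ d) / N.+1%:R.
Proof.
move=> LE D0 aff; have w0 : 0 < w ^+ d by rewrite exprn_gt0// wd_gt0.
have n0 : 0 < N.+1%:R :> R by [].
have o1 := @osc_ge1 R d B B0 N; have o0 : 0 < os by lra.
have D2 : 0 <= 1 - D / 2.
  rewrite -lee_fin; apply: le_trans aff; apply: integral_ge0 => x _.
  by rewrite lee_fin mulr_ge0 ?sqrtr_ge0.
have inner : \sum_(k : cell) (ncontain k)%:R / N.+1%:R *
    Num.sqrt (w ^+ d * cell_mass p k) <= 1 - D / 2 + 2 * B * d%:R / N.+1%:R.
  apply: (@le_trans _ _ (os * (1 - D / 2))).
    rewrite -lee_fin EFinM; apply: (le_trans affinity_lower).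
    by rewrite lee_pmul2l ?lte_fin.
  have -> : os = 1 + 2 * B * d%:R / N.+1%:R.
    by rewrite /osc /wd; ring.
  have : 0 <= 2 * B * d%:R / N.+1%:R by rewrite divr_ge0// !mulr_ge0// ltW.
  by move: (_ / _) => e e0; nra.
have wN : w ^+ d * N.+1%:R ^+ d = 2 ^+ d by rewrite -exprMn wdN.
have outer : \sum_(k : cell) ((ntouch k).+1%:R - (ncontain k)%:R) / N.+1%:R *
    Num.sqrt (w ^+ d * cell_mass p k) <= B * (2 ^+ d + A%:R * 8 ^+ d) / N.+1%:R.
  apply: (@le_trans _ _ (\sum_(k : cell) ((ntouch k).+1%:R - (ncontain k)%:R) / N.+1%:R *
      (B * w ^+ d))).
    apply: ler_sum => k _; rewrite ler_wpM2l ?sqrt_cell_mass_le// divr_ge0// subr_ge0.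
    by rewrite ler_nat leqW// ncontain_le_ntouch.
  rewrite -mulr_suml -mulr_suml sumrB -!natr_sum.
  have := sum_touch_contain; rewrite -(ler_nat R) natrD LE !natrM !natrX => h.
  have -> : (\sum_(k : cell) (ntouch k).+1)%N%:R =
      (\sum_(k : cell) ntouch k)%N%:R + N.+1%:R ^+ d :> R.
    under eq_bigr do rewrite -addn1; rewrite big_split /= natrD; congr (_ + _).
    by rewrite sum1_card card_ffun !card_ord natrX.
  apply: (@le_trans _ _ ((N.+1%:R ^+ d + A%:R * N.+1%:R * (2 ^+ d * (2 * N.+1%:R) ^+ d0))
      / N.+1%:R * (B * w ^+ d))).
    apply: ler_wpM2r; first by rewrite mulr_ge0// ltW.
    apply: ler_wpM2r; first by rewrite invr_ge0.
    by move: h; rewrite natrM; lra.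
  have -> : (N.+1%:R ^+ d + A%:R * N.+1%:R * (2 ^+ d * (2 * N.+1%:R) ^+ d0)) / N.+1%:R
      * (B * w ^+ d) = B * ((w ^+ d * N.+1%:R ^+ d) + A%:R * 2 ^+ d * 2 ^+ d0 *
      (w ^+ d * N.+1%:R ^+ d)) / N.+1%:R.
    by rewrite exprMn [N.+1%:R ^+ d]exprS; ring.
  rewrite wN ler_wpM2r ?invr_ge0// ler_wpM2l ?(ltW B0)// lerD2l -!mulrA ler_wpM2l//.
  have -> : 8 = 2 * 2 * 2 :> R by ring.
  rewrite !exprMn -!mulrA ler_wpM2l ?exprn_ge0// ler_wpM2r ?exprn_ge0//.
  by rewrite exprS ler_peMl ?exprn_ge0//; lra.
have -> : \sum_(k : cell) (ntouch k).+1%:R / N.+1%:R * Num.sqrt (w ^+ d * cell_mass p k) =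
   \sum_(k : cell) (ncontain k)%:R / N.+1%:R * Num.sqrt (w ^+ d * cell_mass p k) +
   \sum_(k : cell) ((ntouch k).+1%:R - (ncontain k)%:R) / N.+1%:R *
    Num.sqrt (w ^+ d * cell_mass p k).
  by rewrite -big_split /=; apply: eq_bigr => k _; ring.
apply: le_trans (lerD inner outer) _.
rewrite -addrA lerD2l le_eqVlt; apply/orP; left; apply/eqP; ring.
Qed.

End bracket.

(** * Events that depend on the grid cells of the observations *)

Section cell_events.
Context {R : realType} {d : nat}.
Variables (B : R) (p : d.-tuple R -> R).
Hypotheses (B0 : 0 < B) (hp : box_lip_density B p).
Context {dT : measure_display} {T : measurableType dT}.
Variables (P : probability T R) (X : nat -> {RV P >-> d.-tuple R}).
Hypothesis hX : iid_with_density X p.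

Lemma measurable_preimage_X i (A : set (d.-tuple R)) :
  measurable A -> measurable (X i @^-1` A).
Proof. by move=> mA; rewrite -[X in measurable X]setTI; exact: measurable_funPT. Qed.

Lemma prob_X i (A : set (d.-tuple R)) : measurable A ->
  P (X i @^-1` A) = (\int[lebesgue_Rd d]_(x in A) (p x)%:E)%E.
Proof. by move=> mA; case: hX => + _ => /(_ i A mA). Qed.

Lemma prob_outside_box i : P (X i @^-1` (~` @box R d)) = 0%E.
Proof.
rewrite prob_X; last by apply: measurableC; exact: measurable_box.
by apply: integral0_eq => x nx; case: hp => _ ->.
Qed.

Lemma measure_finite_union_le (I : Type) (s : seq I) (Q : pred I) (F : I -> set T) :
  (forall i, measurable (F i)) ->
  (P (\big[setU/set0]_(i <- s | Q i) F i) <= \sum_(i <- s | Q i) P (F i))%E.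
Proof.
move=> mF; elim: s => [|i s IH]; first by rewrite !big_nil measure0.
rewrite !big_cons; case: (Q i) => //.
apply: (le_trans (measureU2 _ _ _)) => //.
  by apply: bigsetU_measurable => j _; exact: mF.
exact: leeD.
Qed.

Variable N : nat.
Local Notation cell := {ffun 'I_d -> 'I_N.+1}.
Local Notation mass := (@cell_mass R d p N).

Definition cells_of (t : nat) (w : T) : {ffun 'I_t -> cell} :=
  [ffun i : 'I_t => cidx N (X i w)].

Lemma prob_cell_word (t : nat) (k : {ffun 'I_t -> cell}) :
  P (\bigcap_(i in `I_t) (X i @^-1` (if insub i is Some j then gcell (k j) else setT))) =
  (\prod_(i < t) mass (k i))%:E.
Proof.
have mA i : measurable (if insub i is Some j then gcell (k j) else setT : set (d.-tuple R)).
  by case: insub => // j; exact: measurable_gcell.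
case: (hX) => _ ->//; rewrite -prodEFin; apply: eq_bigr => i _.
rewrite valK prob_X; last exact: measurable_gcell.
exact: integral_gcell hp _ _.
Qed.

(** Reduces a statement on the observations to a sum over the finitely many words
    of cells; the exceptional event also excludes observations outside the box,
    which have probability zero. *)
Lemma cell_word_event (t : nat) (A : pred {ffun 'I_t -> cell}) (b : R) :
  \sum_(k | A k) \prod_(i < t) mass (k i) <= b ->
  exists E : set T, [/\ measurable E, (P E <= b%:E)%E &
    forall w, ~ E w -> (forall i, (i < t)%N -> box (X i w)) /\ ~~ A (cells_of t w)].
Proof.
move=> Ab.
pose E0 := \big[setU/set0]_(i < t) (X i @^-1` (~` @box R d)).
pose Ek (k : {ffun 'I_t -> cell}) := \bigcap_(i in `I_t)
  (X i @^-1` (if insub i is Some j then gcell (k j) else setT)).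
pose E1 := \big[setU/set0]_(k | A k) Ek k.
have mEk k : measurable (Ek k).
  apply: bigcap_measurableType => i _; apply: measurable_preimage_X.
  by case: insub => // j; exact: measurable_gcell.
have mX0 (i : 'I_t) : measurable (X i @^-1` (~` @box R d)).
  by apply/measurable_preimage_X/measurableC; exact: measurable_box.
have mE0 : measurable E0 by apply: bigsetU_measurable => i _; exact: mX0.
have mE1 : measurable E1 by apply: bigsetU_measurable => k _; exact: mEk.
exists (E0 `|` E1); split; first exact: measurableU.
  apply: (le_trans (measureU2 _ _ _)) => //; rewrite -[leRHS]add0e; apply: leeD.
    apply: (le_trans (measure_finite_union_le _ _ mX0)).
    by rewrite big1// => i _; exact: prob_outside_box.
  apply: (le_trans (measure_finite_union_le _ _ mEk)).
  under eq_bigr do rewrite prob_cell_word.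
  by rewrite sumEFin lee_fin.
move=> w /not_orP[n0 n1].
have inbox i : (i < t)%N -> box (X i w).
  move=> it; apply: contrapT => nb; apply: n0; rewrite /E0.
  by rewrite (bigD1 (Ordinal it))//=; left.
split=> //; apply/negP => Aw; apply: n1; rewrite /E1 (bigD1 (cells_of t w))//=; left.
move=> i /= it; rewrite insubT /=; apply/gcellP; split; first exact: inbox.
by rewrite ffunE.
Qed.

(** Markov's inequality for a product of functions of the individual cells. *)
Lemma cell_word_markov (t : nat) (A : pred {ffun 'I_t -> cell})
    (g : 'I_t -> cell -> R) :
  (forall i k, 0 <= g i k) -> (forall k, A k -> 1 <= \prod_(i < t) g i (k i)) ->
  \sum_(k | A k) \prod_(i < t) mass (k i) <=
  \prod_(i < t) \sum_(k : cell) mass k * g i k.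
Proof.
move=> g0 Ag; have m0 k : 0 <= mass k by exact/ltW/(cell_mass_gt0 B0 hp).
rewrite bigA_distr_bigA big_mkcond; apply: ler_sum => k _.
have P0 : 0 <= \prod_(i < t) mass (k i) by exact: prodr_ge0.
rewrite big_split /=; case: ifPn => [Ak|_].
  by rewrite ler_peMr// Ag.
by rewrite mulr_ge0// prodr_ge0.
Qed.

(** Only the observations with index at least [d] enter the test statistic. *)
Lemma cell_word_markov_tail (t : nat) (A : pred {ffun 'I_t -> cell})
    (g : cell -> R) (c : R) : (d <= t)%N ->
  (forall k, 0 <= g k) -> (forall k, A k -> 1 <= \prod_(i < t | (d <= i)%N) g (k i)) ->
  \sum_(k : cell) mass k * g k <= expR c ->
  \sum_(k | A k) \prod_(i < t) mass (k i) <= expR (c *+ (t - d)).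
Proof.
move=> dt g0 Ag gc; have m0 k : 0 <= mass k by exact/ltW/(cell_mass_gt0 B0 hp).
apply: (le_trans (@cell_word_markov t A
  (fun i k => if (d <= i)%N then g k else 1) _ _)).
- by move=> i k; case: ifP.
- by move=> k /Ag; rewrite big_mkcond.
apply: (@le_trans _ _ (\prod_(i < t) if (d <= i)%N then expR c else 1)).
  apply: ler_prod => i _; case: ifP => _.
    by rewrite gc andbT; apply: sumr_ge0 => k _; rewrite mulr_ge0.
  under eq_bigr do rewrite mulr1.
  by rewrite (sum_cell_mass hp) ler01 lexx.
rewrite -big_mkcond /= -(big_geq_mkord d t xpredT (fun=> expR c)) prodr_const_nat.
by rewrite -mulr_natr expRM_natr.
Qed.

End cell_events.

(** * Uniform upper bound on log-concave likelihoods *)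

Lemma sum_exists_le (R : realType) (I J : finType) (Q : I -> pred J) (F : J -> R) :
  (forall j, 0 <= F j) ->
  \sum_(j | [exists i, Q i j]) F j <= \sum_i \sum_(j | Q i j) F j.
Proof.
move=> F0; rewrite big_mkcond (eq_bigr _ (fun i _ => big_mkcond (Q i) F)) exchange_big.
apply: ler_sum => j _; case: ifPn => [/existsP[i Qij]|_]; last first.
  by apply: sumr_ge0 => i _; case: ifP.
by rewrite (bigD1 i)//= Qij lerDl; apply: sumr_ge0 => k _; case: ifP.
Qed.

Lemma mul_sqrt_div (R : realType) (m v : R) : 0 < m -> 0 <= v ->
  m * Num.sqrt (v / m) = Num.sqrt (v * m).
Proof.
move=> m0 v0; have -> : v * m = (v / m) * m ^+ 2 by field; rewrite gt_eqF.
by rewrite [RHS]sqrtrM ?divr_ge0 ?(ltW m0)// sqrtr_sqr ger0_norm ?(ltW m0)// mulrC.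
Qed.

Lemma exists_max_nat (R : realType) (F : nat -> R) (a b i0 : nat) : (a <= i0 < b)%N ->
  exists2 i1, (a <= i1 < b)%N & forall i, (a <= i < b)%N -> F i <= F i1.
Proof.
elim: b i0 => [|b IH] i0; first by rewrite ltn0 andbF.
have [->|bi0] := eqVneq i0 b => hi0.
  have [ab|ab] := ltnP a b; last first.
    by exists b => // i hi; have -> : i = b by lia.
  have [|i1 hi1 m1] := IH b.-1; first by lia.
  have [le|lt] := leP (F b) (F i1).
    exists i1 => [|i hi]; first by lia.
    by have [->//|ib] := eqVneq i b; apply: m1; lia.
  exists b => [|i hi]; first by lia.
  have [->//|ib] := eqVneq i b.
  by apply: (le_trans _ (ltW lt)); apply: m1; lia.
have [|i1 hi1 m1] := IH i0; first by lia.
have [le|lt] := leP (F b) (F i1).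
  exists i1 => [|i hi]; first by lia.
  by have [->//|ib] := eqVneq i b; apply: m1; lia.
exists b => [|i hi]; first by lia.
have [->//|ib] := eqVneq i b.
by apply: (le_trans _ (ltW lt)); apply: m1; lia.
Qed.

Section uniform_bound.
Context {R : realType} {d0 : nat}.
Local Notation d := d0.+1.
Variables (B : R) (p : d.-tuple R -> R).
Hypotheses (B0 : 0 < B) (hp : box_lip_density B p).
Context {dT : measure_display} {T : measurableType dT}.
Variables (P : probability T R) (X : nat -> {RV P >-> d.-tuple R}).
Hypothesis hX : iid_with_density X p.
Local Notation delta := (hellinger_logconcave p).

Section bracket_event.
Variables (N A t : nat).
Local Notation w := (@wd R N).
Local Notation cell := {ffun 'I_d -> 'I_N.+1}.
Local Notation mass := (@cell_mass R d p N).
Local Notation L := (A * N.+1)%N.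
Hypotheses (dt : (d <= t)%N)
  (hN : 4 * (B * (2 * d%:R + 2 ^+ d + A%:R * 8 ^+ d)) / N.+1%:R <= delta ^+ 2)
  (hN' : 16 * B * d%:R / N.+1%:R <= delta ^+ 2).

(** The number of touched levels per cell, bounded by [L], codes the upper step
    function. *)
Definition bracket_val (u : {ffun cell -> 'I_L.+1}) (k : cell) : R :=
  (u k).+1%:R / N.+1%:R.

(** The square root of the likelihood ratio of the bracket and the cell average
    of [p], times the exponential factor of Chernoff's bound. *)
Definition bracket_weight (u : {ffun cell -> 'I_L.+1}) (k : cell) : R :=
  expR (delta ^+ 2 / 8) * (bracket_val u k * Num.sqrt (w ^+ d / mass k)).

Definition good_bracket (u : {ffun cell -> 'I_L.+1}) : bool :=
  \sum_(k : cell) bracket_val u k * Num.sqrt (w ^+ d * mass k) <= 1 - delta ^+ 2 / 4.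

Lemma bracket_weight_ge0 u k : 0 <= bracket_weight u k.
Proof. by rewrite mulr_ge0 ?expR_ge0// mulr_ge0 ?sqrtr_ge0// divr_ge0. Qed.

Lemma good_bracket_chernoff u : good_bracket u ->
  \sum_(k : cell) mass k * bracket_weight u k <= expR (- (delta ^+ 2 / 8)).
Proof.
move=> gu; have w0 : 0 < w ^+ d by rewrite exprn_gt0// wd_gt0.
have -> : \sum_(k : cell) mass k * bracket_weight u k = expR (delta ^+ 2 / 8) *
    \sum_(k : cell) bracket_val u k * Num.sqrt (w ^+ d * mass k).
  rewrite mulr_sumr; apply: eq_bigr => k _.
  rewrite -(mul_sqrt_div (cell_mass_gt0 B0 hp k) (ltW w0)) /bracket_weight; ring.
apply: (@le_trans _ _ (expR (delta ^+ 2 / 8) * expR (- (delta ^+ 2 / 4)))).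
  rewrite ler_wpM2l ?expR_ge0//; apply: (le_trans gu).
  by apply: le_trans (expR_ge1Dx _); rewrite lexx.
rewrite -expRD ler_expR; lra.
Qed.

(** Chernoff's bound and a union bound over the good brackets: outside [E], the
    likelihood of every good bracket is small, and each log-concave density
    that is at most [A ^+ 2] at the observations lies below one of them. *)
Lemma bracket_event : exists E : set T, [/\ measurable E,
  (P E <= ((L.+1 ^ (N.+1 ^ d))%:R * expR (- (delta ^+ 2 / 8) *+ (t - d)))%:E)%E &
  forall om, ~ E om -> (forall i, (i < t)%N -> box (X i om)) /\
    forall q, logconcave_density q ->
    (forall i, (d <= i < t)%N -> q (X i om) <= A%:R ^+ 2) ->
    \prod_(d <= i < t) q (X i om) <=
    expR (- (delta ^+ 2 / 8) *+ (t - d)) * \prod_(d <= i < t) p (X i om)].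
Proof.
pose Q (u : {ffun cell -> 'I_L.+1}) (k : {ffun 'I_t -> cell}) :=
  good_bracket u && (1 <= \prod_(i < t | (d <= i)%N) bracket_weight u (k i)).
have [|E [mE PE hE]] := @cell_word_event R d B p hp dT T P X hX N t
  (fun k => [exists u, Q u k])
  ((L.+1 ^ (N.+1 ^ d))%:R * expR (- (delta ^+ 2 / 8) *+ (t - d))).
  apply: (le_trans (sum_exists_le _ _)).
    by move=> k; apply: prodr_ge0 => i _; exact/ltW/(cell_mass_gt0 B0 hp).
  apply: (@le_trans _ _ (\sum_(u : {ffun cell -> 'I_L.+1})
    expR (- (delta ^+ 2 / 8) *+ (t - d)))); last first.
    by rewrite sumr_const !card_ffun !card_ord -[leLHS]mulr_natl.
  apply: ler_sum => u _; case: (boolP (good_bracket u)) => gu; last first.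
    by rewrite big_pred0 ?expR_ge0// => k; rewrite /Q (negbTE gu).
  apply: (cell_word_markov_tail B0 hp (g := bracket_weight u)) => //.
  - by move=> k; exact: bracket_weight_ge0.
  - by move=> k /andP[].
  - exact: good_bracket_chernoff.
exists E; split=> // om /hE[inbox nQ]; split=> // q lq qA.
have w0 : 0 < w ^+ d by rewrite exprn_gt0// wd_gt0.
have nL (k : cell) : (@ntouch R d0 N q L k < L.+1)%N.
  by rewrite ltnS -[X in (_ <= X)%N]card_ord; exact: max_card.
pose u : {ffun cell -> 'I_L.+1} := [ffun k => Ordinal (nL k)].
have gu : good_bracket u.
  have := bracket_sum_le B0 hp lq (erefl (A * N.+1)%N) (sqr_ge0 delta)
    (affinity_le (box_lip_is_density hp) lq).
  rewrite /good_bracket /bracket_val.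
  under [in X in _ -> X]eq_bigr do rewrite ffunE /=.
  move=> h; apply: (le_trans h); move: hN; rewrite -!mulrA.
  by set e := B * _; lra.
have w1 : \prod_(d <= i < t) bracket_weight u (cidx N (X i om)) <= 1.
  move: nQ; rewrite negb_exists => /forallP/(_ u); rewrite /Q gu /= -ltNge => /ltW.
  rewrite big_geq_mkord /= => h; apply: le_trans h.
  by rewrite le_eqVlt; apply/orP; left; apply/eqP/eq_bigr => i _; rewrite ffunE.
have key i : (d <= i < t)%N -> expR (delta ^+ 2 / 8) * q (X i om) <=
    bracket_weight u (cidx N (X i om)) ^+ 2 * p (X i om).
  move=> /andP[di it]; set x := X i om; set k := cidx N x.
  have kx : gcell k x by apply/gcellP; split=> //; exact: inbox.
  have qU : q x <= bracket_val u k ^+ 2.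
    have := q_le_bracket L lq (gcell_sub_ccell kx).
    rewrite natrM mulfK ?pnatr_eq0// min_l; last by apply: qA; rewrite di.
    by rewrite /bracket_val ffunE.
  have m0 := cell_mass_gt0 B0 hp k.
  have -> : bracket_weight u k ^+ 2 =
      expR (delta ^+ 2 / 8) * bracket_val u k ^+ 2 *
      (expR (delta ^+ 2 / 8) * (w ^+ d / mass k)).
    rewrite /bracket_weight !exprMn sqr_sqrtr ?divr_ge0 ?(ltW w0) ?(ltW m0)//; ring.
  rewrite [leRHS](_ : _ = expR (delta ^+ 2 / 8) * (bracket_val u k ^+ 2 *
    (expR (delta ^+ 2 / 8) * (w ^+ d * p x) / mass k))); last by ring.
  rewrite ler_wpM2l ?expR_ge0//; apply: (le_trans qU).
  rewrite ler_peMr ?sqr_ge0//.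
  have [_ hm] := cell_mass_osc B0 hp kx.
  rewrite ler_pdivlMr// mul1r.
  apply: (le_trans hm); apply: ler_wpM2r.
    by rewrite mulr_ge0 ?(ltW w0)// (p_ge0 hp).
  apply: le_trans (expR_ge1Dx _).
  rewrite /osc /wd lerD2l; move: (d%:R) (N.+1%:R^-1) (delta ^+ 2) hN' => a b c; nra.
have P0 : 0 <= \prod_(d <= i < t) p (X i om).
  by apply: prodr_ge0 => i _; exact: (p_ge0 hp).
have q0 x : 0 <= q x by case: lq => -[+ _ _] _; exact.
have prodE : \prod_(d <= i < t) (expR (delta ^+ 2 / 8) * q (X i om)) <=
    \prod_(d <= i < t) p (X i om).
  apply: (@le_trans _ _ (\prod_(d <= i < t)
    (bracket_weight u (cidx N (X i om)) ^+ 2 * p (X i om)))).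
    rewrite !big_nat; apply: ler_prod => i di; rewrite key// andbT.
    by rewrite mulr_ge0 ?expR_ge0.
  rewrite big_split /= ler_piMl// prodrXl.
  rewrite expr_le1// prodr_ge0// => i _; exact: bracket_weight_ge0.
move: prodE; rewrite big_split /= prodr_const_nat -expRM_natr => prodE.
rewrite mulNrn expRN ler_pdivlMl ?expR_gt0//.
by rewrite -[(delta ^+ 2 / 8) *+ _]mulr_natr.
Qed.

End bracket_event.

Section large_maximum.
Variables (N t : nat) (M0 : R).
Local Notation w := (@wd R N).
Local Notation cell := {ffun 'I_d -> 'I_N.+1}.
Local Notation mass := (@cell_mass R d p N).
Local Notation rad M := (2 * ln M + 2 * ln B + 4).
Hypotheses (dt : (d <= t)%N) (hN : 16 * B * 8 ^+ d <= N.+1%:R) (M01 : 1 <= M0)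
  (hM0 : forall M, M0 <= M -> 1 < M * expR (-1) * (w / rad M) ^+ d).

(** The exponent of a Chernoff bound: its sum over the observations is nonnegative
    exactly when at least half of them fall into cells of [S]. *)
Definition vote (S : {ffun cell -> bool}) (k : cell) : R := if S k then 1 else -1.

Lemma vote_chernoff (S : {ffun cell -> bool}) : \sum_(k | S k) mass k <= 16^-1 ->
  \sum_(k : cell) mass k * expR (vote S k) <= expR (- 4^-1).
Proof.
move=> S16; have e4 : expR 1 <= 4 :> R.
  have h : 2^-1 <= expR (- 2^-1) :> R.
    by apply: le_trans (expR_ge1Dx _); lra.
  have : 4^-1 <= expR (-1) :> R.
    have -> : -1 = - 2^-1 + - 2^-1 :> R by lra.
    have -> : 4^-1 = 2^-1 * 2^-1 :> R by lra.
    by rewrite expRD ler_pM.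
  by rewrite expRN lef_pV2 ?posrE ?expR_gt0.
have e2 : expR (-1) <= 2^-1 :> R.
  by rewrite expRN lef_pV2 ?posrE ?expR_gt0//; apply: le_trans (expR_ge1Dx _); lra.
apply: (@le_trans _ _ (\sum_(k : cell) (2^-1 * mass k + (if S k then 4 * mass k else 0)))).
  apply: ler_sum => k _; have m0 := ltW (cell_mass_gt0 B0 hp k).
  rewrite /vote; case: ifP => _; first by have := ler_wpM2l m0 e4; lra.
  by have := ler_wpM2l m0 e2; lra.
rewrite big_split /= -mulr_sumr (sum_cell_mass hp) -big_mkcond -mulr_sumr.
by apply: le_trans (expR_ge1Dx _); lra.
Qed.

(** For a log-concave density [q] with maximum [M] over the observations, the
    level set at [M e^-r] contains no cell, hence touches only boundary cells,
    of small total mass.  So at least half of the observations lie where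
    [q <= M e^-r], and the radius [r] is chosen such that this outweighs the
    values up to [M] of the others. *)
Lemma large_maximum_event : exists E : set T, [/\ measurable E,
  (P E <= ((2 ^ (N.+1 ^ d))%:R * expR (- 4^-1 *+ (t - d)))%:E)%E &
  forall om, ~ E om -> (forall i, (i < t)%N -> box (X i om)) /\
    forall q i0, logconcave_density q -> (d <= i0 < t)%N -> M0 <= q (X i0 om) ->
    \prod_(d <= i < t) q (X i om) <=
    expR (- 2 *+ (t - d)) * \prod_(d <= i < t) p (X i om)].
Proof.
pose Q (S : {ffun cell -> bool}) (k : {ffun 'I_t -> cell}) :=
  (\sum_(k | S k) mass k <= 16^-1) &&
  (1 <= \prod_(i < t | (d <= i)%N) expR (vote S (k i))).
have [|E [mE PE hE]] := @cell_word_event R d B p hp dT T P X hX N t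
  (fun k => [exists u, Q u k])
  ((2 ^ (N.+1 ^ d))%:R * expR (- 4^-1 *+ (t - d))).
  apply: (le_trans (sum_exists_le _ _)).
    by move=> k; apply: prodr_ge0 => i _; exact/ltW/(cell_mass_gt0 B0 hp).
  apply: (@le_trans _ _ (\sum_(S : {ffun cell -> bool}) expR (- 4^-1 *+ (t - d)))); last first.
    by rewrite sumr_const !card_ffun !card_ord card_bool -[leLHS]mulr_natl.
  apply: ler_sum => S _; case: (boolP (\sum_(k | S k) mass k <= 16^-1)) => gu; last first.
    by rewrite big_pred0 ?expR_ge0// => k; rewrite /Q (negbTE gu).
  apply: (cell_word_markov_tail B0 hp (g := fun k => expR (vote S k))) => //.
  - by move=> k /andP[].
  - exact: vote_chernoff.
exists E; split=> // om /hE[inbox nQ]; split=> // q i0 lq hi0 qM0.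
have w0 : 0 < w ^+ d by rewrite exprn_gt0// wd_gt0.
have /logconcave_densityP[[q0 mq q1] cq] := lq.
have [i1 hi1 i1max] : exists2 i1, (d <= i1 < t)%N &
    forall i, (d <= i < t)%N -> q (X i om) <= q (X i1 om).
  exact: (exists_max_nat (fun i => q (X i om)) hi0).
set M := q (X i1 om) in i1max; have MM0 : M0 <= M by apply: le_trans qM0 (i1max _ hi0).
have M1 : 1 <= M by exact: le_trans MM0.
have M_gt0 : 0 < M by lra.
have B1 := B_ge1 B0 hp.
have lnM : 0 <= ln M by exact: ln_ge0.
have lnB : 0 <= ln B by exact: ln_ge0.
set r := rad M; have r1 : 1 <= r by rewrite /r; lra.
pose K := [set x | M * expR (- r) <= q x].
have cK : convex_Rd K by apply: log_concave_superlevel => //; rewrite mulr_gt0// expR_gt0.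
(* A cell inside the level set would force the integral of q above one. *)
have noncontained (k : cell) : ~ ccell w (gridc k) `<=` K.
  move=> sub; have := integral_ge_peak q0 mq cq M_gt0 (lexx M) r1 (wd_gt0 N) sub.
  by rewrite q1 lee_fin leNgt (hM0 MM0).
pose S := [ffun k : cell => `[< touches K w (gridc k) >]].
have S16 : \sum_(k | S k) mass k <= 16^-1.
  apply: (@le_trans _ _ (\sum_(k in boundary_cells N.+1 w K) (B * w ^+ d))).
    rewrite [leLHS]big_mkcond [leRHS]big_mkcond /=; apply: ler_sum => k _.
    rewrite ffunE inE (asboolF (noncontained k)) andbT.
    by case: ifP => // _; exact: (cell_mass_le B0 hp).
  rewrite sumr_const -[leLHS]mulr_natl.
  have := card_boundary_cells N (wd_gt0 N) cK; rewrite -(ler_nat R) natrM !natrX natrM => card.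
  have Bw : 0 <= B * w ^+ d by rewrite mulr_ge0 ?(ltW w0) ?(ltW B0).
  apply: (le_trans (ler_wpM2r Bw card)).
  have n0 : 0 < N.+1%:R :> R by [].
  have wN : (w * N.+1%:R) ^+ d = 2 ^+ d by rewrite wdN.
  have -> : 2 ^+ d * (2 * N.+1%:R) ^+ d0 * (B * w ^+ d) =
      B * 2 ^+ d * 2 ^+ d0 * (w * N.+1%:R) ^+ d / N.+1%:R.
    move: (wd N) (N.+1%:R) n0 => v n n0; rewrite !exprMn [n ^+ d]exprS.
    by field; exact: lt0r_neq0.
  rewrite wN ler_pdivrMr//; apply: (@le_trans _ _ (B * 8 ^+ d)); last by move: hN; lra.
  have -> : 8 = 2 * 2 * 2 :> R by ring.
  rewrite !exprMn -!mulrA ler_wpM2l ?(ltW B0)// ler_wpM2l ?exprn_ge0//.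
  by rewrite ler_wpM2r ?exprn_ge0// exprS ler_peMl ?exprn_ge0//; lra.
pose v i := vote S (cidx N (X i om)).
have vsum : \sum_(d <= i < t) v i <= 0.
  move: nQ; rewrite negb_exists => /forallP/(_ S); rewrite /Q S16 /= -ltNge -expR_sum.
  rewrite expR_lt1 => /ltW; rewrite big_geq_mkord /= => h; apply: le_trans h.
  by rewrite le_eqVlt; apply/orP; left; apply/eqP/eq_bigr => i _; rewrite ffunE.
have key i : (d <= i < t)%N ->
    q (X i om) <= expR (- 2) * p (X i om) * expR (r / 2 * v i).
  move=> di; have it : (i < t)%N by case/andP: di.
  have bx := inbox i it.
  have pB : expR (- ln B) <= p (X i om).
    by rewrite expRN lnK ?posrE//; exact: (p_ge hp).
  apply: (@le_trans _ _ (expR (- 2) * expR (- ln B) * expR (r / 2 * v i))); last first.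
    by rewrite ler_wpM2r ?expR_ge0// ler_wpM2l ?expR_ge0.
  rewrite -!expRD /v /vote ffunE; case: asboolP => [tk|ntk].
    apply: le_trans (i1max _ di) _; rewrite -[leLHS]lnK ?posrE// ler_expR /r; lra.
  have /negP : ~ K (X i om).
    move=> Ki; apply: ntk; exists (X i om) => //.
    by apply: gcell_sub_ccell; apply/gcellP.
  rewrite -ltNge => /ltW h; apply: (le_trans h).
  rewrite -[X in X * _]lnK ?posrE// -expRD ler_expR /r; lra.
have -> : expR (- 2 *+ (t - d)) * \prod_(d <= i < t) p (X i om) =
    \prod_(d <= i < t) (expR (- 2) * p (X i om)).
  by rewrite big_split /= prodr_const_nat -expRM_natr mulr_natr.
apply: (@le_trans _ _ (\prod_(d <= i < t) (expR (- 2) * p (X i om) * expR (r / 2 * v i)))).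
  by rewrite !big_nat; apply: ler_prod => i di; rewrite q0 key.
rewrite big_split /= -expR_sum -mulr_sumr ler_piMr//.
  by apply: prodr_ge0 => i _; rewrite mulr_ge0 ?expR_ge0// (p_ge0 hp).
by rewrite expR_le1 mulr_ge0_le0//; lra.
Qed.

End large_maximum.
End uniform_bound.

Lemma ln_le_subr1 (R : realType) (x : R) : 0 < x -> ln x <= x - 1.
Proof. by move=> x0; rewrite -{1}[x](subrK 1) addrC; apply: le_ln1Dx; lra. Qed.

Section combine.
Context {R : realType}.

(** The left-hand side grows like [M] up to a power of [ln M]. *)
Lemma peak_mass_unbounded (d0 : nat) (B h : R) : 1 <= B -> 0 < h ->
  exists2 M0 : R, 1 <= M0 & forall M, M0 <= M ->
    1 < M * expR (-1) * (h / (2 * ln M + 2 * ln B + 4)) ^+ d0.+1.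
Proof.
move=> B1 h0; set d : R := d0.+1%:R; have d_gt0 : 0 < d by rewrite ltr0n.
pose a := 4 * d; have a0 : 0 < a by rewrite mulr_gt0.
have lnB : 0 <= ln B by exact: ln_ge0.
pose K := 2 + ln B / 2 + d * ln a - d * ln h.
have K0 : 0 <= 2 * (`|K| + 1) by rewrite mulr_ge0// addr_ge0.
exists (expR (2 * (`|K| + 1))).
  by apply: le_trans (expR_ge1Dx _); lra.
move=> M MM; have M_gt0 : 0 < M by apply: lt_le_trans MM; exact: expR_gt0.
have lnM_ge : 2 * (`|K| + 1) <= ln M by rewrite -[leLHS]expRK ler_ln ?posrE ?expR_gt0.
set r := (2 * ln M + 2 * ln B + 4); have r0 : 0 < r by rewrite /r; lra.
have -> : M * expR (-1) * (h / r) ^+ d0.+1 =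
    expR (ln M - 1 + (ln h - ln r) * d).
  by rewrite !expRD expRM_natr expRN expRD expRN !lnK ?posrE.
rewrite expR_gt1; have ra : ln r <= r / a - 1 + ln a.
  have ra0 : 0 < r / a by rewrite divr_gt0.
  have -> : ln r = ln (r / a) + ln a by rewrite -lnM ?posrE// divfK// gt_eqF.
  by rewrite lerD2r ln_le_subr1.
have : d * ln r <= d * (r / a - 1 + ln a) by rewrite ler_pM2l.
have -> : d * (r / a - 1 + ln a) = r / 4 - d + d * ln a.
  by rewrite /a; field; rewrite gt_eqF.
have := ler_norm K; rewrite /K /r; lra.
Qed.

(** The grid of size [N0] only serves to exclude large maxima, and the truncation
    level [A] is then fixed; the grid of size [N] carries the brackets. *)
Lemma uniform_likelihood_bound (d0 : nat) (B : R) : 1 <= B ->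
  exists (A : nat) (C1 C2 : R), [/\ 0 < C1, 0 <= C2 &
  forall p : d0.+1.-tuple R -> R, box_lip_density B p ->
  forall (dT : measure_display) (T : measurableType dT) (P : probability T R)
    (X : nat -> {RV P >-> d0.+1.-tuple R}), iid_with_density X p ->
  forall N t : nat, (d0.+1 <= t)%N ->
  C1 / N.+1%:R <= hellinger_logconcave p ^+ 2 ->
  exists E : set T, [/\ measurable E,
    (P E <= (((A * N.+1).+1 ^ (N.+1 ^ d0.+1))%:R *
      expR (- (hellinger_logconcave p ^+ 2 / 8) *+ (t - d0.+1)) +
      C2 * expR (- 4^-1 *+ (t - d0.+1)))%:E)%E &
    forall om, ~ E om -> (forall i, (i < t)%N -> box (X i om)) /\
      forall q, logconcave_density q ->
      \prod_(d0.+1 <= i < t) q (X i om) <=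
      expR (- (hellinger_logconcave p ^+ 2 / 8) *+ (t - d0.+1)) *
      \prod_(d0.+1 <= i < t) p (X i om)]].
Proof.
move=> B1; have B0 : 0 < B by lra.
set d := d0.+1.
pose N0 := Num.truncn (16 * B * 8 ^+ d).
have hN0 : 16 * B * 8 ^+ d <= N0.+1%:R.
  have /truncn_itv/andP[_ /ltW] : 0 <= 16 * B * 8 ^+ d by rewrite !mulr_ge0 ?exprn_ge0// ltW.
  by [].
have [M0 M01 hM0] := peak_mass_unbounded d0 B1 (wd_gt0 N0).
pose A := (Num.truncn M0).+1.
have hA : M0 <= A%:R ^+ 2.
  have /truncn_itv/andP[_ /ltW h] : 0 <= M0 by lra.
  apply: (le_trans h); rewrite -/A -natrX ler_nat; rewrite expnS expn1; exact: leq_pmulr.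
pose C1 := 4 * (B * (2 * d%:R + 2 ^+ d + A%:R * 8 ^+ d)) + 16 * B * d%:R.
have c1 : 0 <= 4 * (B * (2 * d%:R + 2 ^+ d + A%:R * 8 ^+ d)).
  by rewrite !mulr_ge0 ?(ltW B0)// !addr_ge0 ?mulr_ge0 ?exprn_ge0.
have c2 : 0 < 16 * B * d%:R by rewrite !mulr_gt0 ?ltr0n.
exists A, C1, (2 ^ (N0.+1 ^ d))%:R; split.
- by rewrite ltr_wpDl.
- by [].
move=> p hp dT T P X hX N t dt hC.
have n0 : 0 < N.+1%:R :> R by [].
have split_C : C1 / N.+1%:R = 4 * (B * (2 * d%:R + 2 ^+ d + A%:R * 8 ^+ d)) / N.+1%:R
    + 16 * B * d%:R / N.+1%:R by rewrite -mulrDl.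
have h1 : 4 * (B * (2 * d%:R + 2 ^+ d + A%:R * 8 ^+ d)) / N.+1%:R <=
    hellinger_logconcave p ^+ 2.
  by apply: le_trans hC; rewrite split_C lerDl divr_ge0// ltW.
have h2 : 16 * B * d%:R / N.+1%:R <= hellinger_logconcave p ^+ 2.
  by apply: le_trans hC; rewrite split_C lerDr divr_ge0.
have [E1 [mE1 PE1 hE1]] := bracket_event B0 hp hX dt h1 h2.
have [E2 [mE2 PE2 hE2]] := large_maximum_event B0 hp hX dt hN0 M01 hM0.
exists (E1 `|` E2); split; first exact: measurableU.
  by apply: (le_trans (measureU2 _ _ _)) => //; rewrite EFinD leeD.
move=> om /not_orP[/hE1[inbox b1] /hE2[_ b2]]; split=> // q lq.
have [small|] := pselect (forall i, (d <= i < t)%N -> q (X i om) <= A%:R ^+ 2).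
  exact: b1.
move=> /existsNP[i /not_implyP[di /negP]]; rewrite -ltNge => /ltW big.
apply: (le_trans (b2 q i lq di (le_trans hA big))).
apply: ler_wpM2r; first by apply: prodr_ge0 => j _; exact: (p_ge0 hp).
rewrite ler_expR lerMn2r; apply/orP; right.
by have := delta_sqr_le2 (box_lip_is_density hp); lra.
Qed.

End combine.

(** * The Laplace rule of succession *)

Section laplace.
Context {R : realType} {C : finType}.
Implicit Types (c : nat -> C) (f : C -> R).

Definition cnt c (n : nat) (k : C) : nat := (\sum_(0 <= s < n) (c s == k))%N.

Definition laplace_step c (s : nat) (k : C) : R :=
  (cnt c s k).+1%:R / (s + #|C|)%:R.

Definition laplace c (n : nat) : R := \prod_(0 <= s < n) laplace_step c s (c s).

Lemma cntS c n k : cnt c n.+1 k = (cnt c n k + (c n == k))%N.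
Proof. by rewrite /cnt big_nat_recr. Qed.

Lemma sum_cnt c n : (\sum_k cnt c n k)%N = n.
Proof.
elim: n => [|n IH]; first by rewrite big1// => k _; rewrite /cnt big_nil.
under eq_bigr do rewrite cntS; rewrite big_split /= IH (bigD1 (c n))//= eqxx.
by rewrite big1 ?addn0 ?addn1// => k /negbTE; rewrite eq_sym => ->.
Qed.

Lemma eq_cnt c c' n : (forall s, (s < n)%N -> c s = c' s) -> cnt c n =1 cnt c' n.
Proof. by move=> cc k; rewrite /cnt !big_mkord; apply: eq_bigr => s _; rewrite cc. Qed.

Lemma eq_laplace c c' n : (forall s, (s < n)%N -> c s = c' s) ->
  laplace c n = laplace c' n.
Proof.
move=> cc; rewrite /laplace !big_mkord; apply: eq_bigr => s _.
rewrite cc// /laplace_step (eq_cnt (c' := c'))// => r rs.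
by apply: cc; apply: ltn_trans rs _.
Qed.

Lemma laplaceS c n : laplace c n.+1 = laplace c n * laplace_step c n (c n).
Proof. by rewrite /laplace big_nat_recr. Qed.

Lemma laplace_gt0 c n : (0 < #|C|)%N -> 0 < laplace c n.
Proof.
move=> C0; apply: prodr_gt0 => s _; rewrite divr_gt0 ?ltr0n//.
by rewrite addn_gt0 C0 orbT.
Qed.

Lemma sum_laplace_step c n : (0 < #|C|)%N -> \sum_k laplace_step c n k = 1.
Proof.
move=> C0; rewrite -mulr_suml -natr_sum.
under eq_bigr do rewrite -addn1; rewrite big_split /= sum_cnt sum1_card divff//.
by rewrite pnatr_eq0 -lt0n addn_gt0 C0 orbT.
Qed.

Definition word_fun (k0 : C) (n : nat) (k : {ffun 'I_n -> C}) (s : nat) : C :=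
  if insub s is Some i then k i else k0.

Definition snoc (n : nat) (k : {ffun 'I_n -> C}) (a : C) : {ffun 'I_n.+1 -> C} :=
  [ffun i => if unlift ord_max i is Some j then k j else a].

Lemma sum_snoc (n : nat) (F : {ffun 'I_n.+1 -> C} -> R) :
  \sum_k F k = \sum_k \sum_a F (@snoc n k a).
Proof.
rewrite pair_big /=.
rewrite (reindex (fun ka : {ffun 'I_n -> C} * C => snoc ka.1 ka.2)) //=.
exists (fun k : {ffun 'I_n.+1 -> C} => ([ffun j => k (lift ord_max j)], k ord_max)).
  move=> [k a] _ /=; rewrite ffunE unlift_none; congr pair.
  by apply/ffunP => j; rewrite !ffunE liftK.
move=> k _; apply/ffunP => i; rewrite ffunE /=.
by case: unliftP => [j|] ->; rewrite ?ffunE.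
Qed.

Lemma word_fun_snoc k0 n (k : {ffun 'I_n -> C}) a s : (s < n)%N ->
  word_fun k0 (snoc k a) s = word_fun k0 k s.
Proof.
move=> sn; rewrite /word_fun (insubT (fun s => s < n)%N sn) /=.
rewrite (insubT (fun s => s < n.+1)%N (ltnW sn)) /= ffunE.
case: unliftP => [j|] /(congr1 (@nat_of_ord _)) /=; last by move=> e; exfalso; rewrite e ltnn in sn.
rewrite /bump leqNgt (ltn_ord j) add0n => e; congr (k _); exact: val_inj.
Qed.

Lemma word_fun_snoc_last k0 n (k : {ffun 'I_n -> C}) a :
  word_fun k0 (snoc k a) n = a.
Proof.
rewrite /word_fun (insubT (fun s => s < n.+1)%N (ltnSn n)) /= ffunE.
case: unliftP => [j|//] /(congr1 (@nat_of_ord _)) /=.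
by rewrite /bump leqNgt (ltn_ord j) add0n => e; have := ltn_ord j; rewrite -e ltnn.
Qed.

Lemma sum_laplace k0 n :
  \sum_(k : {ffun 'I_n -> C}) laplace (word_fun k0 k) n = 1.
Proof.
have C0 : (0 < #|C|)%N by apply/card_gt0P; exists k0.
elim: n => [|n IH].
  rewrite (bigD1 [ffun=> k0])//= big1 ?addr0 ?/laplace ?big_nil// => k /eqP[].
  by apply/ffunP => -[].
rewrite sum_snoc -[RHS]IH; apply: eq_bigr => k _.
rewrite -[RHS]mulr1 -(sum_laplace_step (word_fun k0 k) n C0) mulr_sumr.
apply: eq_bigr => a _; rewrite laplaceS word_fun_snoc_last.
rewrite (eq_laplace (c' := word_fun k0 k)); last by move=> s; exact: word_fun_snoc.
congr (_ * _); rewrite /laplace_step (eq_cnt (c' := word_fun k0 k))// => s.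
exact: word_fun_snoc.
Qed.

(** One term of the multinomial expansion is at most the whole power. *)
Lemma multinomial_term_le (s : seq C) (n : C -> nat) f : (forall k, 0 <= f k) ->
  ((\sum_(k <- s) n k)%N)`!%:R * \prod_(k <- s) f k ^+ n k <=
  (\prod_(k <- s) (n k)`!)%N%:R * (\sum_(k <- s) f k) ^+ (\sum_(k <- s) n k).
Proof.
move=> f0; elim: s => [|k s IH]; first by rewrite !big_nil !mulr1.
rewrite !big_cons; set S := (\sum_(j <- s) n j)%N in IH *; set Sf := \sum_(j <- s) f j in IH *.
have Sf0 : 0 <= Sf by exact: sumr_ge0.
have term : 'C(n k + S, n k)%:R * (f k ^+ n k * Sf ^+ S) <= (f k + Sf) ^+ (n k + S).
  rewrite addrC exprDn (bigD1 (inord (n k)))//= inordK; last by rewrite ltnS leq_addr.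
  rewrite addKn [leLHS](_ : _ = (Sf ^+ S * f k ^+ n k) *+ 'C(n k + S, n k)).
    rewrite lerDl.
    by apply: sumr_ge0 => i _; rewrite mulrn_wge0// mulr_ge0 ?exprn_ge0.
  by rewrite -[RHS]mulr_natl [Sf ^+ S * _]mulrC.
have binE : ((n k + S)`! = 'C(n k + S, n k) * ((n k)`! * S`!))%N.
  by rewrite -(bin_fact (leq_addr S (n k))) addKn.
rewrite binE !natrM; apply: le_trans; last first.
  apply: ler_wpM2l; last exact: term.
  by rewrite mulr_ge0.
set P := \prod_(j <- s) f j ^+ n j in IH *; set Q := (\prod_(j <- s) (n j)`!)%N in IH *.
have -> : 'C(n k + S, n k)%:R * ((n k)`!%:R * S`!%:R) * (f k ^+ n k * P) =
  ('C(n k + S, n k)%:R * (n k)`!%:R * f k ^+ n k) * (S`!%:R * P) by ring.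
have -> : (n k)`!%:R * Q%:R * ('C(n k + S, n k)%:R * (f k ^+ n k * Sf ^+ S)) =
  ('C(n k + S, n k)%:R * (n k)`!%:R * f k ^+ n k) * (Q%:R * Sf ^+ S) by ring.
by apply: ler_wpM2l => //; rewrite !mulr_ge0// exprn_ge0.
Qed.

Lemma prod_cnt c n f : \prod_(0 <= s < n) f (c s) = \prod_k f k ^+ cnt c n k.
Proof.
elim: n => [|n IH].
  by rewrite big_nil big1// => k _; rewrite /cnt big_nil expr0.
rewrite big_nat_recr//= IH; under [RHS]eq_bigr do rewrite cntS exprD.
rewrite big_split /=; congr (_ * _); rewrite (bigD1 (c n))//= eqxx expr1.
by rewrite big1 ?mulr1// => k /negbTE; rewrite eq_sym => ->.
Qed.

(** The probability of a word depends on its counts only. *)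
Lemma laplace_closed_form c n : (0 < #|C|)%N ->
  laplace c n * ((n + #|C|).-1)`!%:R = (#|C|.-1)`!%:R * (\prod_k (cnt c n k)`!)%N%:R.
Proof.
move=> C0; elim: n => [|n IH].
  rewrite /laplace big_nil mul1r add0n big1 ?mulr1// => k _; by rewrite /cnt big_nil.
have -> : (n.+1 + #|C|).-1 = (n + #|C|).-1.+1 by lia.
rewrite laplaceS factS (prednK (ltn_addl _ C0)).
have -> : (\prod_k (cnt c n.+1 k)`! = (cnt c n (c n)).+1 * \prod_k (cnt c n k)`!)%N.
  rewrite (bigD1 (c n))//= [in RHS](bigD1 (c n))//= cntS eqxx addn1 factS -mulnA.
  congr (_ * (_ * _))%N; apply: eq_bigr => k /negbTE; rewrite eq_sym => kn.
  by rewrite cntS kn addn0.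
rewrite !natrM /laplace_step.
have nC : (n + #|C|)%:R != 0 :> R by rewrite pnatr_eq0 -lt0n ltn_addl.
transitivity ((cnt c n (c n)).+1%:R * (laplace c n * ((n + #|C|).-1)`!%:R)).
  by field; rewrite -natrD.
by rewrite IH; ring.
Qed.

Lemma fact_shift_le (n K : nat) : ((n + K)`! <= n`! * (n + K) ^ K)%N.
Proof.
elim: K => [|K IH]; first by rewrite addn0 muln1.
rewrite addnS factS expnS mulnCA leq_mul2l; apply/orP; right.
apply: (leq_trans IH); rewrite leq_mul2l; apply/orP; right.
by case: (K) => // K'; rewrite leq_exp2r.
Qed.

(** The Laplace probability is the reciprocal of the multinomial coefficient up to
    a factor polynomial in [n], and a multinomial term is at most one. *)
Lemma laplace_ge c n f : (0 < #|C|)%N -> (forall k, 0 <= f k) -> \sum_k f k = 1 ->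
  \prod_(0 <= s < n) f (c s) <= laplace c n * (n + #|C|)%:R ^+ #|C|.
Proof.
move=> C0 f0 f1; have fact_gt m : 0 < m`!%:R :> R by rewrite ltr0n fact_gt0.
rewrite prod_cnt; set PI := \prod_k _.
have PI0 : 0 <= PI by apply: prodr_ge0 => k _; rewrite exprn_ge0.
have multi := multinomial_term_le (index_enum C) (cnt c n) f0.
rewrite f1 expr1n mulr1 sum_cnt -/PI in multi.
have closed := laplace_closed_form c n C0.
rewrite -(ler_pM2l (fact_gt (n + #|C|).-1)) mulrA [_ * laplace _ _]mulrC closed.
have h1 : ((n + #|C|).-1)`!%:R <= n`!%:R * (n + #|C|)%:R ^+ #|C| :> R.
  rewrite -natrX -natrM ler_nat -{1}(prednK C0) addnS /=.
  apply: (leq_trans (fact_shift_le _ _)); rewrite leq_mul2l; apply/orP; right.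
  apply: (@leq_trans ((n + #|C|) ^ #|C|.-1)%N).
    by case: (#|C|.-1) (leq_pred #|C|) => // m ?; rewrite leq_exp2r// leq_add2l.
  have -> : ((n + #|C|) ^ #|C| = (n + #|C|) * (n + #|C|) ^ #|C|.-1)%N.
    by rewrite -expnS prednK.
  by rewrite leq_pmull// ltn_addl.
apply: (le_trans (ler_wpM2r PI0 h1)).
rewrite mulrAC; apply: ler_wpM2r; first by rewrite exprn_ge0.
by apply: (le_trans multi); rewrite -natrM ler_nat leq_pmull// fact_gt0.
Qed.

End laplace.

(** * Maximum likelihood with a floor on the cell weights *)

Section waterfilling.
Context {R : realType} {C : finType}.
Implicit Types (n : C -> nat) (v u : C -> R).

Definition floored_weights (gam : R) (v : C -> R) : Prop :=
  (forall k, gam / #|C|%:R <= v k) /\ \sum_k v k = 1.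

(** The second clause compares the weights with the empirical frequencies from
    below; it holds for the maximiser and keeps it close to the Laplace rule. *)
Definition floored_mle (gam : R) n v : Prop :=
  [/\ floored_weights gam v,
      forall k, (1 - gam) * (n k)%:R <= v k * (\sum_k n k)%N%:R &
      forall u, floored_weights gam u ->
        \sum_k (n k)%:R * ln (u k) <= \sum_k (n k)%:R * ln (v k)].

Lemma sum_floor (a : R) : (0 < #|C|)%N -> \sum_(k : C) a / #|C|%:R = a.
Proof.
by move=> C0; rewrite sumr_const -[LHS]mulr_natr divfK// pnatr_eq0 -lt0n.
Qed.

(** Raising every empirical frequency to the common floor and rescaling the
    others by one factor [c] satisfies the optimality conditions. *)
Lemma floored_mle_exists (gam : R) n : (0 < #|C|)%N -> 0 < gam < 1 ->
  exists v, floored_mle gam n v.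
Proof.
move=> C0 /andP[g0 g1]; have K0 : 0 < #|C|%:R :> R by rewrite ltr0n.
set t := (\sum_k n k)%N; have [t0|t0] := posnP t.
  have n0 k : n k = 0%N by apply/eqP; move/eqP: t0; rewrite sum_nat_eq0 => /forallP/(_ k).
  exists (fun=> 1 / #|C|%:R); split; first split.
  - by move=> k; rewrite ler_pM2r ?invr_gt0// ltW.
  - exact: sum_floor.
  - by move=> k; rewrite n0 mulr0 mulr_ge0// divr_ge0.
  - by move=> u _; rewrite !big1// => k _; rewrite n0 mul0r.
have t0' : 0 < t%:R :> R by rewrite ltr0n.
have freq : \sum_k (n k)%:R / t%:R = 1 :> R.
  by rewrite -mulr_suml -natr_sum divff// gt_eqF.
pose F (c : R) : R := \sum_(k : C) Num.max (gam / #|C|%:R) (c * ((n k)%:R / t%:R)).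
have cF : continuous F.
  apply: continuous_big => [|k _ x]; first exact: add_continuous.
  apply: (@continuous_max R R (fun=> _) (fun c => c * _)); first exact: cvg_cst.
  exact: mulrr_continuous.
have F1 : 1 <= F 1.
  by rewrite -[leLHS]freq; apply: ler_sum => k _; rewrite mul1r le_max lexx orbT.
have Fg : F (1 - gam) <= 1.
  apply: (@le_trans _ _ (\sum_(k : C) (gam / #|C|%:R + (1 - gam) * ((n k)%:R / t%:R)))).
    apply: ler_sum => k _; rewrite ge_max lerDl lerDr.
    by rewrite !mulr_ge0 ?invr_ge0// ?subr_ge0 ltW.
  by rewrite big_split /= sum_floor// -mulr_sumr freq mulr1 addrC subrK.
(* The weights sum to one for some factor [c], by continuity. *)
have [|||c] := @IVT R F (1 - gam) 1 1.
- by rewrite gerBl ltW.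
- exact: continuous_subspaceT.
- by rewrite ge_min Fg le_max F1 orbT.
rewrite in_itv /= => /andP[gc c1] Fc.
have c0 : 0 < c by lra.
pose v k := Num.max (gam / #|C|%:R) (c * ((n k)%:R / t%:R)).
have v0 k : 0 < v k by rewrite lt_max divr_gt0.
exists v; split; first split.
- by move=> k; rewrite le_max lexx.
- exact: Fc.
- move=> k; have : c * ((n k)%:R / t%:R) <= v k by rewrite le_max lexx orbT.
  rewrite -(ler_pM2r t0') -mulrA divfK ?gt_eqF//; apply: le_trans.
  by rewrite ler_wpM2r.
- move=> u [uf u1]; have u0 k : 0 < u k by apply: lt_le_trans (uf k); rewrite divr_gt0.
  rewrite -subr_le0 -sumrB.
  apply: (@le_trans _ _ (\sum_k (t%:R / c) * (u k - v k))); last first.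
    by rewrite -mulr_sumr sumrB u1 [X in 1 - X]Fc subrr mulr0.
  apply: ler_sum => k _; rewrite -mulrBr -ln_div ?posrE//.
  apply: (@le_trans _ _ ((n k)%:R * ((u k - v k) / v k))).
    rewrite ler_wpM2l//; have -> : u k / v k = 1 + (u k - v k) / v k.
      by field; rewrite gt_eqF.
    apply: le_ln1Dx; rewrite -subr_gt0 opprK.
    have -> : (u k - v k) / v k + 1 = u k / v k by field; rewrite gt_eqF.
    by rewrite divr_gt0.
  have [le|lt] := leP (gam / #|C|%:R) (c * ((n k)%:R / t%:R)).
    have -> : v k = c * ((n k)%:R / t%:R) by rewrite /v max_r.
    have [->|nk] := posnP (n k).
      rewrite mul0r !mul0r mulr0 subr0; apply: mulr_ge0; last exact: ltW.
      by rewrite divr_ge0 ?ltW.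
    rewrite le_eqVlt; apply/orP; left; apply/eqP; field.
    by rewrite !gt_eqF ?ltr0n.
  have vE : v k = gam / #|C|%:R by rewrite /v max_l// ltW.
  have uv : 0 <= u k - v k by rewrite vE subr_ge0.
  rewrite mulrA mulrAC; apply: ler_wpM2r => //.
  rewrite ler_pdivrMr// mulrAC ler_pdivlMr//.
  have : c * ((n k)%:R / t%:R) <= v k by rewrite vE ltW.
  by rewrite mulrA ler_pdivrMr// mulrC [v k * _]mulrC.
Qed.

Definition floored_weights_of (gam : R) n : C -> R :=
  xget (fun=> 0) [set v | floored_mle gam n v].

Lemma floored_weights_ofP gam n : (0 < #|C|)%N -> 0 < gam < 1 ->
  floored_mle gam n (floored_weights_of gam n).
Proof.
move=> C0 g01; have [v hv] := floored_mle_exists n C0 g01.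
by apply: (@xgetPex _ (fun=> 0) [set v | floored_mle gam n v]); exists v.
Qed.

(** Mixing the two lower bounds of the weights recovers the Laplace rule. *)
Lemma floored_ge_laplace gam n v k : (0 < #|C|)%N -> 0 < gam <= 4^-1 ->
  floored_mle gam n v -> #|C|%:R / gam ^+ 2 <= (\sum_k n k)%N%:R ->
  (1 - 2 * gam) * ((n k).+1%:R / (\sum_k n k + #|C|)%N%:R) <= v k.
Proof.
move=> C0 /andP[g0 g4] [[vf _] vn _] big; set t := (\sum_k n k)%N in vn big *.
have K0 : 0 < #|C|%:R :> R by rewrite ltr0n.
have t0 : 0 < t%:R :> R by apply: lt_le_trans big; rewrite divr_gt0// exprn_gt0.
have tK : 0 < (t + #|C|)%N%:R :> R by rewrite natrD addr_gt0.
rewrite mulrA ler_pdivrMr// -natr1 natrD.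
have v0 : 0 < v k by apply: lt_le_trans (vf k); rewrite divr_gt0.
have h2 := vn k.
have h3 : 1 <= gam * (v k * t%:R).
  rewrite mulrC -ler_pdivrMr// mul1r.
  have -> : gam^-1 = gam / #|C|%:R * (#|C|%:R / gam ^+ 2).
    by field; rewrite !gt_eqF.
  by apply: ler_pM => //; rewrite divr_ge0// ?exprn_ge0 ?ltW.
have h4 : 0 <= v k * #|C|%:R by rewrite mulr_ge0// ltW.
have h5 : 0 <= gam ^+ 2 * (n k)%:R by rewrite mulr_ge0// sqr_ge0.
have := ler_wpM2l (_ : 0 <= 1 - gam) h2; rewrite subr_ge0 => /(_ _)/=.
have g1 : gam <= 1 by lra.
move=> /(_ g1); move: h3 h4 h5; set a := v k * t%:R; set b := v k * _.
by rewrite mulrDr -/a -/b; nra.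
Qed.

End waterfilling.

(** * The sieve estimator *)

Section estimator.
Context {R : realType} {d : nat}.

(** The estimator at time [t] uses the grid of the epoch of [t].  Epochs grow by
    the factor [2 ^ (d + 3)] while the number of cells per axis doubles: with [t]
    of order [2 ^ (j * (d + 3))], the discretisation error [t / 2 ^ j] and the
    Laplace regret [2 ^ (j * d) * ln t] are at most of order
    [2 ^ (j * (d + 2))], the order of the gain [delta ^+ 2 * t] when
    [delta ^+ 2] is about [2 ^- j].  The factor 16 is what [epoch_size_enough]
    requires. *)
Definition epoch (t : nat) : nat := trunc_log (2 ^ (d + 3)) (t %/ 16).

Definition epoch_start (j : nat) : nat := (16 * 2 ^ (j * (d + 3)))%N.

(** Grids are indexed by their number of cells per axis minus one. *)
Definition gridN (j : nat) : nat := (2 ^ j).-1.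

Lemma gridNS j : (gridN j).+1 = (2 ^ j)%N.
Proof. by rewrite /gridN prednK// expn_gt0. Qed.

(** The total mass reserved for the floor: of order [2 ^- j], like the
    discretisation error of a Lipschitz density. *)
Definition floor_mass (j : nat) : R := (2 ^ (j + 2))%:R^-1.

Lemma floor_mass_bounds j : 0 < floor_mass j <= 4^-1.
Proof.
rewrite /floor_mass invr_gt0 ltr0n expn_gt0/= lef_pV2 ?posrE ?ltr0n ?expn_gt0//.
by rewrite (ler_nat R 4) expnD leq_pmull// expn_gt0.
Qed.

Lemma epochP (j t : nat) : (epoch_start j <= t < epoch_start j.+1)%N -> epoch t = j.
Proof.
move=> /andP[h1 h2]; apply: trunc_log_eq; first by rewrite -{1}(expn0 2) ltn_exp2l// addnS.
have e i : ((2 ^ (d + 3)) ^ i * 16 = epoch_start i)%N.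
  by rewrite /epoch_start -expnM mulnC [((d + 3) * i)%N]mulnC.
by rewrite leq_divRL// ltn_divLR// !e h1.
Qed.

Lemma epoch0 t : (t < epoch_start 1)%N -> epoch t = 0%N.
Proof.
rewrite /epoch_start mul1n => h; rewrite /epoch.
have : (t %/ 16 < 2 ^ (d + 3))%N by rewrite ltn_divLR// mulnC.
by move=> lt; apply/eqP; rewrite trunc_log_eq0; apply/orP; right; lia.
Qed.

Lemma epoch_start_le i j : (i <= j)%N -> (epoch_start i <= epoch_start j)%N.
Proof. by move=> ij; rewrite /epoch_start leq_mul2l leq_exp2l// leq_mul2r ij !orbT. Qed.

Lemma leq_d_epoch_start j : (d <= epoch_start j.+1)%N.
Proof.
apply: (@leq_trans (2 ^ d)%N); first exact/ltnW/ltn_expl.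
rewrite /epoch_start -(expnD 2 4) leq_exp2l//; nia.
Qed.

Section step_density.
Variable N : nat.
Local Notation w := (@wd R N).
Local Notation cell := {ffun 'I_d -> 'I_N.+1}.

Lemma card_cell : #|{: cell}| = (N.+1 ^ d)%N.
Proof. by rewrite card_ffun !card_ord. Qed.

Lemma card_cell_gt0 : (0 < #|{: cell}|)%N.
Proof. by rewrite card_cell expn_gt0. Qed.

Definition step_density (v : cell -> R) (x : d.-tuple R) : R :=
  \sum_(k : cell) v k / w ^+ d * \1_(gcell k) x.

Lemma step_density_in v k x : gcell k x -> step_density v x = v k / w ^+ d.
Proof.
move=> kx; rewrite /step_density (bigD1 k)//= indicE mem_set// mulr1 big1 ?addr0//.
move=> l lk; rewrite indicE memNset ?mulr0// => lx; move/eqP: lk; apply.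
by move/gcellP: kx => [_ <-]; move/gcellP: lx => [_ <-].
Qed.

Lemma step_density_out v x : ~ box x -> step_density v x = 0.
Proof.
move=> nx; rewrite /step_density big1// => k _; rewrite indicE memNset ?mulr0//.
by move=> /gcellP[].
Qed.

Lemma step_density_density v : (forall k, 0 <= v k) -> \sum_k v k = 1 ->
  density (step_density v).
Proof.
move=> v0 v1; have w0 : 0 < w ^+ d by rewrite exprn_gt0// wd_gt0.
have c0 k : 0 <= v k / w ^+ d by rewrite divr_ge0// ltW.
have mi k : measurable_fun setT (\1_(gcell k) : d.-tuple R -> R).
  by apply: measurable_indic; exact: measurable_gcell.
have mt k : measurable_fun setT (fun x : d.-tuple R => v k / w ^+ d * \1_(gcell k) x).
  exact: (measurable_funM (measurable_cst _) (mi N k)).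
split.
- by move=> x; apply: sumr_ge0 => k _; rewrite mulr_ge0.
- by apply: measurable_sum => k; exact: mt.
under eq_integral do rewrite -sumEFin.
rewrite ge0_integral_sum//; last 2 first.
- by move=> k; exact/measurable_EFinP.
- by move=> k x _; rewrite lee_fin mulr_ge0.
rewrite -[RHS]/(1%:E) -v1 -sumEFin; apply: eq_bigr => k _.
under eq_integral do rewrite EFinM.
rewrite ge0_integralZl_EFin//; last exact/measurable_EFinP.
rewrite integral_indic//; last exact: measurable_gcell.
transitivity ((v k / w ^+ d)%:E * (w ^+ d)%:E : \bar R)%E.
  by rewrite setIT; congr (_ * _)%E; exact: lebesgue_gcell.
by rewrite -EFinM divfK// gt_eqF.
Qed.

Definition counts (t : nat) (xs : t.-tuple (d.-tuple R)) (k : cell) : nat :=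
  (\sum_(s < t) `[< gcell k (tnth xs s) >])%N.

Lemma loglik_step (t : nat) (xs : t.-tuple (d.-tuple R)) v :
  (forall s, box (tnth xs s)) -> (forall k, 0 < v k) ->
  loglik xs (step_density v) =
  (\sum_k (counts xs k)%:R * ln (v k) - (ln (w ^+ d)) *+ t)%:E.
Proof.
move=> inbox v0; have w0 : 0 < w ^+ d by rewrite exprn_gt0// wd_gt0.
have kx s : gcell (cidx N (tnth xs s)) (tnth xs s) by apply/gcellP; split.
have -> : \sum_k (counts xs k)%:R * ln (v k) =
    \sum_(s < t) ln (v (cidx N (tnth xs s))).
  under eq_bigr do rewrite natr_sum mulr_suml.
  rewrite exchange_big; apply: eq_bigr => s _; rewrite (bigD1 (cidx N (tnth xs s)))//=.
  rewrite asboolT// mul1r big1 ?addr0// => k /eqP nk; rewrite asboolF ?mul0r//.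
  by move=> /gcellP[_ e]; apply: nk.
rewrite -[X in _ *+ X]card_ord -sumr_const -sumrB -sumEFin; apply: eq_bigr => s _.
by rewrite (step_density_in _ (kx s)) lne_EFin ?divr_gt0// ln_div ?posrE.
Qed.

Lemma loglik_step_out (t : nat) (xs : t.-tuple (d.-tuple R)) v s :
  ~ box (tnth xs s) -> loglik xs (step_density v) = -oo%E.
Proof.
move=> ns; rewrite /loglik (bigD1 s)// step_density_out//.
by rewrite [lne _]le0_lneNy// addNye.
Qed.

(** The log-likelihood of a step density depends on the cell counts only.  Every
    step density has likelihood zero at a sample with a point outside the
    box. *)
Lemma step_density_mle gam (t : nat) (xs : t.-tuple (d.-tuple R)) : 0 < gam < 1 ->
  is_mle [set step_density v | v in floored_weights gam] xs
    (step_density (floored_weights_of gam (counts xs))).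
Proof.
move=> g01; have [vf _ vmax] := floored_weights_ofP (counts xs) card_cell_gt0 g01.
have pos v : floored_weights gam v -> forall k : cell, 0 < v k.
  move=> [h _] k; apply: lt_le_trans (h k).
  by case/andP: g01 => g0 _; rewrite divr_gt0// ltr0n card_cell_gt0.
split; first by exists (floored_weights_of gam (counts xs)).
move=> _ [u uf <-].
have [inbox|/existsNP[s ns]] := pselect (forall s, box (tnth xs s)); last first.
  by rewrite !(loglik_step_out _ ns).
rewrite !loglik_step//; [|exact: pos..].
by rewrite lee_fin lerD2r; exact: vmax.
Qed.

End step_density.

Definition sieve (t : nat) : set (d.-tuple R -> R) :=
  [set @step_density (gridN (epoch t)) v | v in floored_weights (floor_mass (epoch t))].

Definition sieve_estimator : estimator_seq R d := fun t xs =>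
  @step_density (gridN (epoch t))
    (floored_weights_of (floor_mass (epoch t)) (counts xs)).

Lemma floor_mass01 j : 0 < floor_mass j < 1.
Proof. by have /andP[-> h] := floor_mass_bounds j; apply: (le_lt_trans h); lra. Qed.

Lemma floored_ge0 N gam (v : {ffun 'I_d -> 'I_N.+1} -> R) : 0 < gam ->
  floored_weights gam v -> forall k, 0 <= v k.
Proof. by move=> g0 [h _] k; apply: le_trans (h k); rewrite divr_ge0// ltW. Qed.

Lemma sieve_estimator_mle : sieve_mle_seq sieve_estimator.
Proof.
exists sieve; first move=> t _ [v vf <-].
  have /andP[g0 _] := floor_mass01 (epoch t).
  by apply: step_density_density; [exact: floored_ge0 vf|case: vf].
by move=> t xs; apply: step_density_mle; exact: floor_mass01.
Qed.

(** The weights are picked by a choice function, but they depend on the sample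
    through finitely many cell memberships. *)
Lemma measurable_fun_finite (dT : measure_display) (T : measurableType dT) (J : finType)
    (b : T -> {ffun J -> bool}) (G : {ffun J -> bool} -> R) :
  (forall j, measurable [set z | b z j]) -> measurable_fun setT (G \o b).
Proof.
move=> mb _ Y mY; rewrite setTI.
have -> : (G \o b) @^-1` Y =
    \big[setU/set0]_(be : {ffun J -> bool} | `[< Y (G be) >]) [set z | b z = be].
  apply/seteqP; split=> [z /= Yz|z].
    by rewrite (bigD1 (b z))/=; [left|exact: asboolT].
  rewrite -bigcup_seq_cond => -[be /andP[_ /asboolP Y1]] /= bz.
  by rewrite /preimage /= bz.
apply: bigsetU_measurable => be _.
have -> : [set z | b z = be] = \bigcap_(j in [set: J]) [set z | b z j = be j].
  apply/seteqP; split=> z /= h; first by move=> j _ /=; rewrite h.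
  by apply/ffunP => j; exact: h.
apply: fin_bigcap_measurable => [|j _]; first exact: finite_finset.
case: (be j); first exact: mb.
rewrite (_ : [set z | _] = ~` [set z | b z j]); first exact: measurableC.
by apply/seteqP; split=> z /=; [move=> ->|move/negP/negbTE].
Qed.

Lemma sieve_estimator_measurable t :
  measurable_fun setT
    (fun z : t.-tuple (d.-tuple R) * d.-tuple R => sieve_estimator z.1 z.2).
Proof.
rewrite /sieve_estimator /step_density; set N := gridN _; set g := floor_mass _.
apply: measurable_sum => k; apply: measurable_funM; last first.
  have mi : measurable_fun setT (\1_(gcell k) : d.-tuple R -> R).
    by apply: measurable_indic; exact: measurable_gcell.
  exact: (measurableT_comp mi measurable_snd).
apply: measurable_funM => //.
pose J := ('I_t * {ffun 'I_d -> 'I_N.+1})%type.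
pose b (z : t.-tuple (d.-tuple R) * d.-tuple R) : {ffun J -> bool} :=
  [ffun j => `[< gcell j.2 (tnth z.1 j.1) >]].
pose G (be : {ffun J -> bool}) : R :=
  floored_weights_of g (fun k => \sum_(s < t) be (s, k))%N k.
rewrite (_ : (fun _ => _) = G \o b).
  apply: measurable_fun_finite => -[s l].
  have -> : [set z | b z (s, l)] =
      (fun z : t.-tuple (d.-tuple R) * d.-tuple R => tnth z.1 s) @^-1` gcell l.
    by apply/seteqP; split=> z /=; rewrite ffunE => /asboolP.
  rewrite -[X in measurable X]setTI.
  have mt : measurable_fun setT (fun z : t.-tuple (d.-tuple R) * d.-tuple R => tnth z.1 s).
    by apply: (measurableT_comp (measurable_tnth s)).
  by apply: mt => //; exact: measurable_gcell.
apply/funext => z /=; rewrite /G; congr (floored_weights_of _ _ _).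
by apply/funext => l; apply: eq_bigr => s _; rewrite ffunE.
Qed.

Lemma sieve_estimator_sequential : sequential_estimator sieve_estimator.
Proof.
move=> t; split; last exact: sieve_estimator_measurable.
move=> xs; have /andP[g0 _] := floor_mass01 (epoch t).
have [vf _ _] := floored_weights_ofP (@counts (gridN (epoch t)) t xs)
  (card_cell_gt0 (gridN (epoch t))) (floor_mass01 (epoch t)).
rewrite /sieve_estimator; apply: (step_density_density (floored_ge0 g0 vf)).
by case: vf.
Qed.

End estimator.

(** * Regret of the sieve estimator *)

Section regret.
Context {R : realType} {d : nat}.
Variables (B : R) (p : d.-tuple R -> R).
Hypotheses (B1 : 1 <= B) (hp : box_lip_density B p).
Let B0 : 0 < B. Proof. exact: (lt_le_trans ltr01 B1). Qed.

Section one_path.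
Variables (x : nat -> d.-tuple R) (T : nat).
Hypothesis inbox : forall i, (i < T)%N -> box (x i).

Local Notation cells N := (fun s => cidx N (x s)).
Local Notation E i := (sieve_estimator (sample x i) (x i)).
Local Notation K j := (#|{: {ffun 'I_d -> 'I_(gridN j).+1}}|).
Local Notation mass N := (@cell_mass R d p N).

Lemma counts_sample N i k : (i <= T)%N ->
  counts (sample x i) k = cnt (cells N) i k.
Proof.
move=> iT; rewrite /counts /cnt big_mkord; apply: eq_bigr => s _; congr nat_of_bool.
rewrite tnth_mktuple; apply/asboolP/eqP => [/gcellP[]//|e]; apply/gcellP; split=> //.
by apply: inbox; exact: leq_trans iT.
Qed.

Lemma sieve_estimatorE i : (i < T)%N -> let N := gridN (@epoch d i) in
  E i = floored_weights_of (floor_mass (@epoch d i)) (@counts R d N i (sample x i))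
    (cidx N (x i)) / wd N ^+ d.
Proof.
move=> iT N; rewrite /sieve_estimator (@step_density_in R d N _ (cidx N (x i)))//.
by apply/gcellP; split=> //; exact: inbox.
Qed.

Lemma card_gridN j : K j = (2 ^ (j * d))%N.
Proof. by rewrite card_cell gridNS -expnM. Qed.

(** From the start of its epoch on, the sample is large enough for
    [floored_ge_laplace]. *)
Lemma epoch_size_enough j i : (@epoch_start d j <= i)%N ->
  (K j)%:R / (floor_mass (R:=R) j) ^+ 2 <= i%:R.
Proof.
move=> ji; rewrite card_gridN /floor_mass -exprVn invrK -natrX -natrM ler_nat.
apply: leq_trans ji; rewrite /epoch_start -expnM -expnD -(expnD 2 4) leq_exp2l//.
nia.
Qed.

(** The loss per observation: the floor contributes [4 * floor_mass j] and the
    variation of the density within a cell [B * d%:R * wd (gridN j)]. *)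
Definition step_loss (j : nat) : R := (1 + 2 * B * d%:R) / (2 ^ j)%:R.

Lemma wd_gridN j : wd (R:=R) (gridN j) = 2 / (2 ^ j)%:R.
Proof. by rewrite /wd gridNS. Qed.

(** The floored weight nearly dominates the Laplace prediction, and the density is
    nearly its average over the cell. *)
Lemma step_lower j i : (@epoch_start d j <= i < @epoch_start d j.+1)%N -> (i < T)%N ->
  expR (- step_loss j) * p (x i) *
    (laplace_step (cells (gridN j)) i (cidx (gridN j) (x i)) /
     mass (gridN j) (cidx (gridN j) (x i))) <= E i.
Proof.
set N := gridN j => ij iT; have ej := epochP ij; have /andP[ji _] := ij.
rewrite sieve_estimatorE// ej -/N; set v := floored_weights_of _ _.
have sumc : (\sum_k @counts R d N i (sample x i) k)%N = i.
  by under eq_bigr do rewrite (counts_sample _ (ltnW iT)); exact: sum_cnt.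
have big : (K j)%:R / (floor_mass (R:=R) j) ^+ 2 <=
    (\sum_k @counts R d N i (sample x i) k)%N%:R by rewrite sumc; exact: epoch_size_enough.
have mle := floored_weights_ofP (@counts R d N i (sample x i)) (card_cell_gt0 N)
  (floor_mass01 (R:=R) j).
have := floored_ge_laplace (cidx N (x i)) (card_cell_gt0 N) (floor_mass_bounds (R:=R) j)
  mle big.
rewrite sumc (counts_sample _ (ltnW iT)) -/v -/(laplace_step _ _ _).
set k := cidx N (x i); set l := laplace_step _ _ _ => vl.
have kx : gcell k (x i) by apply/gcellP; split=> //; exact: inbox.
have [pm _] := cell_mass_osc B0 hp kx.
have m0 := cell_mass_gt0 B0 hp k; have w0 : 0 < wd (R:=R) N ^+ d by rewrite exprn_gt0// wd_gt0.
have l0 : 0 <= l by rewrite divr_ge0.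
have o1 := @osc_ge1 R d B B0 N; have o0 : 0 < osc (d:=d) B N by lra.
have fm : 4 * floor_mass (R:=R) j = ((2 ^ j)%:R)^-1.
  rewrite /floor_mass expnD natrM; field; rewrite pnatr_eq0.
  by rewrite -lt0n expn_gt0.
have /andP[g0 g4] := floor_mass_bounds (R:=R) j.
have loss : expR (- step_loss j) * osc (d:=d) B N <= 1 - 2 * floor_mass j.
  have -> : - step_loss j = - (4 * floor_mass j) + - (B * d%:R * wd N).
    by rewrite /N wd_gridN fm /step_loss; ring.
  rewrite expRD -mulrA; set y := B * d%:R * wd N.
  have h1 : expR (- y) * osc (d:=d) B N <= 1.
    rewrite expRN mulrC ler_pdivrMr ?expR_gt0// mul1r; exact: expR_ge1Dx.
  apply: (@le_trans _ _ (expR (- (4 * floor_mass j)))).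
    by rewrite ler_piMr// expR_ge0.
  rewrite expRN -[leLHS]mul1r ler_pdivrMr ?expR_gt0//.
  have := expR_ge1Dx (4 * floor_mass (R:=R) j).
  move: g0 g4; set g := floor_mass j; set e := expR _ => g0 g4 he.
  have : 0 <= (1 - 2 * g) * (e - (1 + 4 * g)) by rewrite mulr_ge0// subr_ge0//; lra.
  by nra.
rewrite ler_pdivlMr//.
apply: le_trans vl.
apply: (@le_trans _ _ (expR (- step_loss j) * osc (d:=d) B N * l)); last first.
  by apply: ler_wpM2r.
rewrite [leLHS](_ : _ = expR (- step_loss j) * (wd N ^+ d * p (x i) / mass N k) * l);
  last by rewrite -/k; ring.
apply: ler_wpM2r => //; apply: ler_wpM2l; first exact: expR_ge0.
by rewrite ler_pdivrMr.
Qed.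

(** The Laplace rule has not been overfitting up to time [a].  This is needed at
    the start of an epoch, whose grid differs from the one used before. *)
Definition laplace_good (N a : nat) (y : R) : Prop :=
  laplace (cells N) a <= expR y * \prod_(0 <= s < a) mass N (cidx N (x s)).

(** The regret within one epoch: the Laplace rule loses little on the whole past
    ([laplace_ge]), and dividing by its probability at the start of the epoch,
    which is not much larger than the true one, leaves the regret within the
    epoch. *)
Lemma epoch_lower j a b (y : R) : (@epoch_start d j <= a)%N -> (a <= b <= @epoch_start d j.+1)%N ->
  (b <= T)%N -> laplace_good (gridN j) a y ->
  expR (- (step_loss j * (b - a)%:R + (K j)%:R * ln (b + K j)%:R + y)) *
    \prod_(a <= i < b) p (x i) <= \prod_(a <= i < b) E i.
Proof.
move=> ja /andP[ab bj] bT good; set N := gridN j in good *.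
have K0 : (0 < K j)%N := card_cell_gt0 N.
pose m s := mass N (cidx N (x s)).
pose l s : R := laplace_step (cells N) s (cidx N (x s)).
have m0 s : 0 < m s by exact: (cell_mass_gt0 B0 hp).
have l0 s : 0 < l s by rewrite divr_gt0 ?ltr0n ?addn_gt0 ?K0 ?orbT.
have p0 i : 0 <= p (x i) by exact: (p_ge0 hp).
have prodm s t : 0 < \prod_(s <= i < t) m i by exact: prodr_gt0.
have prodl s t : 0 < \prod_(s <= i < t) l i by exact: prodr_gt0.
have lb : \prod_(0 <= s < b) m s <= \prod_(0 <= s < b) l s * (b + K j)%:R ^+ K j.
  apply: (@laplace_ge R _ (cells N) b (mass N)) => //.
    by move=> k; exact/ltW/(cell_mass_gt0 B0 hp).
  exact: sum_cell_mass hp N.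
have step : expR (- (step_loss j * (b - a)%:R)) * \prod_(a <= i < b) p (x i) *
    (\prod_(a <= i < b) l i / \prod_(a <= i < b) m i) <= \prod_(a <= i < b) E i.
  rewrite -mulNr expRM_natr -prodr_const_nat -prodf_div -!big_split /=.
  rewrite !big_nat; apply: ler_prod => i /andP[ai ib].
  apply/andP; split.
    by rewrite mulr_ge0 ?divr_ge0 ?(ltW (l0 _)) ?(ltW (m0 _))// mulr_ge0 ?expR_ge0.
  apply: step_lower; last exact: leq_trans bT.
  by rewrite (leq_trans ja ai) (leq_trans ib bj).
apply: le_trans step.
have -> : - (step_loss j * (b - a)%:R + (K j)%:R * ln (b + K j)%:R + y) =
  - (step_loss j * (b - a)%:R) + - ((K j)%:R * ln (b + K j)%:R + y) by ring.
rewrite expRD mulrAC; apply: ler_wpM2l.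
  by rewrite mulr_ge0 ?expR_ge0// prodr_ge0.
rewrite ler_pdivlMr//.
have bK : 0 < (b + K j)%:R :> R by rewrite ltr0n addn_gt0 K0 orbT.
have -> : expR (- ((K j)%:R * ln (b + K j)%:R + y)) = ((b + K j)%:R ^+ K j * expR y)^-1.
  by rewrite expRN expRD expRM_natl lnK ?posrE.
rewrite mulrC ler_pdivrMr; last by rewrite mulr_gt0 ?expR_gt0// exprn_gt0.
move: lb; rewrite /laplace_good in good.
rewrite !(@big_cat_nat _ _ _ a 0%N b)//= => lb.
have la : \prod_(0 <= s < a) l s <= expR y * \prod_(0 <= s < a) m s by exact: good.
rewrite -(ler_pM2l (prodm 0%N a)); apply: (le_trans lb).
have Kb0 : 0 <= (b + K j)%:R ^+ K j :> R by rewrite exprn_ge0// ltW.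
have lab0 := ltW (prodl a b).
move: la Kb0 lab0; move: (\prod_(0 <= s < a) l s) (\prod_(a <= s < b) l s) => la lab.
move: (\prod_(0 <= s < a) m s) (expR y) ((b + K j)%:R ^+ K j) => ma ey kb.
move=> la_le kb0 lab0.
rewrite (_ : ma * _ = ey * ma * (lab * kb)); last by ring.
by rewrite -mulrA; apply: ler_wpM2r => //; exact: mulr_ge0.
Qed.

(** Before time [epoch_start 1] there is a single cell, and its weight is at least
    its floor. *)
Lemma first_epoch_lower a b : (a <= b <= @epoch_start d 1)%N -> (b <= T)%N ->
  expR (- (ln (4 * 2 ^+ d * B) * (b - a)%:R)) * \prod_(a <= i < b) p (x i) <=
  \prod_(a <= i < b) E i.
Proof.
move=> /andP[ab b1] bT; have c0 : 0 < 4 * 2 ^+ d * B :> R by rewrite !mulr_gt0// exprn_gt0.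
rewrite -mulNr expRM_natr -prodr_const_nat -!big_split /= !big_nat.
apply: ler_prod => i /andP[ai ib]; have iT : (i < T)%N by exact: leq_trans bT.
have pB := p_le hp (inbox iT); have p0 := p_ge0 hp (x i).
rewrite mulr_ge0 ?expR_ge0//= sieve_estimatorE// epoch0; last exact: leq_trans b1.
set v := floored_weights_of _ _.
have [[vf _] _ _] := floored_weights_ofP (@counts R d (gridN 0) i (sample x i))
  (card_cell_gt0 (gridN 0)) (floor_mass01 (R:=R) 0).
have := vf (cidx (gridN 0) (x i)); rewrite -/v card_gridN mul0n expn0 divr1 => v4.
have -> : wd (gridN 0) = 2 :> R by rewrite wd_gridN expn0 divr1.
have w0 : 0 < 2 ^+ d :> R by rewrite exprn_gt0.
have v4' : 4^-1 <= v (cidx (gridN 0) (x i)) by exact: v4.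
rewrite ler_pdivlMr//; apply: le_trans v4'.
rewrite expRN lnK ?posrE// -[leLHS]mulrA [leLHS]mulrC ler_pdivrMr//.
have -> : 4^-1 * (4 * 2 ^+ d * B) = 2 ^+ d * B by field.
by rewrite [2 ^+ d * B]mulrC ler_pM2r.
Qed.

(** Bounds [step_loss] times the length of the epoch plus the Laplace regret, in
    units of [2 ^ (j * (d + 2))]. *)
Definition epoch_cost : R :=
  (1 + 2 * B * d%:R) * (2 ^ (d + 7))%:R + (d + 8)%:R.

Lemma epoch_cost_bound j a b : (a <= b <= @epoch_start d j.+1)%N ->
  step_loss j * (b - a)%:R + (K j)%:R * ln (b + K j)%:R <=
  epoch_cost * (2 ^ (j * (d + 2)))%:R.
Proof.
move=> /andP[ab bj]; rewrite /epoch_cost mulrDl; apply: lerD.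
  rewrite /step_loss -!mulrA; apply: ler_wpM2l.
    by rewrite addr_ge0// !mulr_ge0// ltW.
  rewrite mulrC ler_pdivrMr ?ltr0n ?expn_gt0// -!natrM ler_nat.
  apply: (leq_trans (leq_subr _ _)); apply: (leq_trans bj).
  rewrite /epoch_start -(expnD 2 4) -!expnD leq_exp2l//; nia.
rewrite card_gridN.
have h1 : (b + 2 ^ (j * d) <= 2 ^ (5 + j.+1 * (d + 3)))%N.
  have e : (2 ^ (5 + j.+1 * (d + 3)) = @epoch_start d j.+1 + @epoch_start d j.+1)%N.
    by rewrite /epoch_start -(expnD 2 4) addnn -mul2n -expnS.
  rewrite e; apply: leq_add => //; rewrite /epoch_start -(expnD 2 4) leq_exp2l//; nia.
have h2 : ln (b + 2 ^ (j * d))%:R <= (5 + j.+1 * (d + 3))%N%:R :> R.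
  have ln2 : ln 2 <= 1 :> R by rewrite -[X in ln X]/(1 + 1); apply: le_ln1Dx; lra.
  apply: (@le_trans _ _ (ln (2 ^ (5 + j.+1 * (d + 3)))%:R)).
    have h0 : 0 < (b + 2 ^ (j * d))%:R :> R by rewrite ltr0n addn_gt0 expn_gt0 orbT.
    have h1' : (b + 2 ^ (j * d))%:R <= (2 ^ (5 + j.+1 * (d + 3)))%:R :> R.
      by rewrite ler_nat.
    by rewrite ler_ln ?posrE//; exact: lt_le_trans h1'.
  by rewrite natrX lnXn// -[leLHS]mulr_natr ler_piMl.
have j2 : (j.+1 <= 2 ^ j)%N by exact: ltn_expl.
apply: (@le_trans _ _ ((2 ^ (j * d))%:R * (5 + j.+1 * (d + 3))%:R)).
  by apply: ler_wpM2l.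
rewrite -!natrM ler_nat.
have -> : (2 ^ (j * (d + 2)) = 2 ^ (j * d) * (2 ^ j * 2 ^ j))%N.
  by rewrite -!expnD; congr (2 ^ _)%N; lia.
rewrite mulnCA leq_mul2l; apply/orP; right.
apply: (@leq_trans ((d + 8) * 2 ^ j)%N); first by nia.
by rewrite leq_mul2l -{1}[(2 ^ j)%N]muln1 leq_mul2l expn_gt0 !orbT.
Qed.

(** Each epoch starts a new account: its regret only depends on how the Laplace
    rule of its own grid fares on the past. *)
Lemma regret_path (m t : nat) (y : R) : 0 <= y ->
  (d <= t <= T)%N -> (@epoch_start d m <= t <= @epoch_start d m.+1)%N ->
  (forall j, (1 <= j <= m)%N -> laplace_good (gridN j) (@epoch_start d j) y) ->
  expR (- (ln (4 * 2 ^+ d * B) * (@epoch_start d 1)%:R +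
     \sum_(1 <= j < m.+1) (epoch_cost * (2 ^ (j * (d + 2)))%:R + y))) *
    \prod_(d <= i < t) p (x i) <= \prod_(d <= i < t) E i.
Proof.
move=> y0; elim: m t => [|m IH] t /andP[dt tT] /andP[mt tm] good.
  rewrite [\sum_(1 <= j < 1) _]big_geq// addr0; have dt1 : (d <= t <= @epoch_start d 1)%N by rewrite dt.
  apply: le_trans (first_epoch_lower dt1 tT); apply: ler_wpM2r.
    by apply: prodr_ge0 => i _; exact: (p_ge0 hp).
  rewrite ler_expR lerN2; apply: ler_wpM2l.
    apply: ln_ge0; rewrite -[1]mulr1; apply: ler_pM => //.
    by rewrite -[1]mulr1; apply: ler_pM => //; [lra|rewrite exprn_ege1//; lra].
  by rewrite ler_nat; apply: leq_trans (leq_subr _ _) tm.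
set s := @epoch_start d m.+1 in mt *.
have ds : (d <= s)%N by exact: leq_d_epoch_start.
have sT : (s <= T)%N by exact: leq_trans mt tT.
have IHs : expR (- (ln (4 * 2 ^+ d * B) * (@epoch_start d 1)%:R +
     \sum_(1 <= j < m.+1) (epoch_cost * (2 ^ (j * (d + 2)))%:R + y))) *
    \prod_(d <= i < s) p (x i) <= \prod_(d <= i < s) E i.
  apply: IH; first by rewrite ds.
    by rewrite epoch_start_le//= leqnn.
  by move=> j /andP[j1 jm]; apply: good; rewrite j1 leqW.
have goodm : laplace_good (gridN m.+1) s y by apply: good; rewrite /= leqnn.
have sts : (s <= t <= @epoch_start d m.+2)%N by rewrite mt.
have last := epoch_lower (leqnn s) sts tT goodm.
have cost := epoch_cost_bound sts.
rewrite !(@big_cat_nat _ _ _ s d t)//= big_nat_recr//=.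
set c1 := _ + \sum_(1 <= j < m.+1) _ in IHs; set c2 := epoch_cost * _ + y.
rewrite addrA -/c1 opprD expRD mulrACA; apply: ler_pM => //.
- by rewrite mulr_ge0 ?expR_ge0// prodr_ge0// => i _; exact: (p_ge0 hp).
- by rewrite mulr_ge0 ?expR_ge0// prodr_ge0// => i _; exact: (p_ge0 hp).
apply: le_trans last; apply: ler_wpM2r.
  by apply: prodr_ge0 => i _; exact: (p_ge0 hp).
by rewrite ler_expR lerN2 lerD2r.
Qed.

End one_path.
End regret.

Section regret_event.
Context {R : realType} {d : nat}.
Variables (B : R) (p : d.-tuple R -> R).
Hypothesis hp : box_lip_density B p.
Context {dT : measure_display} {T : measurableType dT}.
Variables (P : probability T R) (X : nat -> {RV P >-> d.-tuple R}).
Hypothesis hX : iid_with_density X p.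

(** The Laplace probabilities sum to one, so they seldom exceed the true ones
    by a large factor. *)
Lemma laplace_event (N a : nat) (y : R) : exists E : set T, [/\ measurable E,
  (P E <= (expR (- y))%:E)%E &
  forall om, ~ E om -> laplace_good p (fun i => X i om) N a y].
Proof.
pose k0 : {ffun 'I_d -> 'I_N.+1} := [ffun=> ord0].
have [|E [mE PE hE]] := @cell_word_event R d B p hp dT T P X hX N a
  (fun k => expR y * \prod_(i < a) cell_mass p (k i) < laplace (word_fun k0 k) a)
  (expR (- y)).
  apply: (@le_trans _ _ (\sum_(k : {ffun 'I_a -> {ffun 'I_d -> 'I_N.+1}})
    expR (- y) * laplace (word_fun k0 k) a)); last first.
    by rewrite -mulr_sumr sum_laplace mulr1.
  rewrite big_mkcond; apply: ler_sum => k _; case: ifPn => [lt|_].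
    by rewrite expRN ler_pdivlMl ?expR_gt0// ltW.
  rewrite mulr_ge0 ?expR_ge0// ltW// laplace_gt0//.
  by rewrite card_ffun !card_ord expn_gt0.
exists E; split=> // om /hE[_]; rewrite -leNgt /laplace_good.
rewrite (eq_laplace (c' := fun s => cidx N (X s om))); last first.
  by move=> s sa; rewrite /word_fun (insubT (fun s => s < a)%N sa) ffunE.
rewrite big_mkord => h; apply: (le_trans h); rewrite le_eqVlt; apply/orP; left.
by apply/eqP; congr (_ * _); apply: eq_bigr => i _; rewrite ffunE.
Qed.

End regret_event.

Lemma sum_geometric_le (R : realType) (r m : nat) : (1 <= r)%N ->
  \sum_(1 <= j < m.+1) (2 ^ (j * r))%:R <= 2 * (2 ^ (m * r))%:R :> R.
Proof.
move=> r1; elim: m => [|m IH]; first by rewrite big_geq.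
rewrite big_nat_recr//=; apply: (@le_trans _ _ (2 * (2 ^ (m * r))%:R + (2 ^ (m.+1 * r))%:R)).
  by rewrite lerD2r.
have : (2 * 2 ^ (m * r) <= 2 ^ (m.+1 * r))%N.
  by rewrite -expnS leq_exp2l//; nia.
by rewrite -(ler_nat R) natrM; lra.
Qed.

(** The cost of the epochs grows geometrically, so the last one dominates.  The
    Laplace rules of all epochs are controlled at confidence [expR (- 2 ^ m)]. *)
Lemma regret_bound (R : realType) (d : nat) (B : R) : 1 <= B ->
  exists2 D : R, 0 < D &
  forall p : d.-tuple R -> R, box_lip_density B p ->
  forall (dT : measure_display) (T : measurableType dT) (P : probability T R)
    (X : nat -> {RV P >-> d.-tuple R}), iid_with_density X p ->
  forall m t : nat, (1 <= m)%N -> (@epoch_start d m <= t <= @epoch_start d m.+1)%N ->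
  exists E : set T, [/\ measurable E,
    (P E <= (m%:R * expR (- (2 ^ m)%:R))%:E)%E &
    forall om, ~ E om -> (forall i, (i < t)%N -> box (X i om)) ->
      expR (- (D * (2 ^ (m * (d + 2)))%:R)) * \prod_(d <= i < t) p (X i om) <=
      \prod_(d <= i < t) sieve_estimator (sample (fun i => X i om) i) (X i om)].
Proof.
move=> B1; have B0 : 0 < B by lra.
pose c0 := ln (4 * 2 ^+ d * B) * (@epoch_start d 1)%:R.
pose c1 : R := @epoch_cost R d B.
have c0_ge0 : 0 <= c0.
  apply: mulr_ge0 => //; apply: ln_ge0; rewrite -[1]mulr1; apply: ler_pM => //.
  by rewrite -[1]mulr1; apply: ler_pM => //; [lra|rewrite exprn_ege1//; lra].
have c1_ge0 : 0 <= c1.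
  by rewrite addr_ge0// mulr_ge0// addr_ge0// !mulr_ge0// ltW.
exists (c0 + 2 * c1 + 1); first by lra.
move=> p hp dT T P X hX m t m1 /andP[mt tm].
have ev (j : nat) := @laplace_event R d B p hp dT T P X hX (gridN j) (@epoch_start d j) (2 ^ m)%:R.
have [F hF] := choice ev.
exists (\big[setU/set0]_(1 <= j < m.+1) F j); split.
- by apply: bigsetU_measurable => j _; have [] := hF j.
- apply: (le_trans (measure_finite_union_le P _ _ _)) => [j|]; first by have [] := hF j.
  apply: (@le_trans _ _ (\sum_(1 <= j < m.+1) (expR (- (2 ^ m)%:R))%:E)%E).
    by apply: lee_sum => j _; have [] := hF j.
  by rewrite sumEFin sumr_const_nat subSS subn0 mulr_natl.
move=> om nF inbox.
have good j : (1 <= j <= m)%N ->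
    laplace_good p (fun i => X i om) (gridN j) (@epoch_start d j) (2 ^ m)%:R.
  move=> jm; have [_ _] := hF j; apply => Fj; apply: nF.
  rewrite -bigcup_seq; exists j => //=; rewrite mem_index_iota; lia.
have dt : (d <= t <= t)%N.
  rewrite leqnn andbT; apply: leq_trans mt; rewrite -(prednK m1).
  by apply: leq_d_epoch_start.
have mtm : (@epoch_start d m <= t <= @epoch_start d m.+1)%N by rewrite mt.
apply: le_trans (regret_path B1 hp inbox (ler0n _ _) dt mtm good).
apply: ler_wpM2r.
  by apply: prodr_ge0 => i _; exact: (p_ge0 hp).
rewrite ler_expR lerN2 big_split /= -mulr_sumr -/c0 -/c1.
rewrite sumr_const_nat subSS subn0 -[_ *+ m]mulr_natl.
set Q : R := (2 ^ (m * (d + 2)))%:R.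
have Q1 : 1 <= Q by rewrite (ler_nat R 1) expn_gt0.
have d2 : (1 <= d + 2)%N by rewrite addn_gt0 orbT.
have geo := sum_geometric_le R m d2; rewrite -/Q in geo.
have mm : m%:R * (2 ^ m)%:R <= Q.
  rewrite -natrM ler_nat; apply: (@leq_trans (2 ^ m * 2 ^ m)%N).
    by rewrite leq_mul2r; apply/orP; right; exact/ltnW/ltn_expl.
  by rewrite -expnD leq_exp2l//; nia.
have g1 := ler_wpM2l c1_ge0 geo.
have g2 := ler_wpM2l c0_ge0 Q1.
rewrite mulr1 in g2; apply: le_trans (lerD g2 (lerD g1 mm)) _.
by rewrite le_eqVlt; apply/orP; left; apply/eqP; ring.
Qed.

(** * Existence of the log-concave maximum likelihood estimate *)

Section compactness.
Context {R : realType} {n : nat}.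
Implicit Types (g : 'rV[R]_n -> R).

Lemma continuous_linear_form (a : 'I_n -> R) :
  continuous (fun l : 'rV[R]_n => \sum_s l ord0 s * a s).
Proof.
apply: continuous_big => [|s _ l]; first exact: add_continuous.
apply: (@continuous_comp _ _ _ (fun l : 'rV[R]_n => l ord0 s) (fun z => z * a s)).
  exact: coord_continuous.
exact: mulrr_continuous.
Qed.

(** Compact sets of the form needed for maximisation: one inequality [g l <= 0]
    encodes all further constraints. *)
Definition cube_constraint (a b : R) g : set 'rV[R]_n :=
  [set l : 'rV[R]_n | (forall s, a <= l ord0 s <= b) /\ g l <= 0].

Lemma compact_cube_constraint (a b : R) g : continuous g -> compact (cube_constraint a b g).
Proof.
move=> cg; have -> : cube_constraint a b g =
    [set l : 'rV[R]_n | forall s, `[a, b]%classic (l ord0 s)] `&` g @^-1` [set y : R | y <= 0].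
  by apply/seteqP; split=> l [h1 h2]; split.
apply: compact_closedI; last by apply: preimage_closed => [l _|]; [exact: cg|exact: closed_le].
by apply: (@rV_compact _ _ (fun=> `[a, b]%classic)) => s; exact: segment_compact.
Qed.

Lemma cube_constraint_max (a b : R) g (f : 'rV[R]_n -> R) : continuous g -> continuous f ->
  cube_constraint a b g !=set0 ->
  exists2 l, cube_constraint a b g l & forall m, cube_constraint a b g m -> f m <= f l.
Proof.
move=> cg cf ne.
have [|l lA lmax] := EVT_max_rV ne (compact_cube_constraint (a := a) (b := b) cg) (f := f).
  exact: continuous_subspaceT.
exists l; first by rewrite inE in lA.
by move=> m mA; apply: lmax; rewrite inE.
Qed.

End compactness.

Lemma log_concave_jensen (R : realType) (d : nat) (f : d.-tuple R -> R) (I : Type)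
    (w : I -> R) (x : I -> d.-tuple R) (s : seq I) : log_concave f ->
  (forall j, 0 <= w j) -> (forall j, 0 < f (x j)) -> 0 < \sum_(j <- s) w j ->
  expR ((\sum_(j <- s) w j * ln (f (x j))) / \sum_(j <- s) w j) <=
  f [tuple (\sum_(j <- s) w j * tnth (x j) i) / \sum_(j <- s) w j | i < d].
Proof.
move=> cf w0 fx; elim: s => [|j s IH]; first by rewrite big_nil ltxx.
rewrite !big_cons; set W := \sum_(k <- s) w k in IH *; set L := \sum_(k <- s) w k * ln _ in IH *.
have W0 : 0 <= W by exact: sumr_ge0.
move=> wW; have [W_gt0|W_le0] := ltP 0 W; last first.
  have WE : W = 0 by apply/eqP; rewrite eq_le W_le0.
  have all0 (F : I -> R) : \sum_(k <- s) w k * F k = 0.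
    elim: (s) (WE : \sum_(k <- s) w k = 0) => [|k s' IHs]; first by rewrite !big_nil.
    rewrite !big_cons => e0; have sw : 0 <= \sum_(j <- s') w j by exact: sumr_ge0.
    have /andP[/eqP wk /eqP e] : (w k == 0) && (\sum_(j <- s') w j == 0).
      by rewrite -paddr_eq0// e0.
    by rewrite wk mul0r add0r; exact: IHs.
  have -> : L = 0 by exact: all0.
  have wj : 0 < w j by rewrite WE addr0 in wW.
  rewrite WE !addr0 mulrAC divff ?mul1r ?gt_eqF// lnK ?posrE//.
  rewrite le_eqVlt; apply/orP; left; apply/eqP; congr f.
  apply: eq_from_tnth => i; rewrite tnth_mktuple big_cons all0 addr0 mulrAC divff ?mul1r//.
  by rewrite gt_eqF.
set y := [tuple _ | i < d] in IH; have {}IH := IH W_gt0.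
have fy : 0 < f y by apply: lt_le_trans IH; exact: expR_gt0.
pose sg := w j / (w j + W).
have s01 : 0 <= sg <= 1.
  by rewrite divr_ge0 ?(ltW wW)//= ler_pdivrMr// mul1r lerDl.
have -> : [tuple (\sum_(k <- j :: s) w k * tnth (x k) i) / (w j + W) | i < d] =
    comb sg (x j) y.
  apply: eq_from_tnth => i; rewrite tnth_comb !tnth_mktuple big_cons /sg -/W.
  by field; rewrite !gt_eqF.
apply: le_trans (cf _ _ _ s01 (fx j) fy); rewrite ler_expR.
have Ly : L / W <= ln (f y) by rewrite -[leLHS]expRK ler_ln ?posrE ?expR_gt0.
have -> : (w j * ln (f (x j)) + L) / (w j + W) = sg * ln (f (x j)) + (1 - sg) * (L / W).
  by rewrite /sg; field; rewrite !gt_eqF.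
by rewrite lerD2l; apply: ler_wpM2l => //; rewrite subr_ge0; case/andP: s01.
Qed.

Section tent.
Context {R : realType} {d t : nat}.
Variable xs : t.-tuple (d.-tuple R).
Implicit Types (l : 'rV[R]_t) (y : 'I_t -> R) (x : d.-tuple R).

Definition bary l : d.-tuple R :=
  [tuple \sum_s l ord0 s * tnth (tnth xs s) i | i < d].

Definition height y l : R := \sum_s l ord0 s * y s.

Definition weights l : Prop := (forall s, 0 <= l ord0 s) /\ \sum_s l ord0 s = 1.

Definition highest y x l : Prop := [/\ weights l, bary l = x &
  forall m, weights m -> bary m = x -> height y m <= height y l].

(** The smallest log-concave function with value at least [expR (y s)] at every
    sample point. *)
Definition tent y x : R :=
  if `[< exists l, highest y x l >] then expR (height y (xget 0 (highest y x))) else 0.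

(** Its vanishing says that the entries of [l] sum to one and that the barycentre
    is [x]; the factor 1 makes the first term an instance of
    [continuous_abs_form]. *)
Definition hull_gap x l : R :=
  `|\sum_s l ord0 s * 1 - 1| +
  \sum_(i < d) `|\sum_s l ord0 s * tnth (tnth xs s) i - tnth x i|.

Lemma continuous_abs_form (a : 'I_t -> R) (c : R) :
  continuous (fun l : 'rV[R]_t => `|\sum_s l ord0 s * a s - c|).
Proof.
move=> l; apply: (@continuous_comp _ _ _
  (fun l : 'rV[R]_t => \sum_s l ord0 s * a s) (fun z => `|z - c|)).
  exact: continuous_linear_form.
by apply: cvg_norm; apply: cvgB; [exact: cvg_id|exact: cvg_cst].
Qed.

Lemma continuous_hull_gap x : continuous (hull_gap x).
Proof.
pose g (l : 'rV[R]_t) := \sum_(i < d) `|\sum_s l ord0 s * tnth (tnth xs s) i - tnth x i|.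
have cg : continuous g.
  apply: continuous_big => [|i _]; first exact: add_continuous.
  exact: continuous_abs_form.
move=> l; have h1 := @continuous_abs_form (fun=> 1) 1 l.
exact: (cvgD h1 (cg l)).
Qed.

Lemma weights_le1 l s : weights l -> 0 <= l ord0 s <= 1.
Proof.
move=> [l0 l1]; rewrite l0 /= -l1 (bigD1 s)//= lerDl; exact: sumr_ge0.
Qed.

Lemma hull_gapP x l : (cube_constraint 0 1 (hull_gap x)) l <->
  weights l /\ bary l = x.
Proof.
have s0 : 0 <= \sum_(i < d) `|\sum_s l ord0 s * tnth (tnth xs s) i - tnth x i|.
  by apply: sumr_ge0.
have sE : \sum_s l ord0 s * 1 = \sum_s l ord0 s by apply: eq_bigr => s _; rewrite mulr1.
split=> [[l01]|[wl bl]].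
  rewrite /hull_gap => h.
  have /eqP : hull_gap x l = 0 by apply/eqP; rewrite eq_le h addr_ge0.
  rewrite paddr_eq0// normr_eq0 subr_eq0 sE => /andP[/eqP l1 /eqP b0].
  split; first by split=> // s; case/andP: (l01 s).
  apply: eq_from_tnth => i; rewrite tnth_mktuple; apply/eqP; rewrite -subr_eq0 -normr_eq0.
  by apply/eqP; apply: (psumr_eq0P _ b0).
split; first by move=> s; exact: weights_le1.
rewrite /hull_gap sE; case: wl => _ ->; rewrite subrr normr0 add0r big1// => i _.
by rewrite -bl tnth_mktuple subrr normr0.
Qed.

Lemma highest_exists y x l : weights l -> bary l = x -> exists m, highest y x m.
Proof.
move=> wl bl; have ne : cube_constraint 0 1 (hull_gap x) !=set0.
  by exists l; apply/hull_gapP.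
have [m /hull_gapP[wm bm] mmax] := cube_constraint_max (@continuous_hull_gap x)
  (@continuous_linear_form R t y) ne.
by exists m; split=> // m' wm' bm'; apply: mmax; apply/hull_gapP.
Qed.

Lemma tent_ge y l : weights l -> expR (height y l) <= tent y (bary l).
Proof.
move=> wl; have ex := highest_exists y wl erefl.
rewrite /tent asboolT//; have [_ _ max] := xgetPex 0 ex.
by rewrite ler_expR; exact: max.
Qed.

Lemma tent_gt0 y x : 0 < tent y x ->
  exists l, [/\ weights l, bary l = x & tent y x = expR (height y l)].
Proof.
rewrite /tent; case: asboolP => [ex _|]; last by rewrite ltxx.
by have [wl bl _] := xgetPex 0 ex; exists (xget 0 (highest y x)).
Qed.

Lemma tent_ge0 y x : 0 <= tent y x.
Proof. by rewrite /tent; case: ifP => _ //; exact: expR_ge0. Qed.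

End tent.

Section tent_properties.
Context {R : realType} {d t : nat}.
Variable xs : t.-tuple (d.-tuple R).
Implicit Types (l m : 'rV[R]_t) (y : 'I_t -> R) (x : d.-tuple R).

Lemma bary_comb s l m :
  bary xs (s *: l + (1 - s) *: m) = comb s (bary xs l) (bary xs m).
Proof.
apply: eq_from_tnth => i; rewrite tnth_comb !tnth_mktuple !mulr_sumr -big_split /=.
by apply: eq_bigr => j _; rewrite !mxE; ring.
Qed.

Lemma height_comb y s l m :
  height y (s *: l + (1 - s) *: m) = s * height y l + (1 - s) * height y m.
Proof.
rewrite /height !mulr_sumr -big_split /=.
by apply: eq_bigr => j _; rewrite !mxE; ring.
Qed.

Lemma weights_comb s l m : 0 <= s <= 1 -> weights l -> weights m ->
  weights (s *: l + (1 - s) *: m).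
Proof.
move=> /andP[s0 s1] [l0 l1] [m0 m1]; split=> [j|].
  by rewrite !mxE addr_ge0// mulr_ge0// subr_ge0.
under eq_bigr do rewrite !mxE.
by rewrite big_split /= -!mulr_sumr l1 m1 !mulr1 addrC subrK.
Qed.

Lemma tent_log_concave y : log_concave (tent xs y).
Proof.
move=> x x' s s01 /tent_gt0[l [wl <- ->]] /tent_gt0[m [wm <- ->]].
rewrite !expRK -height_comb -bary_comb; apply: tent_ge; exact: weights_comb.
Qed.

Definition vertex (j : 'I_t) : 'rV[R]_t := \row_i (i == j)%:R.

Lemma sum_vertex j (F : 'I_t -> R) : \sum_i vertex j ord0 i * F i = F j.
Proof.
rewrite (bigD1 j)//= mxE eqxx mul1r big1 ?addr0// => i /negbTE ij.
by rewrite mxE ij mul0r.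
Qed.

Lemma weights_vertex j : weights (vertex j).
Proof.
split=> [i|]; first by rewrite mxE.
by rewrite -[RHS](sum_vertex j (fun=> 1)); apply: eq_bigr => i _; rewrite mulr1.
Qed.

Lemma tent_sample y j : expR (y j) <= tent xs y (tnth xs j).
Proof.
have <- : height y (vertex j) = y j by exact: sum_vertex.
have e : bary xs (vertex j) = tnth xs j.
  by apply: eq_from_tnth => i; rewrite tnth_mktuple sum_vertex.
by rewrite -[tnth xs j]e; exact/tent_ge/weights_vertex.
Qed.

Lemma height_le y (c : R) l : weights l -> (forall j, y j <= c) -> height y l <= c.
Proof.
move=> [l0 l1] yc; apply: (@le_trans _ _ (\sum_s l ord0 s * c)).
  by apply: ler_sum => s _; rewrite ler_wpM2l.
by rewrite -mulr_suml l1 mul1r.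
Qed.

Lemma height_ge y (c : R) l : weights l -> (forall j, c <= y j) -> c <= height y l.
Proof.
move=> [l0 l1] yc; apply: (@le_trans _ _ (\sum_s l ord0 s * c)).
  by rewrite -mulr_suml l1 mul1r.
by apply: ler_sum => s _; rewrite ler_wpM2l.
Qed.

Lemma tent_le y (c : R) x : (forall j, y j <= c) -> tent xs y x <= expR c.
Proof.
move=> yc; have [h|h] := leP (tent xs y x) 0; first by apply: (le_trans h); exact: expR_ge0.
by have [l [wl _ ->]] := tent_gt0 h; rewrite ler_expR; exact: height_le.
Qed.

Lemma tent_shift y y' (e : R) x : (forall j, y' j <= y j + e) ->
  tent xs y' x <= expR e * tent xs y x.
Proof.
move=> yy; have [h|h] := leP (tent xs y' x) 0.
  by apply: (le_trans h); rewrite mulr_ge0 ?expR_ge0// tent_ge0.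
have [l [wl <- ->]] := tent_gt0 h.
apply: le_trans (ler_wpM2l (expR_ge0 e) (tent_ge xs y wl)).
rewrite -expRD ler_expR /height; apply: (@le_trans _ _ (\sum_s l ord0 s * (y s + e))).
  by apply: ler_sum => s _; rewrite ler_wpM2l//; case: wl.
under eq_bigr do rewrite mulrDr.
by rewrite big_split /= -mulr_suml; case: wl => _ ->; rewrite mul1r addrC.
Qed.

(** Jensen's inequality: the tent lies below every log-concave function that
    dominates it at the sample points. *)
Lemma tent_le_log_concave (f : d.-tuple R -> R) y x : log_concave f ->
  (forall z, 0 <= f z) -> (forall j, expR (y j) <= f (tnth xs j)) -> tent xs y x <= f x.
Proof.
move=> cf f0 fy; have [h|h] := leP (tent xs y x) 0; first exact: le_trans (f0 x).
have [l [[l0 l1] <- ->]] := tent_gt0 h.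
have fx j : 0 < f (tnth xs j) by apply: lt_le_trans (fy j); exact: expR_gt0.
have jen := @log_concave_jensen R d f 'I_t (fun j => l ord0 j) (tnth xs) (index_enum _) cf l0 fx.
rewrite l1 in jen; have {}jen := jen ltr01.
apply: le_trans (_ : f [tuple (\sum_j l ord0 j * tnth (tnth xs j) i) / 1 | i < d] <= _); last first.
  rewrite le_eqVlt; apply/orP; left; apply/eqP; congr f.
  by apply: eq_from_tnth => i; rewrite !tnth_mktuple divr1.
apply: le_trans jen; rewrite divr1 ler_expR; apply: ler_sum => j _.
by apply: ler_wpM2l => //; rewrite -[leLHS]expRK ler_ln ?posrE ?expR_gt0.
Qed.

Hypothesis inbox : forall s, box (tnth xs s).

Lemma bary_box l : weights l -> box (bary xs l).
Proof.
move=> wl i; rewrite tnth_mktuple.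
have b j : -1 <= tnth (tnth xs j) i <= 1 by exact: inbox.
apply/andP; split.
  by apply: (@height_ge (fun j => tnth (tnth xs j) i)) => // j; case/andP: (b j).
by apply: (@height_le (fun j => tnth (tnth xs j) i)) => // j; case/andP: (b j).
Qed.

Lemma tent_out y x : ~ box x -> tent xs y x = 0.
Proof.
move=> nx; apply/eqP; rewrite eq_le tent_ge0 andbT leNgt; apply/negP => /tent_gt0.
by move=> [l [wl e _]]; apply: nx; rewrite -e; exact: bary_box.
Qed.

Definition superlevel y (c : R) : set (d.-tuple R) :=
  [set x | exists l, [/\ weights l, bary xs l = x & c <= height y l]].

(** Superlevel sets of tents are compact, hence equal to the intersection of
    their grid approximations; the latter are finite unions of cells, and this
    makes the tent measurable. *)
Lemma superlevel_grid y c :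
  superlevel y c = \bigcap_N \big[setU/set0]_(k : {ffun 'I_d -> 'I_N.+1} |
    `[< touches (superlevel y c) (wd N) (gridc k) >]) gcell k.
Proof.
apply/seteqP; split=> x.
  move=> Kx N _; have [l [wl bl _]] := Kx.
  have bx : box x by rewrite -bl; exact: bary_box.
  have kx : gcell (cidx N x) x by apply/gcellP.
  rewrite (bigD1 (cidx N x))/=; first by left.
  by apply: asboolT; exists x => //; exact: gcell_sub_ccell.
move=> h; have touch N : exists z l, [/\ weights l, bary xs l = z, c <= height y l &
    forall i, `|tnth z i - tnth x i| <= wd N].
  have := h N I; rewrite -bigcup_seq_cond => -[k /andP[_ /asboolP[z [l [wl bl hl]] zk]] kx].
  exists z, l; split=> // i; have := zk i; have := gcell_sub_ccell kx i.
  rewrite /= !in_itv /= ler_norml => /andP[? ?] /andP[? ?]; apply/andP; split; lra.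
(* [gc l <= 0] says that [l] sums to one and has height at least [c]; [D] is the
   distance of its barycentre to [x]. *)
pose gc l : R := `|\sum_s l ord0 s * 1 - 1| +
   (c - height y l + `|\sum_s l ord0 s * y s - c|).
pose D l : R := \sum_(i < d) `|\sum_s l ord0 s * tnth (tnth xs s) i - tnth x i|.
have cgc : continuous gc.
  move=> l; have c1 := @continuous_abs_form R t (fun=> 1) 1 l.
  have c2 := @continuous_abs_form R t y c l.
  have c3 : {for l, continuous (fun l : 'rV[R]_t => c - height y l)}.
    exact: (cvgB (cvg_cst c) (@continuous_linear_form R t y l)).
  exact: (cvgD c1 (cvgD c3 c2)).
have cD0 : continuous D.
  apply: continuous_big => [|i _]; first exact: add_continuous.
  exact: continuous_abs_form.
have cD : continuous (fun l => - D l) by move=> l; exact: (cvgN (cD0 l)).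
have gcP l : cube_constraint 0 1 gc l <-> weights l /\ c <= height y l.
  have sE : \sum_s l ord0 s * 1 = \sum_s l ord0 s by apply: eq_bigr => s _; rewrite mulr1.
  have n2 : 0 <= c - height y l + `|\sum_s l ord0 s * y s - c|.
    rewrite -/(height y l); have := ler_norm (height y l - c); lra.
  split=> [[l01]|[wl hl]].
    rewrite /gc sE => hg; have n1 := normr_ge0 (\sum_s l ord0 s - 1).
    have /eqP : `|\sum_s l ord0 s - 1| = 0 by lra.
    rewrite normr_eq0 subr_eq0 => /eqP l1; split.
      by split=> // s; case/andP: (l01 s).
    rewrite -/(height y l) in hg n2; have := normr_ge0 (height y l - c).
    by move: (height y l) hg n2 => hh ? ? ?; lra.
  split; first by move=> s; exact: weights_le1.
  rewrite /gc sE; case: wl => _ ->; rewrite subrr normr0 add0r -/(height y l).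
  by rewrite ger0_norm ?subr_ge0//; lra.
have ne : cube_constraint 0 1 gc !=set0.
  by have [z [l [wl _ hl _]]] := touch 0%N; exists l; apply/gcP.
have [l /gcP[wl hl] lmin] := cube_constraint_max cgc cD ne.
exists l; split=> //; apply: contrapT => nb.
have D0 : 0 < D l.
  rewrite lt0r; apply/andP; split; last by apply: sumr_ge0.
  apply/eqP => e; apply: nb; apply: eq_from_tnth => i; rewrite tnth_mktuple.
  by apply/eqP; rewrite -subr_eq0 -normr_eq0; apply/eqP; apply: (psumr_eq0P _ e).
have [N hN] : exists N, d%:R * wd (R:=R) N < D l.
  exists (Num.truncn (2 * d%:R / D l)); rewrite /wd mulrA ltr_pdivrMr//.
  rewrite mulrC [D l * _]mulrC -ltr_pdivrMr// mulrC [d%:R * 2]mulrC.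
  have : 0 <= 2 * d%:R / D l by rewrite divr_ge0 ?mulr_ge0// ltW.
  by move/truncn_itv => /andP[_].
have [z [m [wm bm hm zx]]] := touch N.
have mA : cube_constraint 0 1 gc m by apply/gcP.
have := lmin m mA; rewrite /= lerN2 => Dm.
have : D m <= d%:R * wd N.
  apply: (@le_trans _ _ (\sum_(i < d) wd N)); last first.
    by rewrite sumr_const card_ord -[leLHS]mulr_natl.
  by apply: ler_sum => i _; have := zx i; rewrite -bm tnth_mktuple.
by move=> /(le_lt_trans)/(_ hN); rewrite ltNge Dm.
Qed.

End tent_properties.

Section tent_integral.
Context {R : realType} {d t : nat}.
Variable xs : t.-tuple (d.-tuple R).
Hypothesis inbox : forall s, box (tnth xs s).
Implicit Types (y : 'I_t -> R).
Local Notation leb := (@lebesgue_Rd R d).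

Lemma measurable_tent y : measurable_fun setT (tent xs y).
Proof.
apply: (measurability (@RGenCInfty.G R)) => [|/= _ [_] [r] -> <-].
  exact: RGenCInfty.measurableE.
rewrite setTI; have [r0|r0] := leP r 0.
  rewrite (_ : _ @^-1` _ = setT) //; apply/seteqP; split=> x //= _.
  by rewrite in_itv/= andbT; apply: (le_trans r0); exact: tent_ge0.
have -> : tent xs y @^-1` `[r, +oo[%classic = superlevel xs y (ln r).
  apply/seteqP; split=> x /=; rewrite in_itv /= andbT.
    move=> rx; have [l [wl bl e]] := tent_gt0 (lt_le_trans r0 rx).
    by exists l; split=> //; rewrite -ler_expR -e lnK ?posrE.
  move=> [l [wl <- h]]; apply: le_trans (tent_ge xs y wl).
  by rewrite -[leLHS]lnK ?posrE// ler_expR.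
rewrite (superlevel_grid inbox); apply: bigcapT_measurable => N.
by apply: bigsetU_measurable => k _; exact: measurable_gcell.
Qed.

Definition tent_mass y : R := fine (\int[leb]_x (tent xs y x)%:E).

Lemma integral_tent_le y c : (forall j, y j <= c) ->
  (\int[leb]_x (tent xs y x)%:E <= (expR c * 2 ^+ d)%:E)%E.
Proof.
move=> yc; have [[[u0 mu u1] _] k0] : logconcave_density (@uniform_density R d) /\
    0 <= expR c * 2 ^+ d by split; [exact: uniform_logconcave|rewrite mulr_ge0 ?expR_ge0 ?exprn_ge0].
have u0' x : setT x -> (0 <= (@uniform_density R d x)%:E)%E by rewrite lee_fin.
have mu' : measurable_fun setT (fun x => (@uniform_density R d x)%:E).
  exact/measurable_EFinP.
rewrite -[leRHS]mule1 -u1 -(ge0_integralZl_EFin leb measurableT u0' mu' k0).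
apply: ge0_le_integral => //.
- by move=> x _; rewrite lee_fin tent_ge0.
- by apply/measurable_EFinP; exact: measurable_tent.
- by apply/measurable_EFinP; apply: measurable_funM.
move=> x _; rewrite -EFinM lee_fin; have [bx|nx] := pselect (box x); last first.
  by rewrite (tent_out inbox)// mulr_ge0.
by rewrite uniform_densityE// mulfK ?gt_eqF ?exprn_gt0// tent_le.
Qed.

Lemma tent_massE y : (\int[leb]_x (tent xs y x)%:E)%E = (tent_mass y)%:E.
Proof.
have yc j : y j <= \sum_s `|y s|.
  apply: le_trans (ler_norm _) _; rewrite (bigD1 j)//= lerDl; exact: sumr_ge0.
rewrite /tent_mass fineK// ge0_fin_numE; last first.
  by apply: integral_ge0 => x _; rewrite lee_fin tent_ge0.
by apply: (le_lt_trans (integral_tent_le yc)); rewrite ltry.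
Qed.

Lemma tent_mass_le y c : (forall j, y j <= c) -> tent_mass y <= expR c * 2 ^+ d.
Proof. by move=> yc; rewrite -lee_fin -tent_massE; exact: integral_tent_le. Qed.

Lemma tent_mass_shift y y' e : (forall j, y' j <= y j + e) ->
  tent_mass y' <= expR e * tent_mass y.
Proof.
move=> yy; rewrite -lee_fin EFinM -!tent_massE.
have m z : measurable_fun setT (fun x => (tent xs z x)%:E).
  by apply/measurable_EFinP; exact: measurable_tent.
have t0 x : setT x -> (0 <= (tent xs y x)%:E)%E by rewrite lee_fin tent_ge0.
rewrite -(ge0_integralZl_EFin leb measurableT t0 (m y) (expR_ge0 e)).
apply: ge0_le_integral => //.
- by move=> x _; rewrite lee_fin tent_ge0.
- by apply: measurable_funeM; exact: m.
by move=> x _; rewrite -EFinM lee_fin; exact: tent_shift.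
Qed.

Lemma tent_mass_le1 (f : d.-tuple R -> R) y : logconcave_density f ->
  (forall j, expR (y j) <= f (tnth xs j)) -> tent_mass y <= 1.
Proof.
move=> lf fy; have /logconcave_densityP[[f0 mf f1] cf] := lf.
rewrite -lee_fin -tent_massE -[leRHS]f1; apply: ge0_le_integral => //.
- by move=> x _; rewrite lee_fin tent_ge0.
- by apply/measurable_EFinP; exact: measurable_tent.
- exact/measurable_EFinP.
by move=> x _; rewrite lee_fin; apply: tent_le_log_concave.
Qed.

(** The sample meets all the corner cubes of the box, so that its convex hull
    contains the central cube. *)
Hypothesis corners : forall sg : {ffun 'I_d -> bool}, exists s, forall i,
  if sg i then 3^-1 <= tnth (tnth xs s) i else tnth (tnth xs s) i <= - 3^-1.

Lemma central_cube_hull x : (forall i, - 3^-1 <= tnth x i <= 3^-1) ->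
  exists2 l, weights l & bary xs l = x.
Proof.
move=> hx; apply: (@convex_contains_box R d [set x | exists2 l, weights l & bary xs l = x]
  (fun=> - 3^-1) (fun=> 3^-1)) => //.
- by move=> i; lra.
- move=> z z' s s01 [l wl <-] [m wm <-].
  by exists (s *: l + (1 - s) *: m); [exact: weights_comb|exact: bary_comb].
- move=> sg; have [s hs] := corners sg; exists (tnth xs s) => //.
  exists (vertex s); first exact: weights_vertex.
  by apply: eq_from_tnth => i; rewrite tnth_mktuple sum_vertex.
Qed.

(** The tent has a value at least 1 somewhere and at least [expR (- kap)] on the
    central cube. *)
Lemma tent_mass_ge y (kap : R) s0 : 0 <= y s0 -> 1 <= kap -> (forall j, - kap <= y j) ->
  expR (-1) * (2 / 3 / kap) ^+ d <= tent_mass y.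
Proof.
move=> y0 k1 yk; rewrite -lee_fin -tent_massE -[X in X * _]mul1r.
have e0 : 0 < 2 / 3 :> R by lra.
apply: (@integral_ge_peak R d (tent xs y) (tnth xs s0) 1 kap (2 / 3) (fun=> 1)) => //.
- exact: tent_ge0.
- exact: measurable_tent.
- exact: tent_log_concave.
- by apply: le_trans (tent_sample xs y s0); rewrite -[leLHS]expR0 ler_expR.
move=> x hx; have [|l wl <-] := @central_cube_hull x.
  by move=> i; have := hx i; rewrite /= in_itv /= => /andP[? ?]; apply/andP; split; lra.
by rewrite mul1r; apply: le_trans (tent_ge xs y wl); rewrite ler_expR; exact: height_ge.
Qed.

Lemma tent_mass_gt0 y : 0 < tent_mass y.
Proof.
have [s0 _] := corners [ffun=> true].
pose a := \sum_s `|y s|; have ya j : - a <= y j <= a.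
  rewrite -ler_norml /a (bigD1 j)//= lerDl; exact: sumr_ge0.
have h1 : expR (-1) * (2 / 3 / 1) ^+ d <= tent_mass (fun j => y j + a).
  apply: (@tent_mass_ge _ 1 s0) => // [|j].
    by have /andP[? ?] := ya s0; lra.
  by have /andP[? ?] := ya j; lra.
have h2 : tent_mass (fun j => y j + a) <= expR a * tent_mass y by exact: tent_mass_shift.
have : 0 < expR a * tent_mass y.
  apply: lt_le_trans h2; apply: lt_le_trans h1.
  by rewrite mulr_gt0 ?expR_gt0// exprn_gt0//; lra.
by rewrite pmulr_rgt0// expR_gt0.
Qed.

Definition normalized_tent y x : R := tent xs y x / tent_mass y.

Lemma normalized_tent_logconcave y : logconcave_density (normalized_tent y).
Proof.
have m0 := tent_mass_gt0 y; have mt := measurable_tent y.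
apply/logconcave_densityP; split.
  split.
  - by move=> x; rewrite divr_ge0 ?tent_ge0// ltW.
  - by apply: measurable_funM.
  transitivity (((tent_mass y)^-1)%:E * \int[leb]_x (tent xs y x)%:E)%E.
    have t0 x : setT x -> (0 <= (tent xs y x)%:E)%E by rewrite lee_fin tent_ge0.
    have mt' : measurable_fun setT (fun x => (tent xs y x)%:E).
      exact/measurable_EFinP.
    have i0 : 0 <= (tent_mass y)^-1 by rewrite invr_ge0 ltW.
    rewrite -(ge0_integralZl_EFin leb measurableT t0 mt' i0).
    by apply: eq_integral => x _; rewrite -EFinM mulrC.
  by rewrite tent_massE -EFinM mulVf// gt_eqF.
move=> x z s s01; rewrite /normalized_tent => hx hz.
have tx : 0 < tent xs y x by move: hx; rewrite pmulr_lgt0 ?invr_gt0.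
have tz : 0 < tent xs y z by move: hz; rewrite pmulr_lgt0 ?invr_gt0.
have := tent_log_concave s01 tx tz; rewrite -(ler_pM2r (_ : 0 < (tent_mass y)^-1)) ?invr_gt0//.
apply: le_trans; rewrite -[X in _ <= _ * X]lnK ?posrE ?invr_gt0// -expRD ler_expR.
rewrite !ln_div ?posrE// lnV ?posrE//; lra.
Qed.

(** The log-likelihood of the normalised tent if the tent attains the prescribed
    heights at the sample, and a lower bound for it otherwise. *)
Definition objective (v : 'rV[R]_t) : R :=
  \sum_s v ord0 s - t%:R * ln (tent_mass (fun s => v ord0 s)).

Lemma objective_lipschitz (v v' : 'rV[R]_t) e : (forall s, `|v ord0 s - v' ord0 s| <= e) ->
  objective v - objective v' <= 2 * t%:R * e.
Proof.
move=> vv; rewrite /objective.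
have h1 : \sum_s v ord0 s - \sum_s v' ord0 s <= t%:R * e.
  rewrite -sumrB; apply: (@le_trans _ _ (\sum_(s < t) e)).
    by apply: ler_sum => s _; apply: le_trans (ler_norm _) (vv s).
  by rewrite sumr_const card_ord mulr_natl.
have h2 : ln (tent_mass (fun s => v' ord0 s)) - ln (tent_mass (fun s => v ord0 s)) <= e.
  rewrite lerBlDr.
  have h : tent_mass (fun s => v' ord0 s) <= expR e * tent_mass (fun s => v ord0 s).
    by apply: tent_mass_shift => j; have := vv j; rewrite ler_norml => /andP[? ?]; lra.
  have e0 := tent_mass_gt0 (fun s => v ord0 s).
  rewrite -[X in X + _](expRK e) -lnM ?posrE ?expR_gt0// ler_ln ?posrE ?tent_mass_gt0//.
  by rewrite mulr_gt0 ?expR_gt0.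
have t0 : 0 <= t%:R :> R by [].
have h3 := ler_wpM2l t0 h2; rewrite mulrBr in h3.
move: h1 h3; move: (\sum_s v ord0 s) (\sum_s v' ord0 s) (t%:R : R).
move: (ln (tent_mass (fun s => v ord0 s))) (ln (tent_mass (fun s => v' ord0 s))).
by clear=> m m' a b c h1 h3; lra.
Qed.

Lemma continuous_objective : continuous objective.
Proof.
move=> v A /= /(nbhs_ballP (objective v))[e /= e0 eA].
have r0 : 0 < e / 2 / (2 * t%:R + 1) by rewrite !divr_gt0// ltr_wpDl// mulr_ge0.
apply/nbhs_ballP; exists (e / 2 / (2 * t%:R + 1)) => //= v' [_ vv']; apply: eA.
have close s : `|v ord0 s - v' ord0 s| <= e / 2 / (2 * t%:R + 1) by apply/ltW/vv'.
have e1 : 2 * t%:R * (e / 2 / (2 * t%:R + 1)) <= e / 2.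
  rewrite mulrA ler_pdivrMr; last by rewrite ltr_wpDl// mulr_ge0.
  by rewrite mulrC ler_wpM2l ?divr_ge0 ?(ltW e0)// lerDl.
suff : `|objective v - objective v'| <= e / 2.
  by rewrite /ball /= => h; apply: (le_lt_trans h); lra.
rewrite ler_norml; apply/andP; split.
  rewrite lerNl opprB; apply: le_trans e1; apply: objective_lipschitz => s.
  by rewrite distrC.
by apply: le_trans e1; exact: objective_lipschitz.
Qed.

Lemma loglik_pos (f : d.-tuple R -> R) : (forall s, 0 < f (tnth xs s)) ->
  loglik xs f = (\sum_s ln (f (tnth xs s)))%:E.
Proof. by move=> f0; rewrite /loglik -sumEFin; apply: eq_bigr => s _; rewrite lne_EFin. Qed.

Lemma objective_le_loglik v :
  ((objective v)%:E <= loglik xs (normalized_tent (fun s => v ord0 s)))%E.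
Proof.
set y := fun s => _; have m0 := tent_mass_gt0 y.
have ts s : 0 < tent xs y (tnth xs s).
  by apply: lt_le_trans (tent_sample xs y s); exact: expR_gt0.
rewrite loglik_pos => [|s]; last by rewrite divr_gt0.
rewrite lee_fin /objective -[t in t%:R]card_ord mulr_natl -sumr_const -sumrB.
apply: ler_sum => s _; rewrite ln_div ?posrE// lerD2r.
by rewrite -[leLHS]expRK ler_ln ?posrE ?expR_gt0// tent_sample.
Qed.

(** If the heights have maximum 0 and minimum [- kap], the sum of the heights
    is at most [- kap], whereas the logarithm of the mass is at least of order
    [- d * ln kap]. *)
Lemma objective_far : exists2 kap, 0 <= kap & forall v : 'rV[R]_t,
  (forall s, v ord0 s <= 0) -> (exists s, v ord0 s = 0) ->
  (exists s, v ord0 s < - kap) -> objective v <= objective 0.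
Proof.
have [s1 _] := corners [ffun=> true].
have t0 : 0 < t%:R :> R by rewrite ltr0n; case: (s1) => m; exact: leq_trans.
pose a : R := 6 * t%:R * (d%:R + 1); have a0 : 0 < a by rewrite !mulr_gt0// ltr_wpDl.
pose c := t%:R * (1 + d%:R * (ln a + ln 2)).
exists (2 * `|c| + 1) => [|v v0 [s0 vs0] [s2 vs2]].
  by rewrite addr_ge0// mulr_ge0.
have [smin _ hmin] := @arg_minP _ _ _ s0 xpredT (fun s => v ord0 s) isT.
pose kap := - v ord0 smin.
have kapc : 2 * `|c| + 1 < kap by rewrite /kap ltrNr; apply: le_lt_trans vs2; exact: hmin.
have k1 : 1 <= kap by have := normr_ge0 c; lra.
have k0 : 0 < kap by lra.
have mass : expR (-1) * (2 / 3 / kap) ^+ d <= tent_mass (fun s => v ord0 s).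
  apply: (@tent_mass_ge _ kap s0) => //; first by rewrite vs0.
  by move=> j; rewrite /kap opprK; exact: hmin.
have q0 : 0 < 2 / 3 / kap by rewrite !divr_gt0.
have lnmass : - 1 - d%:R * ln (3 / 2 * kap) <= ln (tent_mass (fun s => v ord0 s)).
  rewrite -ler_expR lnK ?posrE ?tent_mass_gt0//; apply: le_trans mass.
  rewrite expRD; apply: ler_wpM2l; first exact: expR_ge0.
  rewrite -mulrN -lnV ?posrE ?mulr_gt0// expRM_natl lnK ?posrE ?invr_gt0 ?mulr_gt0//.
  rewrite le_eqVlt; apply/orP; left; apply/eqP; congr (_ ^+ _); field.
  by rewrite gt_eqF.
have mass0 : ln (tent_mass (fun s => (0 : 'rV[R]_t) ord0 s)) <= d%:R * ln 2.
  rewrite -ler_expR lnK ?posrE ?tent_mass_gt0// expRM_natl lnK ?posrE//.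
  rewrite -[leRHS]mul1r -[X in X * _]expR0; apply: tent_mass_le => j.
  by rewrite mxE.
have sum_le : \sum_s v ord0 s <= - kap.
  rewrite (bigD1 smin)//= /kap opprK gerDl; apply: sumr_le0 => s _; exact: v0.
have lnk : ln (3 / 2 * kap) <= 3 / 2 * kap / a - 1 + ln a.
  have kk : 0 < 3 / 2 * kap by rewrite mulr_gt0.
  have -> : ln (3 / 2 * kap) = ln (3 / 2 * kap / a) + ln a.
    by rewrite -lnM ?posrE ?divr_gt0// divfK// gt_eqF.
  by rewrite lerD2r ln_le_subr1// divr_gt0.
rewrite /objective.
have -> : \sum_s (0 : 'rV[R]_t) ord0 s = 0 by rewrite big1// => s _; rewrite mxE.
have dn : 0 <= d%:R :> R by [].
have l1 := ler_wpM2l (ltW t0) lnmass; have l2 := ler_wpM2l (ltW t0) mass0.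
have l3 := ler_wpM2l (ltW t0) (ler_wpM2l dn lnk).
have l4 : t%:R * (d%:R * (3 / 2 * kap / a)) <= kap / 2.
  have -> : t%:R * (d%:R * (3 / 2 * kap / a)) = (d%:R / (d%:R + 1)) * (kap / 4).
    by rewrite /a; field; rewrite gt_eqF//= gt_eqF// ltr_wpDl.
  have u1 : d%:R / (d%:R + 1) <= 1 :> R by rewrite ler_pdivrMr ?ltr_wpDl// mul1r lerDl.
  have k4 : 0 <= kap / 4 by rewrite divr_ge0// ltW.
  apply: (le_trans (ler_wpM2r k4 u1)); clear - k0; lra.
have := ler_norm c; rewrite {1}/c => cc.
have l5 : 0 <= t%:R * d%:R :> R by rewrite mulr_ge0// ltW.
move: l1 l2 l3 l4 l5 cc sum_le kapc; move: (ln (tent_mass _)) (ln (tent_mass _)).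
move: (\sum_s v ord0 s) (`|c|) (ln (3 / 2 * kap)) (ln a) (3 / 2 * kap / a) (ln 2).
move: (t%:R : R) (d%:R : R) => T D S N L A E L2 m m0.
clear -T D S N L A E L2 m m0 kap; move: kap => {}kap; lra.
Qed.

(** Any log-concave density may be replaced by the tent over its values at the
    sample, with maximum height normalised to 0, so that it is enough to
    maximise over heights; those below [- kap] are excluded by
    [objective_far], and the rest is compact. *)
Lemma logconcave_mle_exists : exists f, is_mle logconcave_density xs f.
Proof.
have [kap kap0 far] := objective_far.
have [s1 _] := corners [ffun=> true].
have ne : cube_constraint (- kap) 0 (fun _ : 'rV[R]_t => 0) !=set0.
  by exists 0; split=> // s; rewrite mxE lexx andbT oppr_le0 kap0.
have c0 : continuous (fun _ : 'rV[R]_t => (0 : R)) by move=> v; apply: cst_continuous.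
have [v vA vmax] := cube_constraint_max c0 continuous_objective ne.
exists (normalized_tent (fun s => v ord0 s)); split.
  exact: normalized_tent_logconcave.
move=> f lf; apply: le_trans (objective_le_loglik v).
have f0 x : 0 <= f x by case: lf => -[+ _ _] _; exact.
have [pos|/existsNP[s ns]] := pselect (forall s, 0 < f (tnth xs s)); last first.
  rewrite /loglik (bigD1 s)// [lne _]le0_lneNy ?addNye ?leNye//.
  by rewrite lee_fin leNgt; apply/negP.
rewrite (loglik_pos pos) lee_fin.
pose y s := ln (f (tnth xs s)).
have [smax _ hmax] := @arg_maxP _ _ _ s1 xpredT y isT.
pose v' : 'rV[R]_t := \row_s (y s - y smax).
have v'0 s : v' ord0 s <= 0 by rewrite mxE subr_le0; exact: hmax.
have obj : \sum_s y s <= objective v'.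
  have m1 : tent_mass (fun s => v' ord0 s) <= expR (- y smax).
    rewrite -[leRHS]mulr1; apply: (@le_trans _ _ (expR (- y smax) * tent_mass y)).
      by apply: tent_mass_shift => j; rewrite mxE.
    apply: ler_wpM2l; first exact: expR_ge0.
    by apply: (tent_mass_le1 lf) => j; rewrite /y lnK ?posrE.
  have l1 : ln (tent_mass (fun s => v' ord0 s)) <= - y smax.
    by rewrite -[leRHS]expRK ler_ln ?posrE ?expR_gt0// tent_mass_gt0.
  rewrite /objective; have -> : \sum_s v' ord0 s = \sum_s y s - t%:R * y smax.
    under eq_bigr do rewrite mxE; rewrite sumrB; congr (_ - _).
    by rewrite sumr_const card_ord mulr_natl.
  have := ler_wpM2l (ler0n R t) l1; lra.
apply: (le_trans obj).
have [inA|/existsNP[s ns]] := pselect (forall s, - kap <= v' ord0 s).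
  by apply: vmax; split=> // s; rewrite inA v'0.
apply: le_trans (far v' v'0 _ _) _.
- by exists smax; rewrite mxE subrr.
- by exists s; rewrite ltNge; apply/negP.
- by apply: vmax; split=> // s'; rewrite mxE lexx andbT oppr_le0 kap0.
Qed.

End tent_integral.

(** * Samples that meet every corner of the box *)

Section corner_event.
Context {R : realType} {d : nat}.
Variables (B : R) (p : d.-tuple R -> R).
Hypotheses (B0 : 0 < B) (hp : box_lip_density B p).
Context {dT : measure_display} {T : measurableType dT}.
Variables (P : probability T R) (X : nat -> {RV P >-> d.-tuple R}).
Hypothesis hX : iid_with_density X p.

Definition corner_cell (sg : {ffun 'I_d -> bool}) : {ffun 'I_d -> 'I_3} :=
  [ffun i => if sg i then ord_max else ord0].

Lemma corner_cellP (sg : {ffun 'I_d -> bool}) (x : d.-tuple R) :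
  gcell (N := 2) (corner_cell sg) x ->
  forall i, if sg i then 3^-1 <= tnth x i else tnth x i <= - 3^-1.
Proof.
move=> /gcell_sub_ccell gx i; move: (gx i); rewrite /= /gridc ffunE /wd in_itv /=.
by case: (sg i) => /= /andP[h1 h2]; lra.
Qed.

(** Each of the [2 ^ d] corner cells of the grid with three cells per axis is
    missed by all observations with exponentially small probability. *)
Lemma corner_event t : exists E : set T, [/\ measurable E,
  (P E <= ((2 ^ d)%:R * expR (- (B^-1 * (2 / 3) ^+ d)) ^+ t)%:E)%E &
  forall om, ~ E om -> (forall i, (i < t)%N -> box (X i om)) /\
    forall sg : {ffun 'I_d -> bool}, exists2 i, (i < t)%N & forall j,
      if sg j then 3^-1 <= tnth (X i om) j else tnth (X i om) j <= - 3^-1].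
Proof.
pose Q (sg : {ffun 'I_d -> bool}) (k : {ffun 'I_t -> {ffun 'I_d -> 'I_3}}) :=
  [forall i, k i != corner_cell sg].
set r := expR _.
have [|E [mE PE hE]] := @cell_word_event R d B p hp dT T P X hX 2 t
  (fun k => [exists sg, Q sg k]) ((2 ^ d)%:R * r ^+ t).
  apply: (le_trans (sum_exists_le _ _)).
    by move=> k; apply: prodr_ge0 => i _; exact/ltW/(cell_mass_gt0 B0 hp).
  apply: (@le_trans _ _ (\sum_(sg : {ffun 'I_d -> bool}) r ^+ t)); last first.
    by rewrite sumr_const card_ffun card_ord card_bool -[leLHS]mulr_natl.
  apply: ler_sum => sg _.
  apply: (le_trans (cell_word_markov B0 hp
    (g := fun _ k => (k != corner_cell sg)%:R) _ _)) => [i k|k /forallP Qk|].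
  - exact: ler0n.
  - by rewrite big1// => i _; rewrite Qk.
  rewrite prodr_const card_ord lerXn2r ?nnegrE ?expR_ge0//.
    by apply: sumr_ge0 => k _; rewrite mulr_ge0// ltW// (cell_mass_gt0 B0 hp).
  apply: (@le_trans _ _ (1 - cell_mass p (corner_cell sg))).
    rewrite -[X in _ <= X - _](sum_cell_mass hp 2) (bigD1 (corner_cell sg))//= eqxx mulr0 add0r.
    rewrite [X in _ <= X - _](bigD1 (corner_cell sg))//= [X in _ <= X - _]addrC addrK.
    by apply: ler_sum => k ne; rewrite ne mulr1.
  apply: (le_trans _ (expR_ge1Dx _)); rewrite lerD2l lerN2.
  exact: (cell_mass_ge B0 hp (corner_cell sg)).
exists E; split=> // om /hE[inbox nQ]; split=> // sg.
move: nQ; rewrite negb_exists => /forallP/(_ sg).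
rewrite negb_forall => /existsP[i]; rewrite negbK ffunE => /eqP e.
exists i => //; apply: corner_cellP; apply/gcellP; split=> //; exact: inbox.
Qed.

End corner_event.

(** * Expected value of a random time *)

Section expected_time.
Context {R : realType} {dT : measure_display} {T : measurableType dT}.
Variable P : probability T R.

(** The integral of a nonnegative function is a supremum over the simple
    functions below it. *)
Lemma ge0_le_integral_nonmeasurable (f g : T -> \bar R) :
  (forall x, 0 <= f x)%E -> (forall x, f x <= g x)%E ->
  (\int[P]_x f x <= \int[P]_x g x)%E.
Proof.
move=> f0 fg; have g0 x : (0 <= g x)%E by exact: le_trans (f0 x) (fg x).
rewrite !ge0_integralTE//; apply: ereal_sup_le => _ [h hf <-].
by exists h => // x; exact: le_trans (hf x) (fg x).
Qed.

(** A time is at most [T0] plus the number of times [t >= T0] at which [F t]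
    occurs.  The bounds on the probabilities telescope. *)
Lemma integral_time_le (tau : T -> \bar R) (T0 : nat) (F : nat -> set T) (c : R) :
  0 <= c ->
  (forall w, 0 <= tau w)%E ->
  (forall t, measurable (F t)) ->
  (forall t, (T0 <= t)%N -> (P (F t) <= (c * ((t.+1)%:R^-1 - (t.+2)%:R^-1))%:E)%E) ->
  (forall t w, (T0 <= t)%N -> ~ F t w -> (tau w <= t%:R%:E)%E) ->
  (\int[P]_w tau w <= (T0%:R + c)%:E)%E.
Proof.
move=> c0 tau0 mF PF hF.
pose G t : set T := if (T0 <= t)%N then F t else set0.
have mG t : measurable (G t) by rewrite /G; case: ifP.
pose S (w : T) : \bar R := (\sum_(t <oo) (\1_(G t) w)%:E)%E.
have i0 t w : (0 <= (\1_(G t) w : R)%:E)%E by rewrite lee_fin indicE.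
have mi t : measurable_fun setT (fun w => (\1_(G t) w : R)%:E).
  by apply/measurable_EFinP; exact: measurable_indic.
have S0 w : (0 <= S w)%E by apply: nneseries_ge0 => t _ _; exact: i0.
have mS : measurable_fun setT S.
  by apply: ge0_emeasurable_sum => // t w _ _; exact: i0.
have key w : (tau w <= T0%:R%:E + S w)%E.
  have count n : (T0 <= n)%N -> (forall t, (T0 <= t < n)%N -> F t w) ->
      (n%:R%:E <= T0%:R%:E + S w)%E.
    move=> Tn Fn; have h : (\sum_(0 <= i < n) (\1_(G i) w)%:E <= S w)%E.
      by apply: nneseries_lim_ge => i _ _; exact: i0.
    apply: le_trans (leeD2l _ h); rewrite (big_cat_nat (leq0n T0) Tn)//= addeA.
    apply: (@le_trans _ _ (T0%:R%:E + \sum_(T0 <= i < n) 1)%E); last first.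
      apply: leeD; first by rewrite leeDl// sume_ge0// => t _; exact: i0.
      rewrite [leLHS]big_nat [leRHS]big_nat; apply: lee_sum => t tn.
      by rewrite indicE /G; case/andP: (tn) => -> _; rewrite mem_set//; exact: Fn.
    by rewrite sumEFin sumr_const_nat -EFinD lee_fin -natrD subnKC.
  have [[t1 [t1T nF]]|all] := pselect (exists t, (T0 <= t)%N /\ ~ F t w); last first.
    suff -> : S w = +oo%E by rewrite addey// leey.
    have Fn t : (T0 <= t)%N -> F t w by move=> Tt; apply: contrapT => nF; apply: all; exists t.
    case Sw: (S w) (S0 w) count => [r| |//] _ // count; exfalso.
    pose n := (T0 + (Num.truncn (T0%:R + `|r|)).+1)%N.
    have := count n (leq_addr _ _) (fun t h => Fn t (andP h).1).
    rewrite lee_fin leNgt => /negP; apply.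
    apply: (@le_lt_trans _ _ (T0%:R + `|r|)); first by rewrite lerD2l ler_norm.
    apply: (lt_le_trans (truncnS_gt _)); rewrite ler_nat; exact: leq_addl.
  have ex : exists t, (T0 <= t)%N && `[< ~ F t w >] by exists t1; rewrite t1T/=; apply/asboolP.
  case: (ex_minnP ex) => t /andP[tT /asboolP nt] tmin.
  apply: (le_trans (hF t w tT nt)); apply: count => // i /andP[Ti it].
  apply: contrapT => nFi; have := tmin i; rewrite Ti /= leqNgt it => h.
  by have : false by apply: h; apply/asboolP.
apply: (le_trans (ge0_le_integral_nonmeasurable tau0 key)).
rewrite ge0_integralD//.
rewrite integral_cst// [X in (_ * X + _)%E](_ : _ = 1%E); last exact: probability_setT.
rewrite mule1 EFinD leeD2l//.
rewrite /S integral_nneseries//.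
under eq_eseriesr do rewrite integral_indic// setIT.
apply: lime_le; first by apply: is_cvg_nneseries => t _ _; exact: measure_ge0.
apply: nearW => n.
apply: (@le_trans _ _ (\sum_(0 <= t < n) (c * ((t.+1)%:R^-1 - (t.+2)%:R^-1))%:E)%E).
  apply: lee_sum => t _; rewrite /G; case: ifPn => [/PF//|_].
  rewrite measure0 lee_fin mulr_ge0// subr_ge0 lef_pV2 ?posrE// ler_nat; lia.
rewrite sumEFin lee_fin -mulr_sumr ler_piMr//.
have -> : \sum_(0 <= t < n) ((t.+1)%:R^-1 - (t.+2)%:R^-1) = 1 - (n.+1)%:R^-1 :> R.
  under eq_bigr do rewrite -opprB.
  by rewrite sumrN (telescope_sumr (fun t => (t.+1)%:R^-1))// invr1 opprB.
by rewrite gerBl.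
Qed.

End expected_time.

(** * Rejection in late epochs *)

(** The likelihood of the estimate is at least that of the uniform density. *)
Lemma mle_gt0 (R : realType) (d t : nat) (xs : t.-tuple (d.-tuple R)) f :
  (forall s, box (tnth xs s)) -> is_mle logconcave_density xs f ->
  forall s, 0 < f (tnth xs s).
Proof.
move=> inbox [lf fmax] s.
have f0 x : 0 <= f x by case: lf => -[+ _ _] _; exact.
rewrite lt_neqAle f0 andbT eq_sym; apply/eqP => fs0.
have := fmax _ (@uniform_logconcave R d); apply/negP; rewrite -ltNge.
have -> : loglik xs f = -oo%E by rewrite /loglik (bigD1 s)// fs0 [lne _]le0_lneNy ?addNye.
rewrite loglik_pos ?ltNyr// => s'; rewrite uniform_densityE//.
Qed.

Section rejection.
Context {R : realType}.

(** The exponent is rounded up to the order of the gain to which the number of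
    brackets is compared in [rejection_after_epoch]. *)
Lemma word_count_le (A d m : nat) :
  ((A * 2 ^ m).+1 ^ ((2 ^ m) ^ d))%:R <= expR (A%:R * (2 ^ m)%:R ^+ (d + 2)) :> R.
Proof.
set x : R := (2 ^ m)%:R; have x1 : 1 <= x by rewrite (ler_nat R 1) expn_gt0.
have h : (A * 2 ^ m).+1%:R <= expR (A%:R * x).
  by apply: le_trans (expR_ge1Dx _); rewrite -natr1 natrM addrC.
rewrite natrX; apply: (@le_trans _ _ (expR (A%:R * x) ^+ ((2 ^ m) ^ d))).
  by rewrite lerXn2r// nnegrE// expR_ge0.
rewrite -expRM_natr natrX -/x ler_expR -mulrA -exprS ler_wpM2l//.
by rewrite ler_weXn2l//; lia.
Qed.

(** At least half of the first [epoch_start d m] observations enter the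
    statistic. *)
Lemma epoch_length (d m t : nat) : (1 <= m)%N -> (@epoch_start d m <= t)%N ->
  8 * (2 ^ m)%:R ^+ (d + 3) <= (t - d)%:R :> R.
Proof.
move=> m1 mt; rewrite -natrX -[8]/(8%:R) -natrM ler_nat -expnM.
have d2 : (d <= 2 ^ (m * (d + 3)))%N.
  apply: (@leq_trans (2 ^ d)%N); first exact/ltnW/ltn_expl.
  by rewrite leq_exp2l//; nia.
move: mt; rewrite /epoch_start; move: (2 ^ _)%N d2 => y; lia.
Qed.

(** The constant [C3] makes [uniform_likelihood_bound] applicable ([C1]) and its
    gain larger than the logarithm of the number of brackets ([A]), the regret
    ([D]) and the threshold [ln alpha^-1]; it also makes [2 ^ m] large enough
    for the corner cells to be met ([mu]). *)
Lemma rejection_after_epoch (d0 : nat) (B alpha : R) : 1 <= B -> 0 < alpha < 1 ->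
  exists C3 C4 : R, [/\ 0 < C3, 0 <= C4 &
  forall p : d0.+1.-tuple R -> R, box_lip_density B p ->
  forall (dT : measure_display) (T : measurableType dT) (P : probability T R)
    (X : nat -> {RV P >-> d0.+1.-tuple R}), iid_with_density X p ->
  forall phat : estimator_seq R d0.+1, logconcave_mle_seq phat ->
  forall m t : nat, (1 <= m)%N ->
  (@epoch_start d0.+1 m <= t <= @epoch_start d0.+1 m.+1)%N ->
  C3 / (2 ^ m)%:R <= hellinger_logconcave p ^+ 2 ->
  exists E : set T, [/\ measurable E,
    (P E <= (C4 * ((2 ^ m)%:R * expR (- (2 ^ m)%:R)))%:E)%E &
    forall om, ~ E om ->
      alpha^-1 <= ulr sieve_estimator phat (fun i => X i om) t]].
Proof.
move=> B1 /andP[a0 a1]; have B0 : 0 < B by lra.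
have [A [C1 [C2 [C1_gt0 C2_ge0 lik]]]] := uniform_likelihood_bound d0 B1.
have [D D0 reg] := regret_bound d0.+1 B1.
set d := d0.+1 in lik reg *.
pose mu : R := B^-1 * (2 / 3) ^+ d.
have mu0 : 0 < mu by rewrite mulr_gt0 ?invr_gt0// exprn_gt0//; lra.
have imu : 0 < 2 / mu by rewrite divr_gt0.
have la : 0 <= ln alpha^-1 by rewrite ln_ge0// invf_ge1// ltW.
pose C3 := C1 + A%:R + 1 + 2 / mu + D + ln alpha^-1.
have A0 : 0 <= A%:R :> R by [].
have C3A : A%:R + 1 <= C3 by rewrite /C3; lra.
have C3C1 : C1 <= C3 by rewrite /C3; lra.
have C3mu : 2 / mu <= C3 by rewrite /C3; lra.
have C3D : D + ln alpha^-1 <= C3 by rewrite /C3; lra.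
have C3_gt0 : 0 < C3 by lra.
clearbody C3.
exists C3, (2 + C2 + (2 ^ d)%:R); split=> //.
  by rewrite !addr_ge0.
move=> p hp dT T P X hX phat hphat m t m1 /andP[mt tm] hC.
set x : R := (2 ^ m)%:R in hC *.
have x1 : 1 <= x by rewrite (ler_nat R 1) expn_gt0.
have x0 : 0 < x by lra.
have dt : (d <= t)%N.
  apply: leq_trans mt; rewrite -(prednK m1); exact: leq_d_epoch_start.
set delta := hellinger_logconcave p in hC *.
have delta2 : delta ^+ 2 <= 2 by exact: delta_sqr_le2 (box_lip_is_density hp).
have n8 : 8 * x ^+ (d + 3) <= (t - d)%:R by exact: epoch_length.
set n := (t - d)%N in n8 *.
have xe : x ^+ (d + 3) = x ^+ (d + 2) * x by rewrite -exprSr addnS.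
have xx : x <= x ^+ (d + 2) by rewrite -[leLHS]expr1 ler_weXn2l//; lia.
set V := x ^+ (d + 2) in xe xx.
have V1 : 1 <= V by lra.
have V0 : 0 < V by lra.
have Vx : V <= V * x by rewrite ler_peMr// ltW.
have hC' : C3 <= delta ^+ 2 * x by rewrite -ler_pdivrMr.
have expo : C3 * V <= delta ^+ 2 / 8 * n%:R.
  apply: (@le_trans _ _ (delta ^+ 2 / 8 * (8 * x ^+ (d + 3)))); last first.
    by rewrite ler_wpM2l// divr_ge0// sqr_ge0.
  rewrite xe; have -> : delta ^+ 2 / 8 * (8 * (V * x)) = (delta ^+ 2 * x) * V.
    by move: (delta ^+ 2) => e; field.
  by rewrite ler_wpM2r// ltW.
have C1N : C1 / (gridN m).+1%:R <= delta ^+ 2.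
  apply: le_trans hC; rewrite gridNS -/x ler_pM2r ?invr_gt0//.
have [E1 [mE1 PE1 hE1]] := lik p hp dT T P X hX (gridN m) t dt C1N.
have mtm : (@epoch_start d m <= t <= @epoch_start d m.+1)%N by rewrite mt.
have [E2 [mE2 PE2 hE2]] := reg p hp dT T P X hX m t m1 mtm.
have [E3 [mE3 PE3 hE3]] := corner_event B0 hp hX t.
exists (E1 `|` E2 `|` E3); split.
- by apply: measurableU => //; exact: measurableU.
- apply: (le_trans (measureU2 _ _ _)) => //; first exact: measurableU.
  apply: (le_trans (leeD (measureU2 _ _ _) (lexx _))) => //.
  apply: (le_trans (leeD (leeD PE1 PE2) PE3)); rewrite -!EFinD lee_fin.
  rewrite gridNS -/delta -/n -/x -/mu.
  have ex0 : 0 <= expR (- x) by exact: expR_ge0.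
  have first : ((A * 2 ^ m).+1 ^ ((2 ^ m) ^ d))%:R *
      expR (- (delta ^+ 2 / 8) *+ n) <= expR (- x).
    apply: (@le_trans _ _ (expR (A%:R * V) * expR (- (C3 * V)))).
      rewrite ler_pM ?expR_ge0// ?word_count_le// ler_expR mulNrn lerN2.
      by rewrite -[leRHS]mulr_natr.
    rewrite -expRD ler_expR.
    have : (A%:R + 1) * V <= C3 * V by rewrite ler_wpM2r// ltW.
    rewrite mulrDl mul1r; lra.
  have second : expR (- 4^-1 *+ n) <= expR (- x).
    by rewrite ler_expR mulNrn lerN2 -[leRHS]mulr_natr; lra.
  have third : m%:R * expR (- x) <= x * expR (- x).
    by rewrite ler_wpM2r// ler_nat; exact/ltnW/ltn_expl.
  have fourth : expR (- mu) ^+ t <= expR (- x).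
    rewrite -expRM_natr ler_expR mulNr lerN2.
    have mux : 1 <= mu * x.
      rewrite -ler_pdivrMl// mulr1; have : C3 <= 2 * x.
        by apply: (le_trans hC'); rewrite ler_wpM2r// ltW.
      have -> : mu^-1 = (2 / mu) / 2 by field; rewrite gt_eqF.
      lra.
    have tx : x * x <= t%:R.
      apply: (@le_trans _ _ n%:R); last by rewrite ler_nat; exact: leq_subr.
      apply: le_trans n8; rewrite xe; apply: (@le_trans _ _ (V * x)).
        by rewrite ler_wpM2r// ltW.
      have : 0 <= V * x by rewrite mulr_ge0// ltW.
      lra.
    apply: (@le_trans _ _ (mu * (x * x))); last by rewrite ler_pM2l.
    by rewrite mulrA ler_peMl// ltW.
  have e1 : expR (- x) <= x * expR (- x) by rewrite ler_peMl.
  have s2 := ler_wpM2l C2_ge0 (le_trans second e1).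
  have s4 := ler_wpM2l (ler0n R (2 ^ d)) (le_trans fourth e1).
  apply: (le_trans (lerD (lerD (lerD (le_trans first e1) s2) third) s4)).
  by rewrite le_eqVlt; apply/orP; left; apply/eqP; ring.
move=> om /not_orP[/not_orP[/hE1[inbox upper] n2] /hE3[_ corner]].
have {hE2} lower := hE2 om n2 inbox.
set xs := sample (fun i => X i om) t.
have xsE (s : 'I_t) : tnth xs s = X s om by rewrite tnth_mktuple.
have xsbox s : box (tnth xs s) by rewrite xsE; exact: inbox.
have dt' : (d < t)%N.
  have : (0 < n%:R :> R).
    by apply: lt_le_trans n8; rewrite mulr_gt0// exprn_gt0.
  by rewrite ltr0n subn_gt0.
have mle : is_mle logconcave_density xs (phat t xs).
  apply: hphat => //; apply: logconcave_mle_exists => // sg.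
  have [i it hi] := corner sg; exists (Ordinal it) => j.
  by rewrite xsE; exact: hi.
have ph0 := mle_gt0 xsbox mle.
have phi0 i : (i < t)%N -> 0 < phat t xs (X i om).
  by move=> it; have := ph0 (Ordinal it); rewrite xsE.
rewrite /ulr leqNgt dt' /= -/xs big_split /= prodfV.
have Pphat : 0 < \prod_(d <= i < t) phat t xs (X i om).
  by rewrite big_nat; apply: prodr_gt0 => i /andP[_]; exact: phi0.
have Pp : 0 < \prod_(d <= i < t) p (X i om).
  by rewrite big_nat; apply: prodr_gt0 => i /andP[_ it]; exact: (p_gt0 B0 hp (inbox i it)).
rewrite ler_pdivlMr//; apply: le_trans lower.
have [lphat _] := mle.
apply: (le_trans (ler_wpM2l _ (upper _ lphat))); first by rewrite invr_ge0 ltW.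
rewrite mulrA; apply: ler_wpM2r; first exact: ltW.
rewrite -{1}[alpha^-1]lnK ?posrE ?invr_gt0// -expRD ler_expR.
rewrite mulNrn -[X in _ - X]mulr_natr.
have -> : (2 ^ (m * (d + 2)))%:R = V by rewrite expnM natrX.
have : (D + ln alpha^-1) * V <= C3 * V by rewrite ler_wpM2r// ltW.
have : ln alpha^-1 <= ln alpha^-1 * V by rewrite ler_peMr.
by rewrite mulrDl -/n -/delta; lra.
Qed.

End rejection.

(** * The expected rejection time *)

Section assembly.
Context {R : realType}.

Lemma epoch_exists (d m0 t : nat) : (@epoch_start d m0 <= t)%N ->
  exists2 m, (m0 <= m)%N & (@epoch_start d m <= t < @epoch_start d m.+1)%N.
Proof.
move=> m0t; have ex : exists m, (t < @epoch_start d m.+1)%N.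
  exists t; apply: (leq_trans (ltn_expl t (leqnn 2))).
  by rewrite /epoch_start -(expnD 2 4) leq_exp2l//; nia.
case: (ex_minnP ex) => m tm mmin.
have m0m : (m0 <= m)%N.
  rewrite leqNgt; apply/negP => mm0; have := @epoch_start_le d _ _ mm0; lia.
exists m => //; rewrite tm andbT.
have [->//|ne] := eqVneq m m0.
have mE : m.-1.+1 = m by lia.
by rewrite leqNgt; apply/negP; rewrite -{1}mE => /mmin; lia.
Qed.

(** The exponential beats every power of [2 ^ m], and [t] is at most such a
    power. *)
Lemma epoch_tail_summable (d : nat) (C4 : R) : 0 <= C4 -> exists2 C5 : R, 0 <= C5 &
  forall m t, (t < @epoch_start d m.+1)%N ->
  C4 * ((2 ^ m)%:R * expR (- (2 ^ m)%:R)) <= C5 * (t.+1%:R^-1 - t.+2%:R^-1).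
Proof.
move=> C40; pose r := (d + 3)%N; pose L : R := 16 * 2 ^+ r.
pose k := (r + r).+1.
have L0 : 0 < L by rewrite mulr_gt0// exprn_gt0.
exists (C4 * (2 * L * L * k`!%:R)); first by rewrite !mulr_ge0 ?(ltW L0).
move=> m t ht; rewrite -mulrA ler_wpM2l//.
set x : R := (2 ^ m)%:R; have x1 : 1 <= x by rewrite (ler_nat R 1) expn_gt0.
have tL : t.+1%:R <= L * x ^+ r.
  have -> : L * x ^+ r = (@epoch_start d m.+1)%:R.
    rewrite /epoch_start natrM /L /x -/r mulSn expnD natrM mulrA expnM !natrX.
    by [].
  by rewrite ler_nat.
have tL2 : t.+2%:R <= 2 * L * x ^+ r.
  have : 1 <= t.+1%:R :> R by rewrite (ler_nat R 1).
  rewrite -(natr1 t.+1) -mulrA; lra.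
have fac : x ^+ k <= k`!%:R * expR x.
  have := expR_ge1Dxn (r + r) (ltW (lt_le_trans ltr01 x1)).
  rewrite -ler_pdivrMl ?ltr0n ?fact_gt0// mulrC; lra.
have -> : t.+1%:R^-1 - t.+2%:R^-1 = (t.+1%:R * t.+2%:R)^-1 :> R.
  have : 0 < t.+1%:R :> R by [].
  rewrite -(natr1 t.+1); move: (t.+1%:R) => u u0; field.
  by apply/andP; split; rewrite gt_eqF//; lra.
rewrite ler_pdivlMr ?mulr_gt0// expRN mulrAC ler_pdivrMr ?expR_gt0//.
apply: (@le_trans _ _ (x * ((L * x ^+ r) * (2 * L * x ^+ r)))).
  apply: ler_wpM2l; first lra.
  exact: ler_pM.
have -> : x * ((L * x ^+ r) * (2 * L * x ^+ r)) = 2 * L * L * x ^+ k.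
  rewrite /k exprS exprD; move: (x ^+ r) => y; ring.
rewrite -[leRHS]mulrA; apply: ler_wpM2l => //.
by rewrite !mulr_ge0// ltW.
Qed.

(** The least [m] that works; its predecessor fails, which bounds [2 ^ m]. *)
Lemma first_good_epoch (C3 e : R) : 0 < C3 -> 0 < e <= 2 ->
  exists m, [/\ (1 <= m)%N, forall j, (m <= j)%N -> C3 / (2 ^ j)%:R <= e &
    (2 ^ m)%:R <= (2 * C3 + 4) / e].
Proof.
move=> C30 /andP[e0 e2].
have pow j : 0 < (2 ^ j)%:R :> R by rewrite ltr0n expn_gt0.
have ex : exists m, (1 <= m)%N && (C3 / (2 ^ m)%:R <= e).
  exists (Num.truncn (C3 / e)).+1; rewrite /= ler_pdivrMr// mulrC -ler_pdivrMr//.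
  apply: (le_trans (ltW (truncnS_gt _))); rewrite ler_nat; exact/ltnW/ltn_expl.
case: (ex_minnP ex) => m /andP[m1 hm] mmin; exists m; split=> // [j mj|].
  apply: le_trans hm; rewrite ler_pM2l// lef_pV2 ?posrE// ler_nat.
  by rewrite leq_exp2l.
rewrite ler_pdivlMr//; have [->|m2] := eqVneq m 1%N; first by rewrite expn1; lra.
have mE : m.-1.+1 = m by lia.
have : ~~ (C3 / (2 ^ m.-1)%:R <= e).
  apply/negP => h; have := mmin m.-1; rewrite h andbT; lia.
rewrite -ltNge ltr_pdivlMr// => h.
rewrite -mE expnS natrM; lra.
Qed.

Lemma expected_rejection_time (d0 : nat) (B alpha : R) : 1 <= B -> 0 < alpha < 1 ->
  exists2 C : R, 0 < C &
  forall p : d0.+1.-tuple R -> R, box_lip_density B p -> ~ logconcave_law p ->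
  forall (dT : measure_display) (T : measurableType dT) (P : probability T R)
    (X : nat -> {RV P >-> d0.+1.-tuple R}), iid_with_density X p ->
  forall phat : estimator_seq R d0.+1, logconcave_mle_seq phat ->
  (\int[P]_w rejection_time sieve_estimator phat alpha (fun i => X i w) <=
   (C * hellinger_logconcave p ^- (2 * (d0.+1 + 3)))%:E)%E.
Proof.
move=> B1 a01; have [C3 [C4 [C30 C40 rej]]] := rejection_after_epoch d0 B1 a01.
have B0 : 0 < B by lra.
set d := d0.+1 in rej *.
have [C5 C50 tail] := epoch_tail_summable d C40.
pose r := (d + 3)%N.
have K0 : 0 < 2 * C3 + 4 by lra.
have K1 : 0 < 16 * (2 * C3 + 4) ^+ r by rewrite mulr_gt0// exprn_gt0.
exists (16 * (2 * C3 + 4) ^+ r + C5 * 2 ^+ r).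
  by rewrite ltr_wpDr// mulr_ge0// exprn_ge0.
move=> p hp nlc dT T P X hX phat hphat.
have d_gt0 := delta_gt0 B0 hp nlc.
set e := hellinger_logconcave p ^+ 2.
have e0 : 0 < e by rewrite exprn_gt0.
have e2 : e <= 2 by exact: delta_sqr_le2 (box_lip_is_density hp).
have e02 : 0 < e <= 2 by rewrite e0.
have [m0 [m1 good m0le]] := first_good_epoch C30 e02.
have /choice[F hF] t : exists E : set T, measurable E /\ ((@epoch_start d m0 <= t)%N ->
    (P E <= (C5 * (t.+1%:R^-1 - t.+2%:R^-1))%:E)%E /\
    forall om, ~ E om -> alpha^-1 <= ulr sieve_estimator phat (fun i => X i om) t).
  have [m0t|_] := leqP (@epoch_start d m0) t; last by exists set0.
  have [m m0m mt] := epoch_exists m0t.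
  have mt' : (@epoch_start d m <= t <= @epoch_start d m.+1)%N.
    by case/andP: mt => -> /ltnW.
  have [E [mE PE hE]] := rej p hp dT T P X hX phat hphat m t (leq_trans m1 m0m) mt' (good m m0m).
  exists E; split=> // _; split=> //; apply: (le_trans PE); rewrite lee_fin.
  by apply: tail; case/andP: mt.
apply: (@le_trans _ _ ((@epoch_start d m0)%:R + C5)%:E).
  apply: (integral_time_le (F := F) C50).
  - move=> w; apply: le_ereal_inf_tmp => _ [t _ <-]; by rewrite lee_fin.
  - by move=> t; have [] := hF t.
  - by move=> t /(hF t).2[].
  - move=> t w tT nF; apply: ereal_inf_lbound; exists t => //; split.
      by apply: leq_trans tT; rewrite muln_gt0 expn_gt0.
    by have [_ ] := (hF t).2 tT; exact.
rewrite lee_fin exprM -/e -/r -exprVn mulrDl lerD//.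
  rewrite /epoch_start natrM -mulrA ler_wpM2l// expnM natrX -exprMn.
  by rewrite lerXn2r ?nnegrE// ltW// divr_gt0.
rewrite -mulrA -exprMn ler_peMr// exprn_ege1// ler_pdivlMr//; lra.
Qed.

End assembly.

Theorem corollary15 (R : realType) (d : nat) (B : R) (hd : (1 <= d)%N)
    (hB : 0 < B) :
  exists E : estimator_seq R d,
    [/\ sequential_estimator E, sieve_mle_seq E &
    forall alpha : R, 0 < alpha < 1 ->
    exists C k : R, [/\ 0 < C, 0 < k &
    forall p : d.-tuple R -> R,
      box_lip_density B p -> ~ logconcave_law p ->
    forall (dT : measure_display) (T : measurableType dT)
      (P : probability T R) (X : nat -> {RV P >-> d.-tuple R}),
      iid_with_density X p ->
    forall phat : estimator_seq R d, logconcave_mle_seq phat ->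
      (\int[P]_w rejection_time E phat alpha (fun i => X i w) <=
       (C * (hellinger_logconcave p) ^- (2 * (d + 3))
          * (1 + `| ln (hellinger_logconcave p) |) `^ k)%:E)%E]].
Proof.
case: d hd => // d0 _; exists sieve_estimator; split.
- exact: sieve_estimator_sequential.
- exact: sieve_estimator_mle.
move=> alpha a01.
have [B1|B1] := leP 1 B; last first.
  (* There is no such density [p]. *)
  exists 1, 1; split=> // p hp.
  by have := B_ge1 hB hp; rewrite leNgt B1.
have [C C0 bound] := expected_rejection_time d0 B1 a01.
exists C, 1; split=> // p hp nlc dT T P X hX phat hphat.
apply: (le_trans (bound p hp nlc dT T P X hX phat hphat)); rewrite lee_fin.
rewrite powRr1 ?addr_ge0// ler_peMr ?lerDl//.
by rewrite mulr_ge0 ?(ltW C0)// invr_ge0 exprn_ge0// ltW// (delta_gt0 hB hp nlc).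
Qed.
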